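(* Let $n>2$ and let $HH_n\subset OS_n$ be the subset formed of all the $n$-dimensional operator spaces which are Hilbertian and homogeneous. Then $HH_n$ is a non-separable subset of $OS_n$ for the distance $\delta_{cb}$.
   Context: An operator space is a closed subspace of $B(H)$ for some Hilbert space $H$. $OS_n$ is the set of all $n$-dimensional operator spaces, two spaces being identified if they are completely isometric. For $E,F\in OS_n$, $d_{cb}(E,F)=\inf\{\|u\|_{cb}\|u^{-1}\|_{cb}\}$ over all linear isomorphisms $u\colon E\to F$, where $\|\cdot\|_{cb}$ is the completely bounded norm, and $\delta_{cb}(E,F)=\log d_{cb}(E,F)$. An $n$-dimensional operator space $E$ is Hilbertian if it is isometric, as a Banach space, to $\ell_2^n$. An operator space $E$ is homogeneous if $\|u\|=\|u\|_{cb}$ for every bounded linear $u\colon E\to E$. *)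

(* Defs.v *)
From HB Require Import structures.
From mathcomp Require Import all_boot all_order all_algebra.
From mathcomp Require Import all_classical all_reals all_analysis.
From mathcomp Require Import complex.

Set Implicit Arguments.
Unset Strict Implicit.
Unset Printing Implicit Defensive.

Import Order.TTheory GRing.Theory Num.Theory.
Import numFieldNormedType.Exports.

Local Open Scope classical_set_scope.
Local Open Scope ring_scope.

(* Complex Hilbert spaces, of arbitrary dimension. The inner product is linear
   in its first argument and antilinear in the second. *)
Record hilbertSpace (R : realType) := HilbertSpace {
  hilbert_sort :> completeNormedModType R[i] ;
  hilbert_dot : {dot hilbert_sort for (@Num.conj R[i])} ;
  hilbert_normE : forall x, `|x| ^+ 2 = hilbert_dot x x }.

(* The library norm of a complex normed module is R[i]-valued; this is the same
   norm, R-valued. *)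
Definition rnorm (R : realType) (V : normedModType R[i]) (x : V) : R :=
  complex.Re `|x|.

(* The l^2 norm on the direct sum of k copies of V; for V = R[i] this is the
   norm of l_2^k. *)
Definition l2norm (R : realType) (V : normedModType R[i]) (k : nat)
    (xi : 'I_k -> V) : R :=
  Num.sqrt (\sum_i rnorm (xi i) ^+ 2).

(* An operator on H is a bare function H -> H (these form an R[i]-module for the
   pointwise operations), and B(H) is the set of the continuous linear ones. *)
Definition boundedOp (R : realType) (H : hilbertSpace R) : set (H -> H) :=
  [set T | linear T /\ continuous T].

Definition opnorm (R : realType) (H : hilbertSpace R) (T : H -> H) : \bar R :=
  ereal_sup [set (rnorm (T xi))%:E | xi in [set xi : H | rnorm xi <= 1]].

(* A k x k matrix of operators on H, acting on the direct sum of k copies of H;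
   its norm is the one of M_k(B(H)) = B(H^k). *)
Definition mxact (R : realType) (H : hilbertSpace R) (k : nat)
    (x : 'M[H -> H]_k) (xi : 'I_k -> H) : 'I_k -> H :=
  fun i => \sum_j x i j (xi j).

Definition mxopnorm (R : realType) (H : hilbertSpace R) (k : nat)
    (x : 'M[H -> H]_k) : \bar R :=
  ereal_sup [set (l2norm (mxact x xi))%:E
            | xi in [set xi : 'I_k -> H | l2norm xi <= 1]].

Definition mxover (R : realType) (H : hilbertSpace R) (E : set (H -> H))
    (k : nat) : set 'M[H -> H]_k :=
  [set x | forall i j, E (x i j)].
Arguments mxover {R H} E k.

Definition linear_subspace (R : realType) (H : hilbertSpace R)
    (E : set (H -> H)) : Prop :=
  E 0 /\ forall (a : R[i]) x y, E x -> E y -> E (a *: x + y).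

Definition norm_closed (R : realType) (H : hilbertSpace R)
    (E : set (H -> H)) : Prop :=
  forall T : H -> H, boundedOp T ->
    (forall e : R, 0 < e -> exists2 S, E S & (opnorm (T - S)%R < e%:E)%E) -> E T.

Definition operator_space (R : realType) (H : hilbertSpace R)
    (E : set (H -> H)) : Prop :=
  [/\ E `<=` @boundedOp R H, linear_subspace E & norm_closed E].

Definition has_dim (R : realType) (H : hilbertSpace R) (E : set (H -> H))
    (n : nat) : Prop :=
  exists b : 'I_n -> (H -> H),
    E = [set \sum_i c i *: b i | c in [set: 'I_n -> R[i]]] /\
    forall c : 'I_n -> R[i], \sum_i c i *: b i = 0 -> forall i, c i = 0.

Record opspace (R : realType) (n : nat) := OpSpace {
  os_hilbert : hilbertSpace R ;
  os_set :> set (os_hilbert -> os_hilbert) ;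
  os_operator_space : operator_space os_set ;
  os_dim : has_dim os_set n }.

(* Linear maps E -> F are represented by functions between the ambient spaces
   of operators; only their values on E matter. *)
Definition linear_map (R : realType) (H K : hilbertSpace R)
    (E : set (H -> H)) (F : set (K -> K)) (u : (H -> H) -> (K -> K)) : Prop :=
  (forall x, E x -> F (u x)) /\
  (forall (a : R[i]) x y, E x -> E y -> u (a *: x + y) = a *: u x + u y).

(* u : E -> F is a linear isomorphism, with inverse v. *)
Definition linear_iso (R : realType) (H K : hilbertSpace R)
    (E : set (H -> H)) (F : set (K -> K))
    (u : (H -> H) -> (K -> K)) (v : (K -> K) -> (H -> H)) : Prop :=
  [/\ linear_map E F u, linear_map F E v,
      forall x, E x -> v (u x) = x & forall y, F y -> u (v y) = y].

Definition map_norm (R : realType) (H K : hilbertSpace R)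
    (E : set (H -> H)) (u : (H -> H) -> (K -> K)) : \bar R :=
  ereal_sup [set opnorm (u x) | x in E `&` [set x | (opnorm x <= 1)%E]].

(* The norm of id_(M_k) (x) u : M_k(E) -> M_k(F). *)
Definition mxmap_norm (R : realType) (H K : hilbertSpace R)
    (E : set (H -> H)) (u : (H -> H) -> (K -> K)) (k : nat) : \bar R :=
  ereal_sup [set mxopnorm (map_mx u x)
            | x in mxover E k `&` [set x | (mxopnorm x <= 1)%E]].

Definition cb_norm (R : realType) (H K : hilbertSpace R)
    (E : set (H -> H)) (u : (H -> H) -> (K -> K)) : \bar R :=
  ereal_sup (range (mxmap_norm E u)).

Definition completely_isometric (R : realType) (n : nat) (E F : opspace R n)
    : Prop :=
  exists u v, linear_iso E F u v /\
    forall k (x : 'M[os_hilbert E -> os_hilbert E]_k), mxover E k x ->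
      mxopnorm (map_mx u x) = mxopnorm x.

Definition d_cb (R : realType) (n : nat) (E F : opspace R n) : \bar R :=
  ereal_inf [set (cb_norm E w.1 * cb_norm F w.2)%E
            | w in [set w | linear_iso E F w.1 w.2]].

Definition hilbertian (R : realType) (n : nat) (E : opspace R n) : Prop :=
  exists u : {linear 'rV[R[i]]_n -> (os_hilbert E -> os_hilbert E)},
    range u = E /\
    forall x : 'rV[R[i]]_n,
      opnorm (u x) = (l2norm (fun j => x 0 j : R[i]^o))%:E.

Definition homogeneous (R : realType) (n : nat) (E : opspace R n) : Prop :=
  forall u, linear_map E E u -> (map_norm E u < +oo)%E ->
    map_norm E u = cb_norm E u.

(* OS_n: its elements are the complete isometry classes. The library's [set T]
   is confined to a universe below the one of [opspace R n], so from here on sets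
   are plain predicates. *)
Record OS (R : realType) (n : nat) := MkOS {
  OS_mem : opspace R n -> Prop ;
  OS_memP : exists E, OS_mem = completely_isometric E }.

Definition OS_class (R : realType) (n : nat) (E : opspace R n) : OS R n :=
  MkOS (ex_intro _ E erefl).

Definition OS_repr (R : realType) (n : nat) (X : OS R n) : opspace R n :=
  projT1 (cid (OS_memP X)).

(* Independent of the choice of representatives, by [delta_cb_class] below. *)
Definition delta_cb (R : realType) (n : nat) (X Y : OS R n) : \bar R :=
  lne (d_cb (OS_repr X) (OS_repr Y)).

Definition HH (R : realType) (n : nat) (X : OS R n) : Prop :=
  exists E, [/\ X = OS_class E, hilbertian E & homogeneous E].

(* A has a countable subset D that is dense in A for the distance d. *)
Definition separable_subset (R : realType) (T : Type) (d : T -> T -> \bar R)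
    (A : T -> Prop) : Prop :=
  exists D : T -> Prop,
    [/\ forall x, D x -> A x,
        exists f : T -> nat, forall x y, D x -> D y -> f x = f y -> x = y &
        forall x, A x -> forall e : R, 0 < e ->
          exists2 y, D y & (d x y < e%:E)%E].

Lemma mxopnorm_ge0 (R : realType) (H : hilbertSpace R) (k : nat)
    (x : 'M[H -> H]_k) : (0 <= mxopnorm x)%E.
Proof.
apply: (@le_trans _ _ (l2norm (mxact x (fun=> 0)))%:E).
  by rewrite lee_fin sqrtr_ge0.
apply: ereal_sup_ubound; exists (fun=> 0) => //=.
rewrite /l2norm big1 ?sqrtr0 ?ler01// => i _.
by rewrite /rnorm normr0 expr0n.
Qed.

Lemma cb_norm_ge0 (R : realType) (H K : hilbertSpace R) (E : set (H -> H))
    (u : (H -> H) -> (K -> K)) : (0 <= cb_norm E u)%E.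
Proof.
apply: (@le_trans _ _ (mxmap_norm E u 0)); last by apply: ereal_sup_ubound; exists 0%N.
apply: (@le_trans _ _ (mxopnorm (map_mx u (\matrix_(i < 0, j < 0) id)))).
  exact: mxopnorm_ge0.
apply: ereal_sup_ubound; exists (\matrix_(i < 0, j < 0) id) => //; split=> [[]//|/=].
apply: ge_ereal_sup => _ [xi _ <-].
by rewrite lee_fin /l2norm big_ord0 sqrtr0 ler01.
Qed.

Lemma linear_map_comp (R : realType) (H K L : hilbertSpace R)
    (E : set (H -> H)) (F : set (K -> K)) (G : set (L -> L)) u v :
  linear_map E F u -> linear_map F G v -> linear_map E G (v \o u).
Proof.
move=> [EF ul] [FG vl]; split=> [x /EF/FG//|a x y Ex Ey /=].
by rewrite ul// vl//; exact: EF.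
Qed.

Lemma linear_iso_comp (R : realType) (H K L : hilbertSpace R)
    (E : set (H -> H)) (F : set (K -> K)) (G : set (L -> L)) u u' v v' :
  linear_iso E F u u' -> linear_iso F G v v' ->
  linear_iso E G (v \o u) (u' \o v').
Proof.
move=> [lu lu' uK u'K] [lv lv' vK v'K]; split=> [||x Ex|y Gy] /=.
- exact: linear_map_comp lu lv.
- exact: linear_map_comp lv' lu'.
- by rewrite vK ?uK//; exact: lu.1.
- by rewrite u'K ?v'K//; exact: lv'.1.
Qed.

Lemma completely_isometric_refl (R : realType) (n : nat) (E : opspace R n) :
  completely_isometric E E.
Proof.
exists id, id; split; first by split.
by move=> k x _; rewrite map_mx_id.
Qed.

Lemma completely_isometric_inv (R : realType) (H K : hilbertSpace R)
    (E : set (H -> H)) (F : set (K -> K)) u v :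
  linear_iso E F u v ->
  (forall k (x : 'M[H -> H]_k), mxover E k x ->
    mxopnorm (map_mx u x) = mxopnorm x) ->
  forall k (y : 'M[K -> K]_k), mxover F k y ->
    mxopnorm (map_mx v y) = mxopnorm y.
Proof.
move=> [_ lv _ vK] iu k y Fy.
rewrite -iu => [|i j]; last by rewrite mxE; exact: lv.1.
by congr mxopnorm; apply/matrixP => i j; rewrite !mxE vK.
Qed.

Lemma linear_iso_sym (R : realType) (H K : hilbertSpace R)
    (E : set (H -> H)) (F : set (K -> K)) u v :
  linear_iso E F u v -> linear_iso F E v u.
Proof. by case=> ? ? ? ?; split. Qed.

Lemma completely_isometric_sym (R : realType) (n : nat) (E F : opspace R n) :
  completely_isometric E F -> completely_isometric F E.
Proof.
move=> [u [v [iso iu]]]; exists v, u; split; first exact: linear_iso_sym.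
exact: completely_isometric_inv iso iu.
Qed.

Lemma completely_isometric_trans (R : realType) (n : nat)
    (E F G : opspace R n) :
  completely_isometric E F -> completely_isometric F G ->
  completely_isometric E G.
Proof.
move=> [u [u' [uiso iu]]] [v [v' [viso iv]]]; exists (v \o u), (u' \o v').
split=> [|k x Ex]; first exact: linear_iso_comp uiso viso.
have -> : map_mx (v \o u) x = map_mx v (map_mx u x).
  by apply/matrixP => i j; rewrite !mxE.
rewrite iv ?iu// => i j; rewrite mxE.
by case: uiso => lu _ _ _; exact: lu.1.
Qed.

Lemma cb_norm_comp_le (R : realType) (H H' K K' : hilbertSpace R)
    (E : set (H -> H)) (E' : set (H' -> H')) (F' : set (K' -> K')) w u z :
  linear_map E E' w -> linear_map E' F' u ->
  (forall k (x : 'M[H -> H]_k), mxover E k x ->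
    mxopnorm (map_mx w x) = mxopnorm x) ->
  (forall k (x : 'M[K' -> K']_k), mxover F' k x ->
    mxopnorm (map_mx z x : 'M[K -> K]_k) = mxopnorm x) ->
  (cb_norm E (z \o (u \o w)) <= cb_norm E' u)%E.
Proof.
move=> [EE' _] [EF' _] iw iz; apply: ge_ereal_sup => _ [k _ <-].
apply: (@le_trans _ _ (mxmap_norm E' u k)); last first.
  by apply: ereal_sup_ubound; exists k.
apply: ge_ereal_sup => _ [x [Ex x1] <-].
have -> : map_mx (z \o (u \o w)) x = map_mx z (map_mx u (map_mx w x)).
  by apply/matrixP => i j; rewrite !mxE.
rewrite iz => [|i j]; last by rewrite !mxE; apply/EF'/EE'.
apply: ereal_sup_ubound; exists (map_mx w x) => //; split=> [i j|/=].
  by rewrite mxE; exact: EE'.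
by rewrite iw.
Qed.

Lemma d_cb_le (R : realType) (n : nat) (E E' F F' : opspace R n) :
  completely_isometric E E' -> completely_isometric F F' ->
  (d_cb E F <= d_cb E' F')%E.
Proof.
move=> [w [w' [wiso iw]]] [z [z' [ziso iz]]].
have iw' := completely_isometric_inv wiso iw.
have iz' := completely_isometric_inv ziso iz.
apply: le_ereal_inf_tmp => _ [[u v] /= uiso <-].
have [lw _ _ _] := wiso; have [lz _ _ _] := ziso; have [lu lv _ _] := uiso.
apply: (@le_trans _ _
    (cb_norm E (z' \o (u \o w)) * cb_norm F (w' \o (v \o z)))%E).
  apply: ereal_inf_lbound; exists (z' \o (u \o w), w' \o (v \o z)) => //=.
  have := linear_iso_comp (linear_iso_comp wiso uiso) (linear_iso_sym ziso).
  by [].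
apply: lee_pmul; rewrite ?cb_norm_ge0//.
- exact: cb_norm_comp_le lw lu iw iz'.
- exact: cb_norm_comp_le lz lv iz iw'.
Qed.

Lemma delta_cb_class (R : realType) (n : nat) (E F : opspace R n) :
  delta_cb (OS_class E) (OS_class F) = lne (d_cb E F).
Proof.
have repr (G : opspace R n) : completely_isometric G (OS_repr (OS_class G)).
  rewrite /OS_repr; case: cid => G' /= ->; exact: completely_isometric_refl.
have [rE rF] := (repr E, repr F).
congr lne; apply/le_anti/andP; split; apply: d_cb_le => //;
  exact: completely_isometric_sym.
Qed.

Lemma OS_class_eqP (R : realType) (n : nat) (E F : opspace R n) :
  OS_class E = OS_class F <-> completely_isometric E F.
Proof.
split=> [[EF]|EF]; first by rewrite EF; exact: completely_isometric_refl.
suff cEF : completely_isometric E = completely_isometric F.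
  rewrite /OS_class; move: (ex_intro _ _ _) (ex_intro _ _ _).
  by rewrite cEF => p q; congr MkOS; exact: Prop_irrelevance.
apply/funext => G; apply/propext; split; apply: completely_isometric_trans => //.
exact: completely_isometric_sym.
Qed.

(* Main.v *)
Require Import Defs.
From mathcomp Require Import all_boot all_order all_algebra.
From mathcomp Require Import all_classical all_reals all_analysis.
From HB Require Import structures.
From mathcomp Require Import complex finmap.
From mathcomp Require Import ring lra zify.

Set Implicit Arguments.
Unset Strict Implicit.
Unset Printing Implicit Defensive.

Import Order.TTheory GRing.Theory Num.Theory.
Import numFieldNormedType.Exports.

Local Open Scope classical_set_scope.
Local Open Scope ring_scope.

(** Every set of positive integers, given by a boolean sequence, is turned into a
    Hilbertian homogeneous space, in such a way that distinct sets give spaces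
    whose distance [d_cb] is at least a constant larger than one. As there are
    uncountably many sets, no countable set of classes is dense
    ([nonseparable_of_family]).

    The spaces. Let [a] be a tuple of [n] matrices, seen as [n] operators on a
    finite-dimensional space. A contraction [U] of [l_2^n] rotates it to another
    tuple [U a]. Fix a sequence of tuples [a^m], where [a^0 = (1, 0, ..., 0)] consists
    of scalars, and let [w] be a set of indices that contains zero. The space of [w]
    is spanned by [n] block-diagonal operators, the block [(m, U)] of the [j]-th
    one being [(U a^m)_j], for all [m] in [w] and all contractions [U]. Composing
    the coefficients with a contraction replaces a block by another one, hence the
    space is homogeneous ([Lopspace_homogeneous]). If [sum_j a_j^* a_j = 1] for all
    the tuples, then the norm of the combination with coefficients [v] is at most
    [|v|], and the blocks of [a^0] attain it ([opnorm_Lop]): the space is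
    Hilbertian.

    Separation. Take [X = a^m] as a matrix of coefficients. If [m] is in [w], the
    norm of the corresponding matrix over the space of [w] is at least one, since
    [sum_j a_j (x) a_j] fixes the normalized identity ([test_mx_ge]). If it is at
    most [rho < 1] in all the blocks of the space of [w'], then [d_cb] is at least
    [1 / rho] ([iso_cb_norm_ge]). In the block of a tuple [a'] this norm is the one
    of the map [Z |-> sum_i a_i Z b_i], where [b] is a rotation of the transposes
    of [a'] ([test_mx_pairing]). Splitting [Z] with its polar decomposition and
    using the Cauchy-Schwarz inequality ([rd_mul_le]), it is controlled by the map
    [A |-> sum_i a_i A a_i^*] on positive matrices [A] of rank at most the
    dimension of [a']. If this map has a spectral gap above the multiples of the
    identity, uniformly in [m], and if the dimensions grow fast enough, then small
    ranks stay away from the identity and [rho] is as wanted. So a sequence of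
    quantum expanders is needed, with three operators: this is where [2 < n] is
    used.

    The expanders. The tuples are multiples of [(1, u, v, 0, ..., 0)] with [u] and
    [v] signed permutations. A first lemma ([four_generator_gap]) deals with the
    operators on the functions on [V * V], where [V] is the space of the
    polynomials of bounded degree over the field with two elements: no matrix far
    from the scalars almost commutes with a shear, a linear map of order three, a
    translation and a sign. This comes from a ping-pong argument on the squares of
    the coefficients in the basis of the Weyl operators. Then these four generators
    are placed in the slots of a ninefold direct sum, so that two unitaries suffice
    ([slots_gap]). *)

(** * The direct sum of finite-dimensional Hilbert spaces *)

Section Nsq.
Variable R : realType.
Implicit Types x y : R[i].

Definition nsq x : R := complex.Re x ^+ 2 + complex.Im x ^+ 2.

Lemma nsq_ge0 x : 0 <= nsq x.
Proof. by rewrite addr_ge0 ?sqr_ge0. Qed.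

Lemma nsq0 : nsq 0 = 0.
Proof. by rewrite /nsq /= expr0n addr0. Qed.

Lemma nsqM x y : nsq (x * y) = nsq x * nsq y.
Proof. by case: x y => [a b] [c d]; rewrite /nsq /=; ring. Qed.

Lemma nsq_eq0 x : (nsq x == 0) = (x == 0).
Proof.
by case: x => a b; rewrite /nsq paddr_eq0 ?sqr_ge0// !sqrf_eq0 eq_complex.
Qed.

Lemma nsq_real (r : R) : nsq r%:C%C = r ^+ 2.
Proof. by rewrite /nsq /= expr0n addr0. Qed.

Lemma nsqN x : nsq (- x) = nsq x.
Proof. by case: x => a b; rewrite /nsq /= !sqrrN. Qed.

Lemma nsqJ x : nsq (x^*)%C = nsq x.
Proof. by case: x => a b; rewrite /nsq /= sqrrN. Qed.

Lemma normr_nsq x : `|x| ^+ 2 = (nsq x)%:C%C.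
Proof. by rewrite -add_Re2_Im2. Qed.

(** The triangle inequality is the best of these inequalities; in this form it
    passes to sums. *)
Lemma nsqD_le (t : R) x y : 0 < t ->
  nsq (x + y) <= (1 + t) * nsq x + (1 + t^-1) * nsq y.
Proof.
move=> t0; case: x y => [a b] [c d]; rewrite /nsq /=.
have P (u v : R) : (u + v) ^+ 2 <= (1 + t) * u ^+ 2 + (1 + t^-1) * v ^+ 2.
  rewrite -subr_ge0 (_ : _ - _ = t^-1 * (t * u - v) ^+ 2); last by field; lra.
  by rewrite mulr_ge0 ?sqr_ge0// invr_ge0 ltW.
have := P a c; have := P b d; lra.
Qed.

End Nsq.

Section Vn.
Variable R : realType.

(** The square of the norm of [l_2^m]. *)
Definition vn m (x : 'cV[R[i]]_m) : R := \sum_i nsq (x i 0).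

Lemma vn_ge0 m (x : 'cV_m) : 0 <= vn x.
Proof. by apply: sumr_ge0 => i _; exact: nsq_ge0. Qed.

Lemma vn0 m : vn (0 : 'cV_m) = 0.
Proof. by apply: big1 => i _; rewrite mxE nsq0. Qed.

Lemma vn_eq0 m (x : 'cV_m) : vn x = 0 -> x = 0.
Proof.
move/eqP; rewrite psumr_eq0 => [/allP x0|i _]; last exact: nsq_ge0.
apply/matrixP => i j; rewrite ord1 !mxE; apply/eqP.
by rewrite -nsq_eq0; apply: x0; rewrite mem_index_enum.
Qed.

Lemma vnZ m (a : R[i]) (x : 'cV_m) : vn (a *: x) = nsq a * vn x.
Proof. by rewrite mulr_sumr; apply: eq_bigr => i _; rewrite mxE nsqM. Qed.

Lemma vnD_le m (t : R) (x y : 'cV_m) : 0 < t ->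
  vn (x + y) <= (1 + t) * vn x + (1 + t^-1) * vn y.
Proof.
move=> t0; rewrite !mulr_sumr -big_split; apply: ler_sum => i _.
by rewrite mxE; exact: nsqD_le.
Qed.

End Vn.

(** The filter of the finite subsets of [I], directed by inclusion. *)
Definition finsets (I : choiceType) : set_system {fset I} :=
  filter_from setT (fun A => [set B | (A `<=` B)%fset]).

Global Instance finsets_filter (I : choiceType) : ProperFilter (@finsets I).
Proof.
eapply filter_from_proper; last by move=> A _; exists A; rewrite /= fsubset_refl.
apply: filter_fromT_filter; first by exists fset0.
by move=> A B /=; exists (A `|` B)%fset => P /=; rewrite fsubUset => /andP[].
Qed.

Lemma finsets_cvg_unique (R : realType) (I : choiceType) (u : {fset I} -> R)
    (a b : R) :
  u A @[A --> @finsets I] --> a -> u A @[A --> @finsets I] --> b -> a = b.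
Proof. by apply: cvg_unique; exact: Rhausdorff. Qed.

Section Ell2.
Variables (R : realType) (K : choiceType) (N : K -> nat).
Let J := {k : K & 'I_(N k)}.
Implicit Types (f g : J -> R[i]) (A : {fset K}).

Definition blk f k : 'cV[R[i]]_(N k) := \col_i f (existT _ k i).
Definition psum f A : R := \sum_(k <- A) vn (blk f k).
Definition isl2 f := exists M, forall A, psum f A <= M.

(** The square of the norm of the direct sum of the spaces [l_2^(N k)]. *)
Definition qn f : R := sup (range (psum f)).

Lemma blkD f g k : blk (f + g) k = blk f k + blk g k.
Proof. by apply/matrixP => i j; rewrite !mxE. Qed.

Lemma blkZ (a : R[i]) f k : blk (a *: f) k = a *: blk f k.
Proof. by apply/matrixP => i j; rewrite !mxE. Qed.

Lemma psum_ge0 f A : 0 <= psum f A.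
Proof. by apply: sumr_ge0 => i _; exact: vn_ge0. Qed.

Lemma psum_mono f A B : (A `<=` B)%fset -> psum f A <= psum f B.
Proof.
move=> AB; rewrite /psum (big_fsetID _ (fun k => k \in A) B) /=.
have -> : [fset x | x in B & x \in A]%fset = A.
  apply/fsetP => k; rewrite !inE /= andbC.
  by case: (boolP (k \in A)) => //= /(fsubsetP AB).
by rewrite lerDl; apply: sumr_ge0 => i _; exact: vn_ge0.
Qed.

Lemma has_sup_psum f : isl2 f -> has_sup (range (psum f)).
Proof.
move=> [M fM]; split; first by exists (psum f fset0), fset0.
by exists M => _ [A _ <-].
Qed.

Lemma psum_le_qn f A : isl2 f -> psum f A <= qn f.
Proof.
by move=> /has_sup_psum fs; apply: ub_le_sup; [exact: fs.2|exists A].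
Qed.

Lemma qn_le f M : (forall A, psum f A <= M) -> isl2 f /\ qn f <= M.
Proof.
move=> fM; split; first by exists M.
by apply: ge_sup => [|_ [A _ <-]//]; exists (psum f fset0), fset0.
Qed.

Lemma qn_ge0 f : isl2 f -> 0 <= qn f.
Proof. by move=> f2; exact: le_trans (psum_ge0 f fset0) (psum_le_qn _ f2). Qed.

Lemma cvg_psum f : isl2 f -> psum f A @[A --> @finsets K] --> qn f.
Proof.
move=> f2; apply/cvgrPdist_lt => e e0.
have [_ [A _ <-] Ae] := sup_adherent e0 (has_sup_psum f2).
exists A => // B /= AB; have := psum_mono f AB; have := psum_le_qn B f2.
have {}Ae : qn f - e < psum f A := Ae.
by move=> Bq AB'; rewrite /= ger0_norm ?subr_ge0//; lra.
Qed.

Lemma vn_le_qn f k : isl2 f -> vn (blk f k) <= qn f.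
Proof.
by move=> f2; have := psum_le_qn [fset k]%fset f2; rewrite /psum big_seq_fset1.
Qed.

Lemma nsq_le_qn f j : isl2 f -> nsq (f j) <= qn f.
Proof.
move=> f2; case: j => k i; apply: le_trans (vn_le_qn k f2).
rewrite /vn (bigD1 i)//= mxE lerDl.
by apply: sumr_ge0 => i' _; exact: nsq_ge0.
Qed.

Lemma qnD_le f g (t : R) : isl2 f -> isl2 g -> 0 < t ->
  isl2 (f + g) /\ qn (f + g) <= (1 + t) * qn f + (1 + t^-1) * qn g.
Proof.
move=> f2 g2 t0; apply: qn_le => A.
apply: (@le_trans _ _ ((1 + t) * psum f A + (1 + t^-1) * psum g A)).
  rewrite !mulr_sumr -big_split; apply: ler_sum => k _.
  by rewrite blkD; exact: vnD_le.
have ti : 0 < t^-1 by rewrite invr_gt0.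
by apply: lerD; rewrite ler_wpM2l ?psum_le_qn//; lra.
Qed.

Lemma psumZ (a : R[i]) f A : psum (a *: f) A = nsq a * psum f A.
Proof. by rewrite mulr_sumr; apply: eq_bigr => k _; rewrite blkZ vnZ. Qed.

Lemma isl2Z (a : R[i]) f : isl2 f -> isl2 (a *: f).
Proof.
move=> [M fM]; exists (nsq a * M) => A.
by rewrite psumZ ler_wpM2l ?nsq_ge0.
Qed.

Lemma qnZ (a : R[i]) f : isl2 f -> qn (a *: f) = nsq a * qn f.
Proof.
move=> f2; have af2 := isl2Z a f2.
have := cvg_psum af2.
under eq_fun do rewrite psumZ.
move=> h; apply: (finsets_cvg_unique h).
by apply: cvgM; [exact: cvg_cst|exact: cvg_psum].
Qed.

Lemma isl2_0 : isl2 0.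
Proof.
exists 0 => A; rewrite /psum big1// => k _.
by rewrite -[RHS](vn0 R (N k)); congr vn; apply/matrixP => i j; rewrite !mxE.
Qed.

Lemma qn_eq0 f : isl2 f -> qn f = 0 -> f = 0.
Proof.
move=> f2 f0; apply/funext => j; apply/eqP.
by rewrite -nsq_eq0 eq_le nsq_ge0 andbT -f0 nsq_le_qn.
Qed.

Definition l2pred : {pred J -> R[i]} := fun f => `[< isl2 f >].

Lemma l2pred_submod : submod_closed l2pred.
Proof.
split=> [|a f g /asboolP f2 /asboolP g2]; apply/asboolP; first exact: isl2_0.
by have [] := @qnD_le (a *: f) g 1 (isl2Z a f2) g2 ltr01.
Qed.

HB.instance Definition _ := GRing.isSubmodClosed.Build _ _ l2pred l2pred_submod.

Record ell2 := Ell2 { l2val :> J -> R[i] ; l2valP : l2val \in l2pred }.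

HB.instance Definition _ := [isSub for l2val].
HB.instance Definition _ := [Choice of ell2 by <:].
HB.instance Definition _ := [SubChoice_isSubLmodule of ell2 by <:].

Lemma l2P (f : ell2) : isl2 f.
Proof. exact/asboolP/l2valP. Qed.

Lemma l2valD (f g : ell2) : (f + g : ell2) = (f : J -> R[i]) + g :> (J -> R[i]).
Proof. by []. Qed.

Lemma l2valZ (a : R[i]) (f : ell2) :
  (a *: f : ell2) = a *: (f : J -> R[i]) :> (J -> R[i]).
Proof. by []. Qed.

Lemma l2_inj (f g : ell2) : (f : J -> R[i]) = g -> f = g.
Proof. exact: val_inj. Qed.

Definition l2norm_ (f : ell2) : R[i] := (Num.sqrt (qn f))%:C%C.

Lemma l2norm_sqr (f : ell2) : Num.sqrt (qn f) ^+ 2 = qn f.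
Proof. by rewrite sqr_sqrtr// qn_ge0//; exact: l2P. Qed.

Lemma l2norm_D (f g : ell2) : l2norm_ (f + g) <= l2norm_ f + l2norm_ g.
Proof.
rewrite /l2norm_ -rmorphD lecR.
have [f0|f0] := eqVneq (qn f) 0.
  by rewrite f0 sqrtr0 add0r l2valD (qn_eq0 (l2P f) f0) add0r.
have [g0|g0] := eqVneq (qn g) 0.
  by rewrite g0 sqrtr0 addr0 l2valD (qn_eq0 (l2P g) g0) addr0.
have fp : 0 < qn f by rewrite lt0r f0 qn_ge0//; exact: l2P.
have gp : 0 < qn g by rewrite lt0r g0 qn_ge0//; exact: l2P.
have sf : 0 < Num.sqrt (qn f) by rewrite sqrtr_gt0.
have sg : 0 < Num.sqrt (qn g) by rewrite sqrtr_gt0.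
(* The weight for which the two terms of qnD_le add up to a square. *)
have t0 : 0 < Num.sqrt (qn g) / Num.sqrt (qn f) by rewrite divr_gt0.
have [_ h] := qnD_le (l2P f) (l2P g) t0.
rewrite -(@ler_pXn2r _ 2%N)// ?nnegrE ?addr_ge0 ?sqrtr_ge0// l2norm_sqr.
have aux (x y a b : R) : 0 < a -> 0 < b -> x = a ^+ 2 -> y = b ^+ 2 ->
    (1 + b / a) * x + (1 + (b / a)^-1) * y <= (a + b) ^+ 2.
  move=> a0 b0 -> ->; rewrite le_eqVlt; apply/orP; left; apply/eqP.
  by field; rewrite !gt_eqF.
by apply: le_trans h _; apply: aux; rewrite ?l2norm_sqr.
Qed.

Lemma l2norm_Z (a : R[i]) (f : ell2) : l2norm_ (a *: f) = `|a| * l2norm_ f.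
Proof.
rewrite /l2norm_ l2valZ qnZ; last exact: l2P.
by rewrite sqrtrM ?nsq_ge0// rmorphM normc_def.
Qed.

Lemma l2norm_eq0 (f : ell2) : l2norm_ f = 0 -> f = 0.
Proof.
move=> [f0]; apply: l2_inj; apply: qn_eq0; first exact: l2P.
by rewrite -l2norm_sqr f0 expr0n.
Qed.

HB.instance Definition _ :=
  Lmodule_isNormed.Build R[i] ell2 l2norm_D l2norm_Z l2norm_eq0.

Lemma l2normE (f : ell2) : `|f| = (Num.sqrt (qn f))%:C%C.
Proof. by []. Qed.

Definition psumc (f g : J -> R[i]) A : R[i] :=
  \sum_(k <- A) \sum_(i < N k) f (existT _ k i) * (g (existT _ k i))^*%C.

(** The real part of the inner product, by polarization: additivity is then
    obtained as a limit of finite sums. *)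
Definition rdot (f g : J -> R[i]) : R := (qn (f + g) - qn f - qn g) / 2.

Definition l2dot (f g : ell2) : R[i] :=
  (rdot f g +i* rdot f (('i%C : R[i]) *: (g : J -> R[i])))%C.

Lemma Re_psumc f g A :
  complex.Re (psumc f g A) = (psum (f + g) A - psum f A - psum g A) / 2.
Proof.
rewrite /psumc raddf_sum /psum -!sumrB mulr_suml; apply: eq_bigr => k _.
rewrite raddf_sum /vn -!sumrB mulr_suml; apply: eq_bigr => i _.
rewrite blkD !mxE.
by case: (f _) (g _) => [a b] [c d]; rewrite /nsq /=; field.
Qed.

Lemma Im_psumc f g A :
  complex.Im (psumc f g A) =
  complex.Re (psumc f (('i%C : R[i]) *: (g : J -> R[i])) A).
Proof.
rewrite /psumc !raddf_sum; apply: eq_bigr => k _.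
rewrite !raddf_sum; apply: eq_bigr => i _.
rewrite /GRing.scale /=.
by case: (f _) (g _) => [a b] [c d] /=; ring.
Qed.

Lemma cvg_Re_psumc (f g : J -> R[i]) : isl2 f -> isl2 g ->
  complex.Re (psumc f g A) @[A --> @finsets K] --> rdot f g.
Proof.
move=> f2 g2; under eq_fun do rewrite Re_psumc.
have [fg2 _] := qnD_le f2 g2 ltr01.
apply: cvgM; last exact: cvg_cst.
by apply: cvgB; [apply: cvgB|]; exact: cvg_psum.
Qed.

Lemma cvg_Re_dot (f g : ell2) :
  complex.Re (psumc f g A) @[A --> @finsets K] --> complex.Re (l2dot f g).
Proof. by apply: cvg_Re_psumc; exact: l2P. Qed.

Lemma cvg_Im_dot (f g : ell2) :
  complex.Im (psumc f g A) @[A --> @finsets K] --> complex.Im (l2dot f g).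
Proof.
under eq_fun do rewrite Im_psumc.
by apply: cvg_Re_psumc; [exact: l2P|apply: isl2Z; exact: l2P].
Qed.

Lemma l2dot_linear (a : R[i]) (f f' g : ell2) :
  l2dot (a *: f + f') g = a * l2dot f g + l2dot f' g.
Proof.
have E A : psumc (a *: f + f' : ell2) g A = a * psumc f g A + psumc f' g A.
  rewrite mulr_sumr -big_split; apply: eq_bigr => k _ /=.
  rewrite mulr_sumr -big_split; apply: eq_bigr => i _ /=.
  by rewrite mulrDl mulrA.
apply/eqP; rewrite eq_complex; apply/andP; split; apply/eqP.
  apply: (finsets_cvg_unique (@cvg_Re_dot (a *: f + f') g)).
  under eq_fun do rewrite E.
  rewrite (_ : complex.Re _ = complex.Re a * complex.Re (l2dot f g) -
    complex.Im a * complex.Im (l2dot f g) + complex.Re (l2dot f' g)); last first.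
    by case: a (l2dot f g) (l2dot f' g) {E} => [? ?] [? ?] [? ?].
  rewrite (_ : (fun A => _) = (fun A => complex.Re a * complex.Re (psumc f g A) -
    complex.Im a * complex.Im (psumc f g A) + complex.Re (psumc f' g A))); last first.
    apply/funext => A.
    by case: a (psumc f g A) (psumc f' g A) {E} => [? ?] [? ?] [? ?].
  apply: cvgD; last exact: cvg_Re_dot.
  apply: cvgB; apply: cvgM; try exact: cvg_cst.
    exact: cvg_Re_dot.
  exact: cvg_Im_dot.
apply: (finsets_cvg_unique (@cvg_Im_dot (a *: f + f') g)).
under eq_fun do rewrite E.
rewrite (_ : complex.Im _ = complex.Re a * complex.Im (l2dot f g) +
  complex.Im a * complex.Re (l2dot f g) + complex.Im (l2dot f' g)); last first.
  by case: a (l2dot f g) (l2dot f' g) {E} => [? ?] [? ?] [? ?].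
rewrite (_ : (fun A => _) = (fun A => complex.Re a * complex.Im (psumc f g A) +
  complex.Im a * complex.Re (psumc f g A) + complex.Im (psumc f' g A))); last first.
  apply/funext => A.
  by case: a (psumc f g A) (psumc f' g A) {E} => [? ?] [? ?] [? ?].
apply: cvgD; last exact: cvg_Im_dot.
apply: cvgD; apply: cvgM; try exact: cvg_cst.
  exact: cvg_Im_dot.
exact: cvg_Re_dot.
Qed.

Lemma l2dotC (f g : ell2) : l2dot f g = (l2dot g f)^*%C.
Proof.
have E A : psumc f g A = (psumc g f A)^*%C.
  rewrite rmorph_sum; apply: eq_bigr => k _ /=.
  rewrite rmorph_sum; apply: eq_bigr => i _ /=.
  by rewrite rmorphM /= conjcK mulrC.
apply/eqP; rewrite eq_complex; apply/andP; split; apply/eqP.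
  apply: (finsets_cvg_unique (@cvg_Re_dot f g)).
  under eq_fun do rewrite E.
  rewrite (_ : complex.Re _ = complex.Re (l2dot g f)); last by case: (l2dot g f).
  rewrite (_ : (fun A => _) = fun A => complex.Re (psumc g f A)).
    exact: cvg_Re_dot.
  by apply/funext => A; case: (psumc g f A).
apply: (finsets_cvg_unique (@cvg_Im_dot f g)).
under eq_fun do rewrite E.
rewrite (_ : complex.Im _ = - complex.Im (l2dot g f)); last by case: (l2dot g f).
rewrite (_ : (fun A => _) = fun A => - complex.Im (psumc g f A)).
  by apply: cvgN; exact: cvg_Im_dot.
by apply/funext => A; case: (psumc g f A).
Qed.

Lemma l2dot_norm (f : ell2) : l2dot f f = (qn f)%:C%C.
Proof.
have f2 := l2P f; apply/eqP; rewrite eq_complex; apply/andP; split; apply/eqP.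
  rewrite /= /rdot -mulr2n -scaler_nat qnZ//.
  have -> : (2%:R : R[i]) = (2 : R)%:C%C by rewrite rmorph_nat.
  by rewrite nsq_real; field.
rewrite /= /rdot -[X in qn (X + _)]scale1r -scalerDl !qnZ//.
by rewrite /nsq /= !(addr0, add0r) expr0n expr1n add0r; field.
Qed.

Lemma l2dot_bilinear :
  bilinear_for ( *%R : R[i] -> R[i] -> R[i]) (@Num.conj R[i] \; *%R) l2dot.
Proof.
split=> [g a f f'|f a g g']; first exact: l2dot_linear.
by rewrite [LHS]l2dotC l2dot_linear rmorphD rmorphM /= (l2dotC f g) (l2dotC f g').
Qed.

HB.instance Definition _ := @bilinear_isBilinear.Build R[i] ell2 ell2 R[i]
  *%R (@Num.conj R[i] \; *%R) l2dot l2dot_bilinear.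

Lemma l2dot_herm (f g : ell2) :
  l2dot f g = (-1) ^+ false * Num.conj (l2dot g f).
Proof. by rewrite expr0 mul1r l2dotC. Qed.

HB.instance Definition _ := @isHermitianSesquilinear.Build R[i] ell2 false
  (@Num.conj R[i]) l2dot l2dot_herm.

Lemma l2dot_gt0 (f : ell2) : f != 0 -> 0 < l2dot f f.
Proof.
move=> f0; rewrite l2dot_norm ltcR lt0r qn_ge0 ?andbT; last exact: l2P.
by apply: contra f0 => /eqP /(qn_eq0 (l2P f)) f0; apply/eqP/l2_inj.
Qed.

HB.instance Definition _ := @isDotProduct.Build R[i] ell2 l2dot l2dot_gt0.

Lemma l2ballP (x y : ell2) (e : R) : 0 < e ->
  ball x e%:C%C y <-> qn ((x : J -> R[i]) - y) < e ^+ 2.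
Proof.
move=> e0; rewrite -ball_normE /ball_ /= l2normE ltcR.
have xy : 0 <= qn ((x : J -> R[i]) - y) by apply/qn_ge0/(l2P (x - y)).
rewrite -(@ltr_pXn2r _ 2%N) ?nnegrE ?sqrtr_ge0//; last exact: ltW.
by rewrite sqr_sqrtr.
Qed.

Lemma cvg_sum_real (I T : Type) (F : set_system T) (r : seq I)
    (u : I -> T -> R) (a : I -> R) : Filter F ->
  (forall i, u i x @[x --> F] --> a i) ->
  \sum_(i <- r) u i x @[x --> F] --> \sum_(i <- r) a i.
Proof. by move=> FF ua; apply: cvg_big => //; exact: add_continuous. Qed.

Lemma l2_cauchy_coord (F : set_system ell2) (P : R[i] -> R) :
  ProperFilter F -> cauchy F -> {morph P : x y / x - y} ->
  (forall z, P z ^+ 2 <= nsq z) -> forall j,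
  cvg (P ((f : ell2) j) @[f --> F]).
Proof.
move=> FF /cauchyP Fc PB Psq j; apply: R_complete; apply: cauchy_exP => e e0.
have [|x Fx] := Fc e%:C%C; first by rewrite ltcR.
exists (P (x j)).
suff : F [set f : ell2 | `|P (x j) - P (f j)| < e] by [].
apply: filterS Fx => f /(l2ballP _ _ e0) xf /=; rewrite -PB -(@ltr_pXn2r _ 2%N) ?nnegrE ?normr_ge0//; last exact: ltW.
rewrite real_normK ?num_real//; apply: le_lt_trans xf; apply: le_trans (Psq _) _.
exact: (@nsq_le_qn _ j (l2P (x - f))).
Qed.

(** The limit is taken in each coordinate. The bounds on the distances are bounds
    on finite sums of coordinates, so they pass to the limit. *)
Lemma l2_complete (F : set_system ell2) : ProperFilter F -> cauchy F -> cvg F.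
Proof.
move=> FF Fc.
have cRe := @l2_cauchy_coord F (@complex.Re R) FF Fc.
have {}cRe j : cvg (complex.Re ((f : ell2) j) @[f --> F]).
  by apply: cRe => [[a b] [c d]//|z]; rewrite lerDl sqr_ge0.
have cIm := @l2_cauchy_coord F (@complex.Im R) FF Fc.
have {}cIm j : cvg (complex.Im ((f : ell2) j) @[f --> F]).
  by apply: cIm => [[a b] [c d]//|z]; rewrite lerDr sqr_ge0.
pose g : J -> R[i] := fun j => (lim (complex.Re ((f : ell2) j) @[f --> F]) +i*
  lim (complex.Im ((f : ell2) j) @[f --> F]))%C.
have cpsum (x : ell2) A :
    psum (((f : ell2) : J -> R[i]) - x) A @[f --> F] --> psum (g - x) A.
  apply: cvg_sum_real => k; apply: cvg_sum_real => i.
  set j : J := existT _ k i.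
  have E (f : J -> R[i]) : nsq (blk (f - x) k i 0) =
      (complex.Re (f j) - complex.Re (x j)) ^+ 2 +
      (complex.Im (f j) - complex.Im (x j)) ^+ 2.
    rewrite mxE -/j (_ : (f - x) j = f j - x j)//.
    by case: (f j) (x j) => [a b] [c d].
  rewrite E; under eq_fun do rewrite E.
  have cR : complex.Re ((f : ell2) j) - complex.Re (x j) @[f --> F] -->
      complex.Re (g j) - complex.Re (x j).
    by apply: cvgB; [exact: cRe|exact: cvg_cst].
  have cI : complex.Im ((f : ell2) j) - complex.Im (x j) @[f --> F] -->
      complex.Im (g j) - complex.Im (x j).
    by apply: cvgB; [exact: cIm|exact: cvg_cst].
  by apply: cvgD; apply: cvgM.
have gle (e : R) (x : ell2) : 0 < e -> F (ball x e%:C%C) ->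
    isl2 (g - x) /\ qn (g - x) <= e ^+ 2.
  move=> e0 Fx; apply: qn_le => A; apply: (cvgr_to_le (cpsum x A)).
  apply: filterS Fx => f /(l2ballP _ _ e0) xf; apply: le_trans _ (ltW xf).
  have -> : (f : J -> R[i]) - x = (-1) *: ((x : J -> R[i]) - f).
    by rewrite scaleN1r opprB.
  rewrite psumZ nsqN (nsq_real 1) expr1n mul1r.
  exact: psum_le_qn (l2P (x - f)).
move/cauchyP: Fc => Fc.
have g2 : g \in l2pred.
  have [|x Fx] := Fc (1 : R)%:C%C; first by rewrite ltcR.
  apply/asboolP; rewrite -(subrK (x : J -> R[i]) g).
  have [h _] := gle _ _ ltr01 Fx.
  by have [] := qnD_le h (l2P x) ltr01.
apply/cvg_ex; exists (Ell2 g2); apply/cvgrPdist_lt => e e0.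
have er : e = (complex.Re e)%:C%C.
  by move: e0; rewrite ltcE /= => /andP[/eqP h _]; case: e h => a b /= ->.
have re0 : 0 < complex.Re e by move: e0; rewrite ltcE /= => /andP[].
pose d := complex.Re e / 4.
have d0 : 0 < d by rewrite /d; lra.
have [|x Fx] := Fc d%:C%C; first by rewrite ltcR.
have [gx2 gx] := gle _ _ d0 Fx.
apply: filterS Fx => f /(l2ballP _ _ d0) xf.
have /(l2ballP _ _ re0) : qn ((Ell2 g2 : J -> R[i]) - f) < complex.Re e ^+ 2.
  rewrite (_ : _ - _ = (g - x) + ((x : J -> R[i]) - f)); last by rewrite addrA subrK.
  have [_ h] := qnD_le gx2 (l2P (x - f)) ltr01.
  apply: le_lt_trans h _; rewrite invr1.
  apply: (@lt_le_trans _ _ ((1 + 1) * d ^+ 2 + (1 + 1) * d ^+ 2)).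
    by apply: ler_ltD; [rewrite ler_wpM2l|rewrite ltr_pM2l].
  by rewrite /d; nra.
by rewrite -er -ball_normE.
Qed.

HB.instance Definition _ := Uniform_isComplete.Build ell2 l2_complete.

Definition l2H : hilbertSpace R.
Proof.
apply: (@HilbertSpace R ell2 (l2dot : {dot ell2 for @Num.conj R[i]})).
move=> f; rewrite [RHS]l2dot_norm l2normE -rmorphXn /= l2norm_sqr//.
Defined.

Lemma rnorm_l2 (f : ell2) : rnorm f ^+ 2 = qn f.
Proof. by rewrite /rnorm l2normE /= l2norm_sqr. Qed.

End Ell2.

(** * Block-diagonal operators *)

Section BlockOp.
Variables (R : realType) (K : choiceType) (N : K -> nat).
Let J := {k : K & 'I_(N k)}.
Let H := l2H R N.

(** The block-diagonal operator with blocks [B k]. It has this meaning only if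
    the norms of the blocks are bounded, whence the default value. *)
Definition bop (B : forall k, 'M[R[i]]_(N k)) (f : H) : H :=
  insubd (0 : ell2 R N)
    (fun j => (B (tag j) *m blk (f : ell2 R N) (tag j)) (tagged j) 0).

Definition mxbdd (B : forall k, 'M[R[i]]_(N k)) :=
  exists M, forall k xi, vn (B k *m xi) <= M * vn xi.

Lemma blk_bop B (f : H) k : mxbdd B ->
  blk (bop B f : ell2 R N) k = B k *m blk (f : ell2 R N) k.
Proof.
move=> [M BM]; set g : J -> R[i] := fun j =>
  (B (tag j) *m blk (f : ell2 R N) (tag j)) (tagged j) 0.
have bg k' : blk g k' = B k' *m blk (f : ell2 R N) k'.
  by apply/matrixP => i j; rewrite ord1 mxE.
suff g2 : g \in @l2pred R K N by rewrite /bop -/g /insubd insubT -bg.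
apply/asboolP; exists (`|M| * qn (f : ell2 R N)) => A.
apply: le_trans (ler_wpM2l (normr_ge0 _) (psum_le_qn A (l2P _))).
rewrite mulr_sumr; apply: ler_sum => k' _; rewrite bg.
by apply: le_trans (BM _ _) _; rewrite ler_wpM2r ?vn_ge0 ?ler_norm.
Qed.

Lemma ell2_blk_inj (f g : ell2 R N) : (forall k, blk f k = blk g k) -> f = g.
Proof.
move=> fg; apply: l2_inj; apply/funext => -[k i].
by have /matrixP /(_ i 0) := fg k; rewrite !mxE.
Qed.

Lemma blk_sum (I : Type) (r : seq I) (f : I -> H) k :
  blk (\sum_(i <- r) f i : ell2 R N) k = \sum_(i <- r) blk (f i : ell2 R N) k.
Proof.
elim: r => [|i r IH]; last by rewrite !big_cons -IH -blkD.
by rewrite !big_nil; apply/matrixP => i j; rewrite !mxE.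
Qed.

Lemma l2norm_qn p (xi : 'I_p -> H) :
  l2norm xi = Num.sqrt (\sum_i qn (xi i : ell2 R N)).
Proof. by congr Num.sqrt; apply: eq_bigr => i _; exact: rnorm_l2. Qed.

Section Matrix.
Variables (p : nat) (B : 'I_p -> 'I_p -> forall k, 'M[R[i]]_(N k)).
Variable (x : 'M[H -> H]_p).
Hypothesis (xB : forall i j, x i j = bop (B i j)).
Hypothesis (Bb : forall i j, mxbdd (B i j)).

Lemma blk_mxact (xi : 'I_p -> H) i k :
  blk (mxact x xi i : ell2 R N) k =
  \sum_j B i j k *m blk (xi j : ell2 R N) k.
Proof.
by rewrite blk_sum; apply: eq_bigr => j _; rewrite xB blk_bop.
Qed.

(** The norm on the direct sum is the limit of the norms on finitely many blocks,
    in each of which the bound applies. *)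
Lemma mxopnorm_blk_le (s : R) : 0 <= s ->
  (forall k (xi : 'I_p -> 'cV_(N k)),
    \sum_i vn (\sum_j B i j k *m xi j) <= s ^+ 2 * \sum_j vn (xi j)) ->
  (mxopnorm x <= s%:E)%E.
Proof.
move=> s0 xs; apply: ge_ereal_sup => _ [xi /= xi1 <-]; rewrite lee_fin.
suff h : \sum_i qn (mxact x xi i : ell2 R N) <=
    s ^+ 2 * \sum_j qn (xi j : ell2 R N).
  apply: (@le_trans _ _ (s * l2norm xi)); last by rewrite ler_piMr.
  rewrite !l2norm_qn -[X in _ <= X * _](ger0_norm s0) -sqrtr_sqr.
  by rewrite -sqrtrM ?sqr_ge0// ler_wsqrtr.
have c : \sum_i psum (mxact x xi i : ell2 R N) A @[A --> @finsets K] -->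
    \sum_i qn (mxact x xi i : ell2 R N).
  by apply: cvg_sum_real => i; apply: cvg_psum; exact: l2P.
apply: (cvgr_to_le c); apply: nearW => A.
apply: (@le_trans _ _ (s ^+ 2 * \sum_j psum (xi j : ell2 R N) A)); last first.
  rewrite ler_wpM2l ?sqr_ge0//; apply: ler_sum => j _.
  by apply: psum_le_qn; exact: l2P.
rewrite exchange_big [X in _ * X]exchange_big mulr_sumr /=.
apply: ler_sum => k _; under eq_bigr do rewrite blk_mxact.
exact: xs.
Qed.

End Matrix.

Section Inj.
Variables (k : K).

Definition blk_inj (xi : 'cV[R[i]]_(N k)) : J -> R[i] := fun j =>
  match pselect (k = tag j) with
  | left e => xi (cast_ord (congr1 N (esym e)) (tagged j)) 0
  | right _ => 0
  end.

Lemma blk_injE xi : blk (blk_inj xi) k = xi.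
Proof.
apply/matrixP => i j; rewrite ord1 mxE /blk_inj /=; case: pselect => // e.
by congr (xi _ _); apply: val_inj.
Qed.

Lemma blk_inj_neq xi k' : k' != k -> blk (blk_inj xi) k' = 0.
Proof.
move=> kk'; apply/matrixP => i j; rewrite !mxE /blk_inj /=.
by case: pselect => // e; rewrite e eqxx in kk'.
Qed.

Lemma qn_blk_inj xi : isl2 (blk_inj xi) /\ qn (blk_inj xi) <= vn xi.
Proof.
apply: qn_le => A; have [kA|kA] := boolP (k \in A).
  rewrite /psum (big_fsetD1 k)//= blk_injE big1_fset ?addr0// => k'.
  by rewrite !inE => /andP[kk' _] _; rewrite blk_inj_neq// vn0.
rewrite /psum big1_fset ?vn_ge0// => k' kA' _.
rewrite blk_inj_neq ?vn0//; apply: contraNN kA => /eqP <-.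
exact: kA'.
Qed.

Lemma l2pred_blk_inj xi : blk_inj xi \in @l2pred R K N.
Proof. by apply/asboolP; have [] := qn_blk_inj xi. Qed.

End Inj.

Section MatrixLow.
Variables (p : nat) (B : 'I_p -> 'I_p -> forall k, 'M[R[i]]_(N k)).
Variable (x : 'M[H -> H]_p).
Hypothesis (xB : forall i j, x i j = bop (B i j)).
Hypothesis (Bb : forall i j, mxbdd (B i j)).

(** The vectors supported in one block recover the norm of this block. *)
Lemma mxopnorm_blk_ge (s : R) : 0 <= s -> (mxopnorm x <= s%:E)%E ->
  forall k (xi : 'I_p -> 'cV_(N k)),
    \sum_i vn (\sum_j B i j k *m xi j) <= s ^+ 2 * \sum_j vn (xi j).
Proof.
move=> s0 xs k xi; set t := \sum_j vn (xi j).
have t0 : 0 <= t by apply: sumr_ge0 => j _; exact: vn_ge0.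
have [t00|tn] := eqVneq t 0.
  have xi0 j : xi j = 0.
    apply: vn_eq0; apply/eqP; move: t00 => /eqP; rewrite psumr_eq0 => [|i _].
      by move=> /allP /(_ j (mem_index_enum j)).
    exact: vn_ge0.
  rewrite big1 ?mulr_ge0 ?sqr_ge0// => i _.
  by rewrite big1 ?vn0// => j _; rewrite xi0 mulmx0.
have tp : 0 < t by rewrite lt0r tn.
pose c := (Num.sqrt t)^-1; have c2 : c ^+ 2 = t^-1 by rewrite exprVn sqr_sqrtr.
pose eta j : H := Ell2 (l2pred_blk_inj (c%:C%C *: xi j)).
have beta j : blk (eta j : ell2 R N) k = c%:C%C *: xi j by rewrite blk_injE.
have eta1 : l2norm eta <= 1.
  rewrite l2norm_qn -sqrtr1 ler_wsqrtr//.
  apply: (@le_trans _ _ (\sum_j vn (c%:C%C *: xi j))).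
    by apply: ler_sum => j _; have [] := qn_blk_inj (c%:C%C *: xi j).
  under eq_bigr do rewrite vnZ nsq_real c2.
  by rewrite -mulr_sumr mulVf.
have : l2norm (mxact x eta) <= s.
  by rewrite -lee_fin; apply: le_trans xs; apply: ereal_sup_ubound; exists eta.
rewrite l2norm_qn -(@ler_pXn2r _ 2%N) ?nnegrE ?sqrtr_ge0// sqr_sqrtr; last first.
  by apply: sumr_ge0 => j _; apply: qn_ge0; exact: l2P.
move=> h; rewrite -ler_pdivrMr//; apply: le_trans h.
rewrite mulrC mulr_sumr; apply: ler_sum => i _.
have := vn_le_qn k (l2P (mxact x eta i : ell2 R N)).
rewrite (blk_mxact xB)//; apply: le_trans.
under [X in _ <= vn X]eq_bigr do rewrite beta -scalemxAr.
by rewrite -scaler_sumr vnZ nsq_real c2.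
Qed.

End MatrixLow.

End BlockOp.

Lemma opnorm_mx1 (R : realType) (H : hilbertSpace R) (T : H -> H) :
  opnorm T = mxopnorm (const_mx T : 'M[H -> H]_1).
Proof.
have l2norm1 (xi : 'I_1 -> H) : l2norm xi = rnorm (xi 0).
  rewrite /l2norm big_ord1 sqrtr_sqr ger0_norm// /rnorm.
  by have := normr_ge0 (xi 0); rewrite lecE => /andP[].
rewrite /opnorm /mxopnorm; congr ereal_sup; apply/seteqP; split => _ [xi xi1 <-].
  by exists (fun=> xi); rewrite /= l2norm1// /mxact big_ord1 mxE.
exists (xi 0); first by rewrite /= -l2norm1.
by rewrite l2norm1 /mxact big_ord1 mxE.
Qed.

(** * The operator space of a family of tuples of matrices *)

Section LinearProp.
Variables (A : nzRingType) (V W : lmodType A) (T : V -> W).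
Hypothesis Tl : linear T.

Lemma linearP_0 : T 0 = 0.
Proof. by have := Tl (-1) 0 0; rewrite scaler0 addr0 scaleN1r addNr. Qed.

Lemma linearP_Z c x : T (c *: x) = c *: T x.
Proof. by have := Tl c x 0; rewrite linearP_0 !addr0. Qed.

Lemma linearP_B x y : T (x - y) = T x - T y.
Proof. by have := Tl (-1) y x; rewrite !scaleN1r ![- _ + _]addrC. Qed.

End LinearProp.

Section Tuples.
Variables (R : realType) (n : nat).

Record mtuple := MTuple { tdim :> nat ; tmx : 'I_n -> 'M[R]_tdim }.

Definition cmx p q (M : 'M[R]_(p, q)) : 'M[R[i]]_(p, q) :=
  map_mx (real_complex R) M.

(** The row and the column with entries [tmx t j] have norm one; equivalently, the
    map [A |-> sum_j a_j A a_j^T] and its adjoint preserve the identity. *)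
Definition bistochastic (t : mtuple) :=
  \sum_j (tmx t j)^T *m tmx t j = 1%:M /\ \sum_j tmx t j *m (tmx t j)^T = 1%:M.

Definition amat (t : mtuple) (v : 'rV[R[i]]_n) : 'M[R[i]]_t :=
  \sum_j v 0 j *: cmx (tmx t j).

Definition rv (v : 'rV[R[i]]_n) : R := \sum_j nsq (v 0 j).

Definition contraction_mx (U : 'M[R[i]]_n) := forall v, rv (v *m U) <= rv v.

Lemma rv_ge0 v : 0 <= rv v.
Proof. by apply: sumr_ge0 => j _; exact: nsq_ge0. Qed.

Lemma rvZ (c : R[i]) v : rv (c *: v) = nsq c * rv v.
Proof. by rewrite mulr_sumr; apply: eq_bigr => j _; rewrite mxE nsqM. Qed.

Lemma rv0 : rv 0 = 0.
Proof. by apply: big1 => j _; rewrite mxE nsq0. Qed.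

Lemma rv_eq0 v : rv v = 0 -> v = 0.
Proof.
move/eqP; rewrite psumr_eq0 => [/allP v0|i _]; last exact: nsq_ge0.
apply/matrixP => i j; rewrite ord1 !mxE; apply/eqP.
by rewrite -nsq_eq0; apply: v0; rewrite mem_index_enum.
Qed.

End Tuples.

Lemma amatD (R : realType) n (t : mtuple R n) (c : R[i]) v w :
  amat t (c *: v + w) = c *: amat t v + amat t w.
Proof.
rewrite /amat scaler_sumr -big_split; apply: eq_bigr => j _.
by rewrite !mxE scalerDl scalerA.
Qed.

Lemma amatZ (R : realType) n (t : mtuple R n) (c : R[i]) v :
  amat t (c *: v) = c *: amat t v.
Proof.
by rewrite /amat scaler_sumr; apply: eq_bigr => j _; rewrite !mxE scalerA.
Qed.

(** The norm of the matrix of the combinations of [t] with coefficients [X] is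
    at most [s]. *)
Definition tnorm_le (R : realType) n (t : mtuple R n) k
    (X : 'I_k -> 'I_k -> 'rV[R[i]]_n) (s : R) :=
  forall xi : 'I_k -> 'cV_t,
    \sum_i vn (\sum_j amat t (X i j) *m xi j) <= s ^+ 2 * \sum_j vn (xi j).

Lemma nsq_sum_le (R : realType) (I : finType) (x y : I -> R[i]) :
  nsq (\sum_i x i * y i) <= (\sum_i nsq (x i)) * \sum_i nsq (y i).
Proof.
set S := \sum_i x i * y i; set X := \sum_i _; set Y := \sum_i nsq (y i).
have Y0 : 0 <= Y by apply: sumr_ge0 => i _; exact: nsq_ge0.
have [YE|Yn] := eqVneq Y 0.
  have y0 i : y i = 0.
    apply/eqP; rewrite -nsq_eq0; move/eqP: YE; rewrite psumr_eq0 => [|j _].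
      by move=> /allP /(_ i (mem_index_enum i)).
    exact: nsq_ge0.
  by rewrite YE mulr0 /S big1 ?nsq0// => i _; rewrite y0 mulr0.
have Yp : 0 < Y by rewrite lt0r Yn.
(* Expand the sum of the squares of |Y x_i - S y_i^*|. *)
rewrite -(ler_pM2l Yp) -subr_ge0.
suff -> : Y * (X * Y) - Y * nsq S =
    \sum_i nsq (Y%:C%C * x i - S * (y i)^*%C).
  by apply: sumr_ge0 => i _; exact: nsq_ge0.
transitivity (\sum_i (Y ^+ 2 * nsq (x i) -
    2 * Y * complex.Re (S^*%C * (x i * y i)) + nsq S * nsq (y i))).
  rewrite big_split sumrB -!mulr_sumr /= -/Y -/X -raddf_sum -mulr_sumr -/S /=.
  have -> : complex.Re (S^*%C * S) = nsq S by case: (S) => a b; rewrite /nsq /=; ring.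
  ring.
apply: eq_bigr => i _.
by case: (x i) (y i) S => [a b] [c d] [e f]; rewrite /nsq /=; ring.
Qed.

Section Bistochastic.
Variable R : realType.

Lemma vn_ReIm m (x : 'cV[R[i]]_m) :
  vn x = ((map_mx (@complex.Re R) x)^T *m map_mx (@complex.Re R) x) 0 0 +
         ((map_mx (@complex.Im R) x)^T *m map_mx (@complex.Im R) x) 0 0.
Proof.
rewrite !mxE -big_split; apply: eq_bigr => i _.
by rewrite !mxE /nsq !expr2.
Qed.

Lemma Re_cmx p q r (M : 'M[R]_(p, q)) (x : 'M[R[i]]_(q, r)) :
  map_mx (@complex.Re R) (cmx M *m x) = M *m map_mx (@complex.Re R) x.
Proof.
apply/matrixP => i j; rewrite !mxE raddf_sum; apply: eq_bigr => k _.
by rewrite !mxE; case: (x k j) => a b /=; rewrite mul0r subr0.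
Qed.

Lemma Im_cmx p q r (M : 'M[R]_(p, q)) (x : 'M[R[i]]_(q, r)) :
  map_mx (@complex.Im R) (cmx M *m x) = M *m map_mx (@complex.Im R) x.
Proof.
apply/matrixP => i j; rewrite !mxE raddf_sum; apply: eq_bigr => k _.
by rewrite !mxE; case: (x k j) => a b /=; rewrite mul0r addr0.
Qed.

Lemma vn_sum_cmx n m (a : 'I_n -> 'M[R]_m) (x : 'cV[R[i]]_m) :
  \sum_j (a j)^T *m a j = 1%:M -> \sum_j vn (cmx (a j) *m x) = vn x.
Proof.
move=> a1; under eq_bigr do rewrite vn_ReIm Re_cmx Im_cmx.
rewrite big_split vn_ReIm /=.
have E (y : 'cV[R]_m) : \sum_j ((a j *m y)^T *m (a j *m y)) 0 0 = (y^T *m y) 0 0.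
  under eq_bigr do rewrite trmx_mul mulmxA -(mulmxA y^T).
  have -> : y^T *m y = \sum_j y^T *m ((a j)^T *m a j) *m y.
    by rewrite -mulmx_suml -mulmx_sumr a1 mulmx1.
  by rewrite summxE.
by rewrite !E.
Qed.

(** Cauchy-Schwarz in the coefficients, the column of the tuple being an
    isometry. *)
Lemma vn_amat_le n (t : mtuple R n) v (x : 'cV_t) : bistochastic t ->
  vn (amat t v *m x) <= rv v * vn x.
Proof.
move=> [t1 _]; rewrite -(vn_sum_cmx x t1) exchange_big mulr_sumr.
apply: ler_sum => i _.
have -> : (amat t v *m x) i 0 = \sum_j v 0 j * (cmx (tmx t j) *m x) i 0.
  rewrite /amat mulmx_suml summxE; apply: eq_bigr => j _.
  by rewrite -scalemxAl [LHS]mxE.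
exact: nsq_sum_le.
Qed.

End Bistochastic.

Lemma lipschitz_sq_continuous (R : realType) (V : normedModType R[i])
    (T : V -> V) (M : R) :
  (forall x y, rnorm (T x - T y) ^+ 2 <= M * rnorm (x - y) ^+ 2) ->
  continuous T.
Proof.
move=> TM x; apply/cvgrPdist_lt => e e0.
have rn (y : V) : `|y| = (rnorm y)%:C%C by rewrite /rnorm RRe_real// normr_real.
have rn0 (y : V) : 0 <= rnorm y by have := normr_ge0 y; rewrite rn lecR.
have re0 : 0 < complex.Re e by move: e0; rewrite ltcE /= => /andP[].
have er : e = (complex.Re e)%:C%C by rewrite RRe_real// gtr0_real.
have M0 : 0 < `|M| + 1 by rewrite ltr_wpDl.
pose d := complex.Re e / Num.sqrt (`|M| + 1).
have d0 : 0 < d by rewrite divr_gt0 ?sqrtr_gt0.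
near=> y.
rewrite er rn ltcR -(@ltr_pXn2r _ 2%N) ?nnegrE ?(ltW re0)//.
apply: le_lt_trans (TM _ _) _.
apply: (@le_lt_trans _ _ ((`|M| + 1) * rnorm (x - y) ^+ 2)).
  by rewrite ler_wpM2r ?sqr_ge0//; apply: le_trans (ler_norm _) _; rewrite lerDl.
have d2 : (`|M| + 1)^-1 * complex.Re e ^+ 2 = d ^+ 2.
  by rewrite /d expr_div_n sqr_sqrtr ?(ltW M0)// mulrC.
rewrite -ltr_pdivlMl// d2 ltr_pXn2r ?nnegrE ?(ltW d0)// -ltcR -rn.
near: y; apply: (@cvgr_dist_lt _ _ _ (nbhs x)); first exact: cvg_id.
by rewrite ltcR.
Unshelve. all: by end_near. Qed.

Section Space.
Variables (R : realType) (n' : nat).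
Local Notation n := n'.+1.
Variable a : nat -> mtuple R n.
Hypothesis a_bi : forall m, bistochastic (a m).

(** Its rotations are all the linear forms of norm at most one in the
    coefficients: they make the space contain an isometric copy of [l_2^n]. *)
Definition scalar_tuple : mtuple R n :=
  @MTuple R n 1 (fun j => (j == ord0)%:R%:M).

Definition tup (m : nat) : mtuple R n :=
  if m is m'.+1 then a m' else scalar_tuple.

Lemma scalar_bistochastic : bistochastic scalar_tuple.
Proof.
split; rewrite (bigD1 ord0)//= big1 ?addr0 => [|j /negbTE ->];
  by rewrite ?eqxx ?tr_scalar_mx ?mul1mx ?raddf0 ?mulmx0 ?mul0mx.
Qed.

Lemma tup_bi m : bistochastic (tup m).
Proof. by case: m => [|m]; [exact: scalar_bistochastic|exact: a_bi]. Qed.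

Definition ublk : choiceType := (nat * 'M[R[i]]_n)%type.
Definition udim (k : ublk) : nat := tup k.1.
Let H := l2H R udim.

Variable w : nat -> bool.

(** The rotation by which the block [k] acts; the blocks that do not belong to
    the space are made zero. *)
Definition urot (k : ublk) : 'M[R[i]]_n :=
  if w k.1 && `[< contraction_mx k.2 >] then k.2 else 0.

Lemma urot_contraction k : contraction_mx (urot k).
Proof.
rewrite /urot; case: ifP => [/andP[_ /asboolP//]|_] v.
by rewrite mulmx0 rv0 rv_ge0.
Qed.

Definition uop (v : 'rV[R[i]]_n) (k : ublk) : 'M[R[i]]_(udim k) :=
  amat (tup k.1) (v *m urot k).

Lemma vn_uop_le v k (x : 'cV_(udim k)) : vn (uop v k *m x) <= rv v * vn x.
Proof.
apply: le_trans (vn_amat_le _ _ (tup_bi _)) _.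
by rewrite ler_wpM2r ?vn_ge0// urot_contraction.
Qed.

Lemma uop_bdd v : mxbdd (uop v).
Proof. by exists (rv v) => k x; exact: vn_uop_le. Qed.

Definition Lop (v : 'rV[R[i]]_n) : H -> H := bop (uop v).

Lemma blk_Lop v (f : H) k :
  blk (Lop v f : ell2 R udim) k = uop v k *m blk (f : ell2 R udim) k.
Proof. exact/blk_bop/uop_bdd. Qed.

Lemma uopD (c : R[i]) u v k : uop (c *: u + v) k = c *: uop u k + uop v k.
Proof. by rewrite /uop mulmxDl -scalemxAl amatD. Qed.

Lemma Lop_linear (c : R[i]) u v : Lop (c *: u + v) = c *: Lop u + Lop v.
Proof.
apply/funext => f; apply: ell2_blk_inj => k.
rewrite blk_Lop uopD mulmxDl -scalemxAl -!blk_Lop.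
by rewrite -blkZ -blkD.
Qed.

HB.instance Definition _ :=
  GRing.isLinear.Build R[i] 'rV[R[i]]_n (H -> H) _ Lop Lop_linear.

Lemma qn_Lop_le v (f : H) :
  qn (Lop v f : ell2 R udim) <= rv v * qn (f : ell2 R udim).
Proof.
have [//|_ h] := @qn_le _ _ _ (Lop v f : ell2 R udim)
  (rv v * qn (f : ell2 R udim)) _.
  move=> A; apply: le_trans (ler_wpM2l (rv_ge0 _) (psum_le_qn A (l2P _))).
  rewrite mulr_sumr; apply: ler_sum => k _; rewrite blk_Lop; exact: vn_uop_le.
exact: h.
Qed.

Lemma Lop_fun_linear v : linear (Lop v).
Proof.
move=> c f g; apply: ell2_blk_inj => k.
rewrite blk_Lop !blkD !blkZ mulmxDr -scalemxAr -!blk_Lop.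
by rewrite -blkZ -blkD.
Qed.

Section MatrixNorm.
Variables (k : nat) (X : 'I_k -> 'I_k -> 'rV[R[i]]_n) (s : R).
Hypothesis s0 : 0 <= s.

Lemma mxopnorm_Lop_le :
  (forall m U, w m -> contraction_mx U ->
    tnorm_le (tup m) (fun i j => X i j *m U) s) ->
  (mxopnorm (\matrix_(i, j) Lop (X i j)) <= s%:E)%E.
Proof.
move=> h; apply: (@mxopnorm_blk_le R ublk udim k (fun i j => uop (X i j))) => //.
- by move=> i j; rewrite mxE.
- by move=> i j; exact: uop_bdd.
move=> [m U] xi; have [/andP[wm /asboolP cU]|no] :=
  boolP (w m && `[< contraction_mx U >]).
  have := h m U wm cU xi.
  by rewrite /uop /urot /= wm asboolT.
rewrite big1 => [|i _]; first by rewrite mulr_ge0 ?sqr_ge0 ?sumr_ge0// => *; exact: vn_ge0.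
rewrite big1 ?vn0// => j _.
rewrite /uop /urot (negbTE no) mulmx0 /amat big1 ?mul0mx// => l _.
by rewrite mxE scale0r.
Qed.

Lemma mxopnorm_Lop_ge :
  (mxopnorm (\matrix_(i, j) Lop (X i j)) <= s%:E)%E ->
  forall m U, w m -> contraction_mx U ->
    tnorm_le (tup m) (fun i j => X i j *m U) s.
Proof.
move=> h m U wm cU xi.
have := @mxopnorm_blk_ge R ublk udim k (fun i j => uop (X i j)) _ _ _ s s0 h
  (m, U) xi.
rewrite /uop /urot /= wm asboolT//; apply.
  by move=> i j; rewrite mxE.
by move=> i j; exact: uop_bdd.
Qed.

End MatrixNorm.

Lemma opnorm_Lop_mx v :
  opnorm (Lop v) = mxopnorm (\matrix_(i < 1, j < 1) Lop v).
Proof.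
by rewrite opnorm_mx1; congr mxopnorm; apply/matrixP => i j; rewrite !mxE.
Qed.

Hypothesis w0 : w 0%N.

Lemma amat_scalar v (x : 'cV[R[i]]_1) : amat scalar_tuple v *m x = v 0 0 *: x.
Proof.
apply/matrixP => i j; rewrite !ord1 mxE big_ord1 [RHS]mxE; congr (_ * _).
rewrite /amat summxE (bigD1 ord0)//= big1 ?addr0 => [|l /negbTE l0].
  by rewrite !mxE eqxx mulr1.
by rewrite !mxE /= l0 mul0rn mulr0.
Qed.

(** The upper bound holds in every block, and a block of the scalar tuple attains
    it. *)
Lemma opnorm_Lop v : opnorm (Lop v) = (Num.sqrt (rv v))%:E.
Proof.
have le : (opnorm (Lop v) <= (Num.sqrt (rv v))%:E)%E.
  rewrite opnorm_Lop_mx; apply: mxopnorm_Lop_le => [|m U _ cU xi].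
    exact: sqrtr_ge0.
  rewrite !big_ord1 sqr_sqrtr ?rv_ge0//.
  apply: le_trans (vn_amat_le _ _ (tup_bi m)) _.
  by rewrite ler_wpM2r ?vn_ge0.
have [v0|vn0] := eqVneq (rv v) 0.
  apply/le_anti; rewrite le v0 sqrtr0 /=.
  by rewrite opnorm_mx1; exact: mxopnorm_ge0.
have vp : 0 < rv v by rewrite lt0r vn0 rv_ge0.
have [s E] : exists s, opnorm (Lop v) = s%:E.
  have := mxopnorm_ge0 (const_mx (Lop v) : 'M[H -> H]_1).
  by rewrite -opnorm_mx1; move: le; case: (opnorm _) => // s; exists s.
have s0 : 0 <= s.
  have := mxopnorm_ge0 (const_mx (Lop v) : 'M[H -> H]_1).
  by rewrite -opnorm_mx1 E lee_fin.
apply/le_anti; rewrite le /= E lee_fin.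
pose c := Num.sqrt (rv v); have c0 : 0 < c by rewrite sqrtr_gt0.
have c2 : c ^+ 2 = rv v by rewrite sqr_sqrtr ?rv_ge0.
(* The contraction with first column the conjugate of v / |v|, and zero elsewhere,
   turns v into |v| e_0. *)
pose U : 'M[R[i]]_n := \matrix_(i, j)
  (if j == ord0 then c^-1%:C%C * (v 0 i)^*%C else 0).
have vU u j : (u *m U) 0 j =
    if j == ord0 then c^-1%:C%C * \sum_i u 0 i * (v 0 i)^*%C else 0.
  rewrite mxE; case: (eqVneq j ord0) => [->|jn].
    by rewrite mulr_sumr; apply: eq_bigr => i _; rewrite mxE eqxx mulrCA.
  by rewrite big1// => i _; rewrite mxE (negbTE jn) mulr0.
have cU : contraction_mx U.
  move=> u; rewrite /rv (bigD1 ord0)//= big1 => [|j /negbTE jn]; last first.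
    by rewrite vU jn nsq0.
  rewrite vU eqxx addr0 nsqM nsq_real exprVn c2 mulrC ler_pdivrMr//.
  apply: le_trans (nsq_sum_le _ _) _.
  by under [X in _ * X <= _]eq_bigr do rewrite nsqJ.
have h := @mxopnorm_Lop_ge 1 (fun _ _ => v) s s0 _ 0%N U w0 cU (fun=> const_mx 1).
move: h; rewrite -opnorm_Lop_mx E lexx => /(_ isT).
rewrite !big_ord1 amat_scalar vU eqxx vnZ.
have -> : vn (const_mx 1 : 'cV[R[i]]_1) = 1.
  by rewrite /vn big_ord1 mxE (nsq_real 1) expr1n.
have -> : \sum_i v 0 i * (v 0 i)^*%C = (rv v)%:C%C.
  rewrite rmorph_sum; apply: eq_bigr => i _.
  by rewrite -sqr_normc normr_nsq.
rewrite -rmorphM nsq_real !mulr1 => h.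
rewrite -(@ler_pXn2r _ 2%N) ?nnegrE ?sqrtr_ge0//; apply: le_trans h.
by rewrite -/c -c2 expr2 mulKf// gt_eqF.
Qed.

Definition Lspace : set (H -> H) := range Lop.

Lemma Lop_bounded v : boundedOp (Lop v).
Proof.
split; first exact: Lop_fun_linear.
apply: (@lipschitz_sq_continuous R H (Lop v) (rv v)) => f g.
rewrite -(linearP_B (Lop_fun_linear v)).
by rewrite !rnorm_l2; exact: qn_Lop_le.
Qed.

Lemma Lspace_linear : linear_subspace Lspace.
Proof.
split; first by exists 0 => //; exact: raddf0.
by move=> c _ _ [u _ <-] [v _ <-]; exists (c *: u + v) => //; exact: Lop_linear.
Qed.

Lemma opnorm_unit (T : H -> H) (e : R) (f : H) :
  (opnorm T <= e%:E)%E -> rnorm f <= 1 -> rnorm (T f) <= e.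
Proof.
move=> Te f1; rewrite -lee_fin; apply: le_trans Te.
by apply: ereal_sup_ubound; exists f.
Qed.

(** The block in which the [j]-th coordinate of [Lop v] can be read. *)
Definition coord_blk (j : 'I_n) : ublk := (0%N, delta_mx j 0).

Lemma mul_delta (v : 'rV[R[i]]_n) j i :
  (v *m (delta_mx j 0 : 'M[R[i]]_n)) 0 i = if i == 0 then v 0 j else 0.
Proof.
rewrite mxE (bigD1 j)//= big1 => [|l /negbTE lj].
  by rewrite mxE eqxx addr0; case: eqP; rewrite ?mulr1 ?mulr0.
by rewrite mxE lj mulr0.
Qed.

Lemma delta_contraction j : contraction_mx (delta_mx j 0 : 'M[R[i]]_n).
Proof.
move=> v; rewrite /rv (bigD1 0)//= big1 => [|i /negbTE i0].
  rewrite mul_delta eqxx addr0 (bigD1 j)//= lerDl.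
  by apply: sumr_ge0 => i _; exact: nsq_ge0.
by rewrite mul_delta i0 nsq0.
Qed.

Definition coord_vec (j : 'I_n) : ell2 R udim :=
  Ell2 (@l2pred_blk_inj R ublk udim (coord_blk j) (const_mx 1)).

Lemma coord_vec_le1 j : rnorm (coord_vec j) <= 1.
Proof.
rewrite -(@ler_pXn2r _ 2%N) ?nnegrE//; last first.
  by rewrite /rnorm l2normE /= sqrtr_ge0.
rewrite rnorm_l2 expr1n.
have [_ h] := @qn_blk_inj R ublk udim (coord_blk j) (const_mx 1).
by apply: le_trans h _; rewrite /vn big_ord1 mxE (nsq_real 1) expr1n.
Qed.

Lemma coord_Lop u j :
  blk (Lop u (coord_vec j) : ell2 R udim) (coord_blk j) 0 0 = u 0 j.
Proof.
rewrite blk_Lop blk_injE /uop /urot /= w0 asboolT; last exact: delta_contraction.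
by rewrite amat_scalar mul_delta eqxx !mxE mulr1.
Qed.

Lemma Lop_inj : injective Lop.
Proof.
move=> u v uv; apply/matrixP => i j; rewrite ord1.
by rewrite -[LHS]coord_Lop uv coord_Lop.
Qed.

(** The coefficients are continuous functions of the operator, since each of them
    can be read in one block; so a limit of operators of the space has
    coefficients too. *)
Lemma Lspace_closed : norm_closed Lspace.
Proof.
move=> T [Tl _] TE.
pose v : 'rV[R[i]]_n :=
  \row_j blk (T (coord_vec j) : ell2 R udim) (coord_blk j) 0 0.
have TB := linearP_B Tl; have TZ := linearP_Z Tl.
have rn0 (f : H) : 0 <= rnorm f by rewrite /rnorm l2normE /= sqrtr_ge0.
suff Tv (g : H) : rnorm g <= 1 -> T g = Lop v g.
  exists v => //; apply/funext => f.
  have c0 : 0 < rnorm f + 1 by rewrite ltr_wpDl.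
  have -> : f = (rnorm f + 1)%:C%C *: ((rnorm f + 1)^-1%:C%C *: f).
    by rewrite scalerA -rmorphM divff ?gt_eqF//= scale1r.
  have LZ := linearP_Z (Lop_fun_linear v).
  rewrite LZ TZ Tv//.
  rewrite -(@ler_pXn2r _ 2%N) ?nnegrE// rnorm_l2 expr1n qnZ; last exact: l2P.
  rewrite nsq_real -rnorm_l2 exprVn mulrC ler_pdivrMr ?exprn_gt0// mul1r.
  by rewrite ler_pXn2r ?nnegrE ?(ltW c0)// lerDl.
move=> g1; have [//|neq] := eqVneq (T g) (Lop v g); exfalso.
pose Q := qn (T g - Lop v g : ell2 R udim).
have Q0 : 0 < Q.
  rewrite lt0r qn_ge0 ?andbT; last exact: l2P.
  apply: contra neq => /eqP /(qn_eq0 (l2P _)) h.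
  by rewrite -subr_eq0; apply/eqP/l2_inj.
pose e2 := Q / (4 * n.+1%:R); have e20 : 0 < e2.
  by rewrite divr_gt0// mulr_gt0.
pose e := Num.sqrt e2; have e0 : 0 < e by rewrite sqrtr_gt0.
have ee : e ^+ 2 = e2 by rewrite sqr_sqrtr// ltW.
have [_ [u _ <-] /ltW Tu] := TE _ e0.
have dist (f : H) : rnorm f <= 1 -> qn (T f - Lop u f : ell2 R udim) <= e2.
  move=> f1; have := opnorm_unit Tu f1.
  rewrite -(@ler_pXn2r _ 2%N) ?nnegrE ?(ltW e0)// rnorm_l2 ee; exact.
have uv : rv (u - v) <= n%:R * e2.
  rewrite /rv -[n in n%:R]card_ord -sum1_card natr_sum mulr_suml.
  apply: ler_sum => j _; rewrite mul1r.
  apply: le_trans (dist _ (coord_vec_le1 j)).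
  have := @nsq_le_qn R ublk udim (T (coord_vec j) - Lop u (coord_vec j))
    (existT _ (coord_blk j) (0 : 'I_1)) (l2P (_ : ell2 R udim)).
  apply: le_trans.
  set z := (z in _ <= nsq z).
  have -> : z = v 0 j - u 0 j by rewrite -[u 0 j]coord_Lop !mxE.
  by rewrite -[nsq (v 0 j - _)]nsqN opprB !mxE.
have : Q <= 2 * e2 + 2 * (n%:R * e2).
  have -> : Q = qn ((T g - Lop u g) + (Lop (u - v) g) : ell2 R udim).
    rewrite /Q; congr (qn _); congr l2val.
    by rewrite raddfB /=; rewrite [RHS]addrA subrK.
  have [_] := qnD_le (l2P (T g - Lop u g : ell2 R udim))
    (l2P (Lop (u - v) g : ell2 R udim)) ltr01.
  rewrite invr1 => h; apply: le_trans h _.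
  apply: lerD; rewrite ler_wpM2l ?dist//.
  apply: le_trans (qn_Lop_le _ _) _; rewrite -[leRHS]mulr1.
  apply: ler_pM => //; rewrite ?rv_ge0//; first by apply: qn_ge0; exact: l2P.
  by rewrite -rnorm_l2 expr_le1.
have -> : 2 * e2 + 2 * (n%:R * e2) = Q / 2.
  have n0 : 0 <= n%:R :> R by [].
  rewrite /e2 -[n.+1%:R]natr1; move: n0; set z := n%:R => z0.
  by field; rewrite gt_eqF//; lra.
by lra.
Qed.

Lemma Lop0 : Lop 0 = 0. Proof. exact: raddf0. Qed.

Lemma LopZ (c : R[i]) v : Lop (c *: v) = c *: Lop v.
Proof. by rewrite -[c *: v]addr0 Lop_linear Lop0 addr0. Qed.

Lemma Lop_sum v : Lop v = \sum_i v 0 i *: Lop (delta_mx 0 i).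
Proof.
by rewrite {1}(row_sum_delta v) raddf_sum; apply: eq_bigr => i _; rewrite -LopZ.
Qed.

Lemma Lspace_operator_space : operator_space Lspace.
Proof.
split; [|exact: Lspace_linear|exact: Lspace_closed].
by move=> _ [v _ <-]; exact: Lop_bounded.
Qed.

Lemma Lspace_dim : has_dim Lspace n.
Proof.
exists (fun i => Lop (delta_mx 0 i)).
have E (c : 'I_n -> R[i]) :
    \sum_i c i *: Lop (delta_mx 0 i) = Lop (\row_i c i).
  by rewrite [RHS]Lop_sum; apply: eq_bigr => i _; rewrite mxE.
split=> [|c].
  apply/seteqP; split => [_ [v _ <-]|_ [c _ <-]]; last first.
    by exists (\row_i c i) => //; rewrite E.
  exists (fun i => v 0 i); first by [].
  exact/esym/Lop_sum.
rewrite E -Lop0 => /Lop_inj /matrixP c0 i.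
by have := c0 0 i; rewrite !mxE.
Qed.

Definition Lopspace : opspace R n :=
  OpSpace Lspace_operator_space Lspace_dim.

Lemma Lopspace_hilbertian : hilbertian Lopspace.
Proof.
exists (Lop : {linear 'rV[R[i]]_n -> (H -> H)}); split=> // v.
rewrite opnorm_Lop /l2norm; congr (Num.sqrt _)%:E; apply: eq_bigr => j _.
by rewrite /rnorm normc_def /= sqr_sqrtr// addr_ge0 ?sqr_ge0.
Qed.

End Space.

Arguments Lop {R n'} a w v.
Arguments Lspace {R n'} a w.

(** * Completely bounded norms and linear isomorphisms *)

Section CbNorm.
Variable R : realType.
Implicit Types H K L : hilbertSpace R.

Lemma rnorm_normE (V : normedModType R[i]) (x : V) : `|x| = (rnorm x)%:C%C.
Proof. by rewrite /rnorm RRe_real// normr_real. Qed.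

Lemma rnorm_ge0 (V : normedModType R[i]) (x : V) : 0 <= rnorm x.
Proof. by have := normr_ge0 x; rewrite rnorm_normE lecR. Qed.

Lemma rnormZ (V : normedModType R[i]) (c : R) (x : V) : 0 <= c ->
  rnorm (c%:C%C *: x) = c * rnorm x.
Proof.
move=> c0; apply: complexI; rewrite -rnorm_normE normrZ rnorm_normE rmorphM.
by rewrite ger0_norm// lecR.
Qed.

Lemma rnorm_eq0 (V : normedModType R[i]) (x : V) : rnorm x = 0 -> x = 0.
Proof. by move=> x0; apply/eqP; rewrite -normr_eq0 rnorm_normE x0. Qed.

Lemma l2normZ (V : normedModType R[i]) k (c : R) (xi : 'I_k -> V) : 0 <= c ->
  l2norm (fun i => c%:C%C *: xi i) = c * l2norm xi.
Proof.
move=> c0; rewrite /l2norm -[X in X * _](ger0_norm c0) -sqrtr_sqr.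
rewrite -sqrtrM ?sqr_ge0// mulr_sumr; congr Num.sqrt.
by apply: eq_bigr => i _; rewrite rnormZ// exprMn.
Qed.

Lemma mxopnorm_scale H k (x : 'M[H -> H]_k) (c s : R) : 0 <= c ->
  (mxopnorm x <= s%:E)%E ->
  (mxopnorm (map_mx (fun T => (c%:C%C : R[i]) *: T) x) <= (c * s)%:E)%E.
Proof.
move=> c0 xs; apply: ge_ereal_sup => _ [xi xi1 <-]; rewrite lee_fin.
have -> : mxact (map_mx (fun T => (c%:C%C : R[i]) *: T) x) xi =
    fun i => c%:C%C *: mxact x xi i.
  apply/funext => i; rewrite /mxact scaler_sumr; apply: eq_bigr => j _.
  by rewrite mxE.
rewrite l2normZ// ler_wpM2l// -lee_fin; apply: le_trans xs.
by apply: ereal_sup_ubound; exists xi.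
Qed.

Section LinearMap.
Variables (H K : hilbertSpace R) (E : set (H -> H)) (F : set (K -> K)).
Variable u : (H -> H) -> (K -> K).
Hypotheses (Es : linear_subspace E) (ul : linear_map E F u).

Lemma linear_map0 : u 0 = 0.
Proof.
have [_ h] := ul; have := h (-1) _ _ Es.1 Es.1.
by rewrite scaler0 addr0 scaleN1r addNr.
Qed.

Lemma linear_mapZ (c : R[i]) x : E x -> u (c *: x) = c *: u x.
Proof.
move=> Ex; have [_ h] := ul.
by rewrite -[c *: x]addr0 h ?linear_map0 ?addr0//; exact: Es.1.
Qed.

Lemma linear_subspaceZ (c : R[i]) x : E x -> E (c *: x).
Proof.
by move=> Ex; rewrite -[c *: x]addr0; apply: Es.2 => //; exact: Es.1.
Qed.

Lemma linear_map_sum (I : Type) (r : seq I) (c : I -> R[i]) x :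
  (forall i, E (x i)) ->
  u (\sum_(i <- r) c i *: x i) = \sum_(i <- r) c i *: u (x i) /\
  E (\sum_(i <- r) c i *: x i).
Proof.
move=> Ex; elim: r => [|i r [IH IH2]].
  by rewrite !big_nil linear_map0; split=> //; exact: Es.1.
rewrite !big_cons; split; last exact: Es.2.
by have [_ ->] := ul; rewrite ?IH.
Qed.

Lemma cb_norm_scale (b s : R) k (x : 'M[H -> H]_k) :
  (cb_norm E u <= b%:E)%E -> 0 < s -> mxover E k x ->
  (mxopnorm x <= s%:E)%E -> (mxopnorm (map_mx u x) <= (b * s)%:E)%E.
Proof.
move=> ub s0 Ex xs.
pose y := map_mx (fun T => (s^-1%:C%C : R[i]) *: T) x.
have si : 0 <= s^-1 by rewrite invr_ge0 ltW.
have y1 : (mxopnorm y <= 1)%E.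
  by have := mxopnorm_scale si xs; rewrite mulVf ?gt_eqF.
have Ey : mxover E k y by move=> i j; rewrite mxE; exact: linear_subspaceZ.
have uy : (mxopnorm (map_mx u y) <= b%:E)%E.
  apply: le_trans ub; apply: (@le_trans _ _ (mxmap_norm E u k)).
    by apply: ereal_sup_ubound; exists y.
  by apply: ereal_sup_ubound; exists k.
have := mxopnorm_scale (ltW s0) uy.
rewrite mulrC; congr (_ <= _)%E; congr mxopnorm; apply/matrixP => i j.
by rewrite !mxE linear_mapZ// scalerA -rmorphM divff ?gt_eqF// scale1r.
Qed.

Lemma opnorm_le_cb_norm x : E x -> (opnorm x <= 1)%E ->
  (opnorm (u x) <= cb_norm E u)%E.
Proof.
move=> Ex x1; apply: (@le_trans _ _ (mxmap_norm E u 1)); last first.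
  by apply: ereal_sup_ubound; exists 1%N.
rewrite opnorm_mx1; apply: ereal_sup_ubound; exists (const_mx x).
  by split=> [i j|/=]; rewrite ?mxE// -opnorm_mx1.
by congr mxopnorm; apply/matrixP => i j; rewrite !mxE.
Qed.

End LinearMap.

Lemma cb_norm_comp H K L (E : set (H -> H)) (F : set (K -> K))
    (G : set (L -> L)) u v (b c : R) :
  linear_subspace F -> linear_map E F u -> linear_map F G v ->
  0 < b -> (cb_norm E u <= b%:E)%E -> (cb_norm F v <= c%:E)%E ->
  (cb_norm E (v \o u) <= (c * b)%:E)%E.
Proof.
move=> Fs ul vl b0 ub vc; apply: ge_ereal_sup => _ [k _ <-].
apply: ge_ereal_sup => _ [x [Ex x1] <-].
rewrite (_ : map_mx (v \o u) x = map_mx v (map_mx u x)); last first.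
  by apply/matrixP => i j; rewrite !mxE.
apply: (cb_norm_scale Fs vl vc b0) => [i j|]; first by rewrite mxE; apply: ul.1.
apply: le_trans ub; apply: (@le_trans _ _ (mxmap_norm E u k)).
  by apply: ereal_sup_ubound; exists x.
by apply: ereal_sup_ubound; exists k.
Qed.

Lemma boundedOp_opnorm H (T : H -> H) : boundedOp T ->
  exists2 M : R, 0 < M & (opnorm T <= M%:E)%E.
Proof.
move=> [Tl Tc].
have T0 := linearP_0 Tl; have TZ := linearP_Z Tl.
have /cvgrPdist_lt /(_ 1 ltr01) := Tc 0.
move=> /nbhs_ballP[e /= e0]; rewrite -ball_normE => eT.
have re0 : 0 < complex.Re e by move: e0; rewrite ltcE /= => /andP[].
have er : e = (complex.Re e)%:C%C by rewrite RRe_real// gtr0_real.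
set r := complex.Re e in re0 er.
exists (2 / r); first by rewrite divr_gt0.
apply: ge_ereal_sup => _ [f /= f1 <-]; rewrite lee_fin.
have : ball_ (@Num.norm _ _) (0 : H) e ((r / 2)%:C%C *: f).
  rewrite /ball_ /= sub0r normrN rnorm_normE er ltcR rnormZ; last lra.
  by have := rnorm_ge0 f; nra.
move=> /eT /=; rewrite T0 sub0r normrN TZ rnorm_normE rnormZ; last lra.
rewrite (ltcR _ 1) => h.
have r2 : 0 < r / 2 by lra.
rewrite -(ler_pM2l r2) [leRHS](_ : _ = 1); first exact: ltW.
by field; rewrite gt_eqF.
Qed.

Lemma opnorm_gt0 H (T : H -> H) : boundedOp T -> T <> 0 -> (0 < opnorm T)%E.
Proof.
move=> [Tl Tc] Tn; rewrite lt_neqAle opnorm_mx1 mxopnorm_ge0 andbT eq_sym.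
rewrite -opnorm_mx1; apply/eqP => T0; apply: Tn; apply/funext => f.
have TZ := linearP_Z Tl.
have c0 : 0 < rnorm f + 1 by rewrite ltr_wpDl ?rnorm_ge0.
have -> : f = (rnorm f + 1)%:C%C *: ((rnorm f + 1)^-1%:C%C *: f).
  by rewrite scalerA -rmorphM divff ?gt_eqF//= scale1r.
rewrite TZ [T _](_ : _ = 0) ?scaler0//; apply: rnorm_eq0; apply/le_anti.
rewrite rnorm_ge0 andbT -lee_fin (_ : 0%:E = opnorm T)//; apply: ereal_sup_ubound.
exists ((rnorm f + 1)^-1%:C%C *: f) => //=.
by rewrite rnormZ ?invr_ge0 ?(ltW c0)// mulrC ler_pdivrMr// mul1r lerDl.
Qed.

Lemma opspace_unit n (E : opspace R n.+1) :
  exists x : os_hilbert E -> os_hilbert E,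
    [/\ @os_set R _ E x, (opnorm x <= 1)%E & x <> 0].
Proof.
have [Eb Es _] := os_operator_space E; have [b [bE bI]] := os_dim E.
have Eb0 : @os_set R _ E (b ord0).
  rewrite bE; exists (fun i => (i == ord0)%:R) => //.
  by rewrite (bigD1 ord0)//= big1 ?addr0 ?scale1r// => i /negbTE ->; rewrite scale0r.
have [M M0 bM] := boundedOp_opnorm (Eb _ Eb0).
have b0 : b ord0 <> 0.
  move=> b0; have := bI (fun i => (i == ord0)%:R).
  rewrite (bigD1 ord0)//= big1 ?addr0 ?scale1r => [/(_ b0 ord0)|i /negbTE ->].
    by rewrite eqxx => /eqP; rewrite oner_eq0.
  by rewrite scale0r.
exists ((M^-1%:C%C : R[i]) *: b ord0); split.
- exact: (linear_subspaceZ Es).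
- rewrite opnorm_mx1.
  have Mi : 0 <= M^-1 by rewrite invr_ge0 ltW.
  have := @mxopnorm_scale _ _ _ M^-1 M Mi (_ : (mxopnorm (const_mx (b ord0) :
    'M[os_hilbert E -> os_hilbert E]_1) <= M%:E)%E).
  rewrite -opnorm_mx1 mulVf ?gt_eqF// => /(_ bM).
  congr (_ <= _)%E; congr mxopnorm; apply/matrixP => i j; rewrite !mxE//.
- move=> /(congr1 (fun T => (M%:C%C : R[i]) *: T)).
  by rewrite scalerA -rmorphM divff ?gt_eqF//= scale1r scaler0.
Qed.

Lemma cb_norm_gt0 n (E F : opspace R n.+1) u v : linear_iso E F u v ->
  (0 < cb_norm E u)%E.
Proof.
move=> [ul vl uK vK]; have [x [Ex x1 x0]] := opspace_unit E.
have [_ Es _] := os_operator_space E; have [Fb Fs _] := os_operator_space F.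
apply: lt_le_trans (opnorm_le_cb_norm _ Ex x1).
apply: opnorm_gt0; first by apply: Fb; exact: ul.1.
by move=> ux0; apply: x0; rewrite -(uK _ Ex) ux0 (linear_map0 Fs vl).
Qed.

(** Both factors are positive, so that a finite product has finite factors, in
    spite of the convention for the product of zero and infinity. *)
Lemma iso_cb_norm_fin n (E F : opspace R n.+1) u v (r : R) :
  linear_iso E F u v -> (cb_norm E u * cb_norm F v < r%:E)%E ->
  exists b c : R, [/\ cb_norm E u = b%:E, cb_norm F v = c%:E,
    0 < b, 0 < c & b * c < r].
Proof.
move=> iso; have u0 := cb_norm_gt0 iso.
have v0 := cb_norm_gt0 (linear_iso_sym iso).
move: u0 v0; case: (cb_norm E u) => [b| |]//; case: (cb_norm F v) => [c| |]// b0 c0.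
- by rewrite -EFinM lte_fin; exists b, c.
- by rewrite gt0_muley.
- by rewrite gt0_mulye.
Qed.

Lemma d_cb_lt_iso n (E F : opspace R n.+1) (r : R) : (d_cb E F < r%:E)%E ->
  exists u v b c, [/\ linear_iso E F u v, (cb_norm E u <= b%:E)%E,
    (cb_norm F v <= c%:E)%E & [/\ 0 < b, 0 < c & b * c < r]].
Proof.
move=> /ereal_inf_lt [_ [[u v] /= iso <-] /(iso_cb_norm_fin iso)].
by move=> [b [c [ub vc b0 c0 bc]]]; exists u, v, b, c; rewrite ub vc.
Qed.

Lemma d_cb_lt_trans n (E F G : opspace R n.+1) (r : R) :
  (d_cb E F < r%:E)%E -> (d_cb G F < r%:E)%E -> 
  exists u v b c, [/\ linear_iso E G u v, (cb_norm E u <= b%:E)%E,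
    (cb_norm G v <= c%:E)%E & [/\ 0 < b, 0 < c & b * c < r ^+ 2]].
Proof.
move=> /d_cb_lt_iso [u [u' [b [b' [iu ub u'b [b0 b'0 bb]]]]]].
move=> /d_cb_lt_iso [v [v' [c [c' [iv vc v'c [c0 c'0 cc]]]]]].
have [ul u'l _ _] := iu; have [vl v'l _ _] := iv.
have [_ Fs _] := os_operator_space F.
exists (v' \o u), (u' \o v), (c' * b), (b' * c); split.
- exact: linear_iso_comp iu (linear_iso_sym iv).
- exact: (cb_norm_comp Fs ul v'l).
- exact: (cb_norm_comp Fs vl u'l).
- split; [exact: mulr_gt0|exact: mulr_gt0|].
  rewrite (_ : c' * b * (b' * c) = b * b' * (c * c')); last by ring.
  by rewrite expr2 ltr_pM// ?ltW ?mulr_gt0.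
Qed.

End CbNorm.

(** * Homogeneity, and separation by a matrix of coefficients *)

Section Homogeneous.
Variables (R : realType) (n' : nat).
Local Notation n := n'.+1.
Variable a : nat -> mtuple R n.
Hypothesis a_bi : forall m, bistochastic (a m).
Let H := l2H R (udim a).

Lemma Lop_matrix (w w' : nat -> bool) (u : (H -> H) -> (H -> H)) :
  linear_map (Lspace a w) (Lspace a w') u ->
  exists M : 'M[R[i]]_n, forall v, u (Lop a w v) = Lop a w' (v *m M).
Proof.
move=> ul; have Es := Lspace_linear a_bi w.
have Ew v : Lspace a w (Lop a w v) by exists v.
have /choice [f fE] (i : 'I_n) :
    exists v, u (Lop a w (delta_mx 0 i)) = Lop a w' v.
  by have [v _ <-] := ul.1 _ (Ew (delta_mx 0 i)); exists v.
exists (\matrix_i f i) => v; rewrite (Lop_sum a_bi w v).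
have [-> _] := linear_map_sum Es ul (index_enum 'I_n) (fun i => v 0 i)
  (fun i => Ew (delta_mx 0 i)).
under eq_bigr do rewrite fE.
rewrite mulmx_sum_row.
elim/big_rec2: _ => [|i y1 y2 _ ->]; first by rewrite (Lop0 a_bi).
by rewrite (Lop_linear a_bi) rowK.
Qed.

Lemma map_mx_Lop (w w' : nat -> bool) (u : (H -> H) -> (H -> H)) M k
    (X : 'I_k -> 'I_k -> 'rV[R[i]]_n) :
  (forall v, u (Lop a w v) = Lop a w' (v *m M)) ->
  map_mx u (\matrix_(i, j) Lop a w (X i j)) =
  \matrix_(i, j) Lop a w' (X i j *m M).
Proof.
by move=> uM; apply/matrixP => i j; rewrite mxE [X in u X]mxE [RHS]mxE uM.
Qed.

Lemma mxover_Lop (w : nat -> bool) k (x : 'M[H -> H]_k) :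
  mxover (Lspace a w) k x ->
  exists X : 'I_k -> 'I_k -> 'rV[R[i]]_n, x = \matrix_(i, j) Lop a w (X i j).
Proof.
move=> xE; have /choice [X XE] (ij : 'I_k * 'I_k) :
    exists v, x ij.1 ij.2 = Lop a w v.
  by have [v _ <-] := xE ij.1 ij.2; exists v.
exists (fun i j => X (i, j)); apply/matrixP => i j.
by rewrite mxE -(XE (i, j)).
Qed.

Section OneSpace.
Variable w : nat -> bool.
Hypothesis w0 : w 0%N.

(** After the coefficients are multiplied by a contraction [M], the block of [U]
    is the former block of [M U]. *)
Lemma mxopnorm_Lop_mul k (X : 'I_k -> 'I_k -> 'rV[R[i]]_n) M (b s : R) :
  0 <= b -> 0 <= s -> (forall v, rv (v *m M) <= b ^+ 2 * rv v) ->
  (mxopnorm (\matrix_(i, j) Lop a w (X i j)) <= s%:E)%E ->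
  (mxopnorm (\matrix_(i, j) Lop a w (X i j *m M)) <= (b * s)%:E)%E.
Proof.
move=> b0 s0 bM Xs; apply: mxopnorm_Lop_le => //; first exact: mulr_ge0.
move=> m U wm cU xi.
have [b00|bn] := eqVneq b 0.
  have vM (v : 'rV[R[i]]_n) : v *m M = 0.
    apply: rv_eq0; apply/le_anti; rewrite rv_ge0 andbT.
    by have := bM v; rewrite b00 expr0n mul0r.
  rewrite big1 => [|i _].
    by rewrite mulr_ge0 ?sqr_ge0 ?sumr_ge0// => *; exact: vn_ge0.
  rewrite big1 ?vn0// => j _; rewrite vM mul0mx /amat big1 ?mul0mx// => l _.
  by rewrite mxE scale0r.
have bp : 0 < b by rewrite lt0r bn.
have cV : contraction_mx (b^-1%:C%C *: (M *m U)).
  move=> v; rewrite -scalemxAr rvZ nsq_real exprVn mulrC ler_pdivrMr ?exprn_gt0//.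
  by rewrite mulmxA mulrC; apply: le_trans (cU _) _.
have h := mxopnorm_Lop_ge a_bi s0 Xs wm cV xi.
rewrite exprMn -mulrA -ler_pdivrMl ?exprn_gt0//; apply: le_trans h.
rewrite mulr_sumr; apply: ler_sum => i _.
rewrite -exprVn -nsq_real -vnZ scaler_sumr.
rewrite le_eqVlt; apply/orP; left; apply/eqP; congr vn.
by apply: eq_bigr => j _; rewrite scalemxAl -amatZ -scalemxAr mulmxA.
Qed.

Lemma rv_mul_le (w' : nat -> bool) (u : (H -> H) -> (H -> H)) M (b : R) :
  w' 0%N -> 0 <= b -> (forall v, u (Lop a w v) = Lop a w' (v *m M)) ->
  (forall x, Lspace a w x -> (opnorm x <= 1)%E -> (opnorm (u x) <= b%:E)%E) ->
  forall v, rv (v *m M) <= b ^+ 2 * rv v.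
Proof.
move=> w'0 b0 uM ub v.
have [v0|vn] := eqVneq (rv v) 0.
  by rewrite v0 (rv_eq0 v0) mul0mx rv0 mulr0.
have vp : 0 < rv v by rewrite lt0r vn rv_ge0.
pose c := (Num.sqrt (rv v))^-1.
have c2 : c ^+ 2 = (rv v)^-1 by rewrite exprVn sqr_sqrtr ?rv_ge0.
have Ex : Lspace a w (Lop a w (c%:C%C *: v)) by exists (c%:C%C *: v).
have x1 : (opnorm (Lop a w (c%:C%C *: v)) <= 1)%E.
  by rewrite (opnorm_Lop a_bi w0) lee_fin rvZ nsq_real c2 mulVf// sqrtr1.
have := ub _ Ex x1; rewrite (uM (c%:C%C *: v)) (opnorm_Lop a_bi w'0).
rewrite lee_fin -scalemxAl rvZ nsq_real c2.
rewrite -(@ler_pXn2r _ 2%N) ?nnegrE ?sqrtr_ge0// sqr_sqrtr; last first.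
  by rewrite mulr_ge0 ?invr_ge0 ?rv_ge0.
by rewrite mulrC ler_pdivrMr.
Qed.

Lemma Lopspace_homogeneous : homogeneous (Lopspace a_bi w0).
Proof.
move=> u ul ufin; set E := Lspace a w.
have [M uM] := Lop_matrix ul.
have E0 : E 0 by exact: (Lspace_linear a_bi w).1.
have op0 : opnorm (0 : H -> H) = 0%E.
  rewrite -(Lop0 a_bi w) (opnorm_Lop a_bi w0).
  by rewrite rv0 sqrtr0.
have u0 : (0 <= map_norm E u)%E.
  apply: (@le_trans _ _ (opnorm (u 0))).
    by rewrite opnorm_mx1 mxopnorm_ge0.
  by apply: ereal_sup_ubound; exists 0 => //; split=> //=; rewrite op0.
have [s sE] : exists s, map_norm E u = s%:E.
  by move: u0 ufin; rewrite -/E; case: (map_norm E u) => // s; exists s.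
have s0 : 0 <= s by rewrite -lee_fin -sE.
apply/le_anti/andP; split.
  apply: ge_ereal_sup => _ [x [Ex x1] <-].
  exact: opnorm_le_cb_norm.
have sM := @rv_mul_le w u M s w0 s0 uM.
have {}sM v : rv (v *m M) <= s ^+ 2 * rv v.
  apply: sM => x Ex x1; rewrite -sE; apply: ereal_sup_ubound.
  by exists x.
rewrite -/E sE; apply: ge_ereal_sup => _ [k _ <-].
apply: ge_ereal_sup => _ [x [/mxover_Lop [X ->] x1] <-].
rewrite (map_mx_Lop _ uM) -[s]mulr1.
exact: mxopnorm_Lop_mul.
Qed.

End OneSpace.

(** The matrix over the second space with coefficients [X] has norm at most [rho].
    Going back to the first space by [v] multiplies the norm by at most [c], and
    the coefficients by the inverse of the matrix of [u]. By homogeneity this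
    matrix acts on the first space with norm at most [b]; multiplying by it
    restores [X], whose norm over the first space is at least one. *)
Lemma iso_cb_norm_ge (w w' : nat -> bool) (w0 : w 0%N) (w'0 : w' 0%N)
    u v (b c rho : R) k (X : 'I_k -> 'I_k -> 'rV[R[i]]_n) m :
  linear_iso (Lspace a w) (Lspace a w') u v ->
  0 < b -> 0 < c -> 0 < rho ->
  (cb_norm (Lspace a w) u <= b%:E)%E -> (cb_norm (Lspace a w') v <= c%:E)%E ->
  w m -> (forall s, 0 <= s -> tnorm_le (tup a m) X s -> 1 <= s) ->
  (forall m' U, w' m' -> contraction_mx U ->
    tnorm_le (tup a m') (fun i j => X i j *m U) rho) ->
  1 <= b * (c * rho).
Proof.
move=> [ul vl uK vK] b0 c0 r0 ub vc wm Xge Xle.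
have [M uM] := Lop_matrix ul; have [M' vM'] := Lop_matrix vl.
have MK (x : 'rV[R[i]]_n) : x *m M' *m M = x.
  by apply: (Lop_inj a_bi w'0); rewrite -uM -vM' vK//; exists x.
have bM := @rv_mul_le w w0 w' u M b w'0 (ltW b0) uM.
have {}bM x : rv (x *m M) <= b ^+ 2 * rv x.
  apply: bM => y Ey y1; apply: le_trans ub.
  exact: opnorm_le_cb_norm.
have h1 := mxopnorm_Lop_le a_bi (ltW r0) Xle.
have h2 : (mxopnorm (\matrix_(i, j) Lop a w (X i j *m M')) <= (c * rho)%:E)%E.
  rewrite -(map_mx_Lop X vM').
  apply: (cb_norm_scale (Lspace_linear a_bi w') vl vc r0) h1.
  by move=> i j; rewrite mxE; exists (X i j).
have cr : 0 <= c * rho by rewrite ltW ?mulr_gt0.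
have h3 := mxopnorm_Lop_mul (ltW b0) cr bM h2.
apply: Xge; first by rewrite mulr_ge0 ?ltW ?mulr_gt0.
have br : 0 <= b * (c * rho) by rewrite ltW ?mulr_gt0.
have c1 : contraction_mx (1%:M : 'M[R[i]]_n) by move=> x; rewrite mulmx1.
have := mxopnorm_Lop_ge a_bi br h3 wm c1.
suff -> : (fun i j => X i j *m M' *m M *m 1%:M) = X by [].
by apply/funext => i; apply/funext => j; rewrite mulmx1 MK.
Qed.

End Homogeneous.

(** * Reduction to a family of tuples *)

Lemma OS_repr_class (R : realType) n (Y : OS R n) : OS_class (OS_repr Y) = Y.
Proof.
rewrite /OS_repr; case: cid => F /=; case: Y => mem P /= memF.
rewrite /OS_class; move: (ex_intro _ _ _) P; rewrite -memF => p q.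
by congr MkOS; exact: Prop_irrelevance.
Qed.

Lemma d_cb_ge0 (R : realType) n (E F : opspace R n) : (0 <= d_cb E F)%E.
Proof. by apply: le_ereal_inf_tmp => _ [w _ <-]; rewrite mule_ge0 ?cb_norm_ge0. Qed.

(** Cantor's diagonal argument. *)
Lemma no_injection_bool_seq (h : (nat -> bool) -> nat) : ~ injective h.
Proof.
move=> hI; pose g := fun m => `[< exists2 g, h g = m & g m = false >].
have [gT|gF] := boolP (g (h g)).
  by have /asboolP [g' /hI -> gF] := gT; rewrite gF in gT.
have : g (h g) by apply/asboolP; exists g => //; apply/negbTE.
by rewrite (negbTE gF).
Qed.

(** If [d_cb] is less than [rho^(-1/2)] from two of the spaces to a common one, then
    it is less than [1 / rho] between them, so they are equal. Hence the choice of
    a close point in a countable dense set would be an injection of the boolean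
    sequences into the integers. *)
Lemma nonseparable_of_family (R : realType) n' (a : nat -> mtuple R n'.+1)
    (rho : R) :
  (forall m, bistochastic (a m)) -> 0 < rho < 1 ->
  (forall m, exists k (X : 'I_k -> 'I_k -> 'rV[R[i]]_n'.+1),
    (forall s, 0 <= s -> tnorm_le (a m) X s -> 1 <= s) /\
    (forall m' U, m' != m.+1 -> contraction_mx U ->
      tnorm_le (tup a m') (fun i j => X i j *m U) rho)) ->
  ~ separable_subset (@delta_cb R n'.+1) (@HH R n'.+1).
Proof.
move=> a_bi /andP[r0 r1] sep [D [_ [f fI] Dd]].
pose w (g : nat -> bool) m := if m is m'.+1 then g m' else true.
pose E g : opspace R n'.+1 := Lopspace a_bi (erefl : w g 0%N).
pose r := Num.sqrt rho^-1.
have rho1 : 1 < rho^-1 by rewrite invf_gt1.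
have r2 : r ^+ 2 = rho^-1 by rewrite sqr_sqrtr// invr_ge0 ltW.
have r_gt1 : 1 < r by rewrite -sqrtr1 ltr_sqrt// invr_gt0.
have lr : 0 < ln r by rewrite ln_gt0.
have HHE g : HH (OS_class (E g)).
  exists (E g); split=> //; first exact: Lopspace_hilbertian.
  exact: Lopspace_homogeneous.
have /choice [y yP] g : exists Y, D Y /\ (d_cb (E g) (OS_repr Y) < r%:E)%E.
  have [Y DY dY] := Dd _ (HHE g) _ lr; exists Y; split=> //.
  move: dY; rewrite -{1}[Y]OS_repr_class delta_cb_class.
  have -> : (ln r)%:E = lne r%:E by rewrite lne_EFin// (lt_trans ltr01).
  rewrite lte_lne//; rewrite in_itv /= ?leey ?d_cb_ge0// andbT lee_fin.
  by rewrite ltW// (lt_trans ltr01).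
apply: (@no_injection_bool_seq (f \o y)) => g g' /= fy.
have [Dg dg] := yP g; have [Dg' dg'] := yP g'.
have yy := fI _ _ Dg Dg' fy; rewrite -yy in dg'.
have [u [v [b [c [iso ub vc [b0 c0 bc]]]]]] := d_cb_lt_trans dg dg'.
have bcr : b * c * rho < 1 by rewrite -ltr_pdivlMr// mul1r -r2.
have key h h' p q (x : (l2H R (udim a) -> l2H R (udim a)) -> _) x' m :
    linear_iso (Lspace a (w h)) (Lspace a (w h')) x x' ->
    (cb_norm (Lspace a (w h)) x <= p%:E)%E ->
    (cb_norm (Lspace a (w h')) x' <= q%:E)%E -> 0 < p -> 0 < q ->
    p * q * rho < 1 -> h m -> ~~ h' m -> False.
  move=> i1 xp xq p0 q0 pq hm h'm.
  have [k [X [X1 X2]]] := sep m.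
  have := @iso_cb_norm_ge R n' a a_bi (w h) (w h') erefl erefl x x' p q rho k X
    m.+1 i1 p0 q0 r0 xp xq hm X1.
  rewrite mulrA leNgt pq => /(_ _)/negP; apply=> // m' U wm'; apply: X2.
  by apply: contraTN wm' => /eqP ->.
apply/funext => m; case: (boolP (g m)) => gm; case: (boolP (g' m)) => gm' //.
  exact: False_ind (key g g' b c u v m iso ub vc b0 c0 bcr gm gm').
have cbr : c * b * rho < 1 by rewrite [c * b]mulrC.
have iso' := linear_iso_sym iso.
exact: False_ind (key g' g c b v u m iso' vc ub c0 b0 cbr gm' gm).
Qed.

(** * A quantum spectral gap bounds the pairing of two tuples *)

Section HilbertSchmidt.
Variable R : realType.
Local Notation C := R[i].

Definition adjm m p (A : 'M[C]_(m, p)) : 'M[C]_(p, m) := map_mx Num.conj A^T.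

(** The square of the Hilbert-Schmidt norm, and the real inner product. *)
Definition hs m p (A : 'M[C]_(m, p)) : R := \sum_i \sum_j nsq (A i j).
Definition rd m p (A B : 'M[C]_(m, p)) : R := complex.Re (\tr (A *m adjm B)).

Lemma adjmK m p (A : 'M[C]_(m, p)) : adjm (adjm A) = A.
Proof. by apply/matrixP => i j; rewrite !mxE conjCK. Qed.

Lemma adjmM m p q (A : 'M[C]_(m, p)) (B : 'M[C]_(p, q)) :
  adjm (A *m B) = adjm B *m adjm A.
Proof. by rewrite /adjm trmx_mul map_mxM. Qed.

Lemma adjm_cmx m p (A : 'M[R]_(m, p)) : adjm (cmx A) = cmx A^T.
Proof. by apply/matrixP => i j; rewrite !mxE; exact: conjc_real. Qed.

Lemma adjm_diag p (d : 'rV[R]_p) : adjm (diag_mx (cmx d)) = diag_mx (cmx d).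
Proof.
rewrite /adjm tr_diag_mx map_diag_mx; congr diag_mx.
by apply/matrixP => i j; rewrite !mxE; exact: conjc_real.
Qed.

Lemma tr_adjm m (A : 'M[C]_m) : complex.Re (\tr (adjm A)) = complex.Re (\tr A).
Proof.
rewrite /mxtrace !raddf_sum; apply: eq_bigr => i _; rewrite !mxE.
by case: (A i i).
Qed.

Lemma hs_ge0 m p (A : 'M[C]_(m, p)) : 0 <= hs A.
Proof. by apply: sumr_ge0 => i _; apply: sumr_ge0 => j _; exact: nsq_ge0. Qed.

Lemma hs_tr m p (A : 'M[C]_(m, p)) : \tr (A *m adjm A) = (hs A)%:C%C.
Proof.
rewrite /hs rmorph_sum; apply: eq_bigr => i _; rewrite mxE rmorph_sum.
by apply: eq_bigr => j _; rewrite !mxE /= -normr_nsq sqr_normc.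
Qed.

Lemma hs_rd m p (A : 'M[C]_(m, p)) : hs A = rd A A.
Proof. by rewrite /rd hs_tr. Qed.

Lemma rdC m p (A B : 'M[C]_(m, p)) : rd A B = rd B A.
Proof. by rewrite /rd -tr_adjm adjmM adjmK. Qed.

Lemma rdDl m p (A A' B : 'M[C]_(m, p)) : rd (A + A') B = rd A B + rd A' B.
Proof. by rewrite /rd mulmxDl !raddfD. Qed.

Lemma rdNl m p (A B : 'M[C]_(m, p)) : rd (- A) B = - rd A B.
Proof. by rewrite /rd mulNmx !raddfN. Qed.

Lemma rdZl m p (c : R) (A B : 'M[C]_(m, p)) : rd (c%:C%C *: A) B = c * rd A B.
Proof.
rewrite /rd -scalemxAl mxtraceZ; case: (\tr _) => x y /=.
by rewrite mul0r subr0.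
Qed.

Lemma hsB m p (A B : 'M[C]_(m, p)) : hs (A - B) = hs A + hs B - 2 * rd A B.
Proof.
rewrite !hs_rd rdDl rdNl rdC rdDl rdNl [rd B (A - B)]rdC rdDl rdNl.
by rewrite (rdC B A); ring.
Qed.

Lemma rd_le m p (A B : 'M[C]_(m, p)) : 2 * rd A B <= hs A + hs B.
Proof. by have := hs_ge0 (A - B); rewrite hsB; lra. Qed.

Lemma hsD_le m p (A B : 'M[C]_(m, p)) : hs (A + B) <= 2 * hs A + 2 * hs B.
Proof.
have := hsB A (- B); rewrite opprK => ->.
rewrite rdC rdNl (rdC B A) (_ : hs (- B) = hs B).
  by have := rd_le A B; lra.
by rewrite !hs_rd rdNl rdC rdNl opprK.
Qed.

Lemma hsZ m p (c : R) (A : 'M[C]_(m, p)) : hs (c%:C%C *: A) = c ^+ 2 * hs A.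
Proof.
rewrite /hs mulr_sumr; apply: eq_bigr => i _; rewrite mulr_sumr.
by apply: eq_bigr => j _; rewrite mxE nsqM nsq_real.
Qed.

Lemma hs_eq0 m p (A : 'M[C]_(m, p)) : hs A = 0 -> A = 0.
Proof.
move/eqP; rewrite psumr_eq0 => [/allP h|i _]; last first.
  by apply: sumr_ge0 => j _; exact: nsq_ge0.
apply/matrixP => i j; rewrite mxE; apply/eqP.
have := h i (mem_index_enum i); rewrite psumr_eq0 => [/allP|k _]; last exact: nsq_ge0.
by move=> /(_ j (mem_index_enum j)); rewrite nsq_eq0.
Qed.

Lemma hs_adjm m p (A : 'M[C]_(m, p)) : hs (adjm A) = hs A.
Proof. by apply: complexI; rewrite -!hs_tr adjmK mxtrace_mulC. Qed.

Lemma hs_mul_adj m p (A : 'M[C]_(m, p)) : hs (A *m adjm A) = hs (adjm A *m A).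
Proof.
apply: complexI; rewrite -!hs_tr !adjmM !adjmK.
by rewrite -!mulmxA mxtrace_mulC !mulmxA.
Qed.

Lemma hs_cols m p (A : 'M[C]_(m, p)) : hs A = \sum_j \sum_i nsq (A i j).
Proof. exact: exchange_big. Qed.

Lemma hs_diag p (d : 'rV[R]_p) : hs (diag_mx (cmx d)) = \sum_j d 0 j ^+ 2.
Proof.
apply: eq_bigr => i _; rewrite (bigD1 i)//= big1 => [|j /negbTE ji].
  by rewrite !mxE eqxx addr0 mulr1n nsq_real.
by rewrite !mxE eq_sym ji mulr0n nsq0.
Qed.

(** If [s] is the modulus of [Y] and [V] its polar part, the factors are
    [V s^(1/2)] and [s^(1/2)], up to the unitary matrix that diagonalizes [s]. *)
Lemma balanced_factor N p (Y : 'M[C]_(N, p)) :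
  exists (y1 : 'M[C]_(N, p)) (y2 : 'M[C]_p),
    [/\ Y = y1 *m y2, hs (y1 *m adjm y1) = hs Y, hs (adjm y2 *m y2) = hs Y &
        hs y1 ^+ 2 <= p%:R * hs Y].
Proof.
pose G := adjm Y *m Y.
have Gn : G \is normalmx.
  apply/normalmxP; suff -> : (map_mx Num.conj G^T) = G by [].
  by rewrite -/(adjm G) /G adjmM adjmK.
have Pu := spectral_unitarymx G; have /orthomx_spectralP := Gn.
rewrite (invmx_unitary Pu); set P := spectralmx G in Pu *.
rewrite -/(adjm P) => GE.
have PP : P *m adjm P = 1%:M by apply/unitarymxP.
have PP' : adjm P *m P = 1%:M by apply: mulmx1C.
pose Z := Y *m adjm P.
have ZZ : adjm Z *m Z = diag_mx (spectral_diag G).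
  rewrite /Z adjmM adjmK -mulmxA (mulmxA (adjm Y)) -/G [X in _ *m (X *m _)]GE.
  by rewrite !mulmxA PP mul1mx -mulmxA PP mulmx1.
pose d := \row_i \sum_k nsq (Z k i).
have d0 i : 0 <= d 0 i by rewrite mxE; apply: sumr_ge0 => k _; exact: nsq_ge0.
have {}ZZ : adjm Z *m Z = diag_mx (cmx d).
  rewrite ZZ; congr diag_mx; apply/matrixP => i j; rewrite ord1.
  have /matrixP /(_ j j) := ZZ; rewrite [RHS]mxE eqxx mulr1n => <-.
  rewrite !mxE rmorph_sum; apply: eq_bigr => k _; rewrite !mxE /= mulrC.
  by rewrite -normr_nsq sqr_normc.
have ZE i k : d 0 i = 0 -> Z k i = 0.
  rewrite mxE => /eqP; rewrite psumr_eq0 => [/allP h|l _]; last exact: nsq_ge0.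
  by apply/eqP; rewrite -nsq_eq0; apply: (h k); rewrite mem_index_enum.
have hsY : \sum_i d 0 i = hs Y.
  transitivity (hs Z); first by rewrite hs_cols; apply: eq_bigr => i _; rewrite mxE.
  apply: complexI; rewrite -!hs_tr /Z adjmM adjmK.
  by rewrite mulmxA -(mulmxA Y) PP' mulmx1.
pose s : 'rV[R]_p := map_mx Num.sqrt d; pose t : 'rV[R]_p := map_mx Num.sqrt s.
have s0 i : 0 <= s 0 i by rewrite mxE sqrtr_ge0.
have s2 i : s 0 i ^+ 2 = d 0 i by rewrite mxE sqr_sqrtr.
have t2 i : t 0 i ^+ 2 = s 0 i by rewrite mxE sqr_sqrtr.
pose ti : 'rV[R]_p := map_mx (fun x => x^-1) t.
have tis j : ti 0 j * d 0 j * ti 0 j = s 0 j.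
  rewrite [ti 0 j]mxE -s2 -t2; have [->|q0] := eqVneq (t 0 j) 0.
    by rewrite invr0 !mul0r expr0n.
  by field.
exists (Z *m diag_mx (cmx ti)), (diag_mx (cmx t) *m P).
have y1y1 : adjm (Z *m diag_mx (cmx ti)) *m (Z *m diag_mx (cmx ti)) =
    diag_mx (cmx s).
  rewrite adjmM adjm_diag mulmxA -(mulmxA _ (adjm Z)) ZZ.
  rewrite !mulmx_diag; congr diag_mx; apply/matrixP => i j; rewrite ord1 !mxE.
  rewrite -!rmorphM; congr (_%:C)%C.
  by have := tis j; rewrite !mxE.
split.
- rewrite mulmxA -(mulmxA Z) mulmx_diag.
  rewrite [X in X *m P](_ : _ = Z); first by rewrite -mulmxA PP' mulmx1.
  apply/matrixP => k i; rewrite mul_mx_diag !mxE.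
  have [di|dn] := eqVneq (d 0 i) 0.
    by have := ZE i k di; rewrite mxE => ->; rewrite mul0r.
  rewrite -rmorphM mulVf ?mulr1//.
  apply: contra dn => /eqP ti0; rewrite -s2 -t2.
  by rewrite [t 0 i]mxE [s 0 i]mxE [d 0 i]mxE ti0 !expr0n.
- by rewrite hs_mul_adj y1y1 hs_diag -hsY; apply: eq_bigr => i _; rewrite s2.
- rewrite -hs_mul_adj adjmM mulmxA -(mulmxA _ P) PP mulmx1 adjm_diag mulmx_diag.
  rewrite [X in diag_mx X](_ : _ = cmx s).
    by rewrite hs_diag -hsY; apply: eq_bigr => i _; rewrite s2.
  apply/matrixP => i j; rewrite ord1 !mxE -rmorphM -expr2.
  by have := t2 j; rewrite !mxE => ->.
- have -> : hs (Z *m diag_mx (cmx ti)) = \sum_i s 0 i.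
    apply: complexI; rewrite -hs_tr mxtrace_mulC y1y1 rmorph_sum.
    by apply: eq_bigr => i _; rewrite !mxE eqxx mulr1n.
  have := @nsq_sum_le R _ (fun i : 'I_p => (1 : R)%:C%C) (fun i => (s 0 i)%:C%C).
  have -> : \sum_i (1 : R)%:C%C * (s 0 i)%:C%C = (\sum_i s 0 i)%:C%C.
    by rewrite rmorph_sum; apply: eq_bigr => i _; rewrite -rmorphM mul1r.
  have -> : \sum_(i < p) nsq (1 : R)%:C%C = p%:R.
    by rewrite nsq_real expr1n sumr_const card_ord.
  rewrite nsq_real -hsY => /le_trans -> //; rewrite ler_wpM2l//.
  by apply: ler_sum => i _; rewrite nsq_real s2.
Qed.

(** For [A = y y^*] and [B = x x^*] of norm one, the sum of the [a_j A a_j^*] does not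
    approach [B]. As [hs y] is the trace of [A], the hypothesis on it says that [A]
    is far from the identity; it holds when the rank of [A] is at most [p]. *)
Definition quantum_gap N n (a : 'I_n -> 'M[R]_N) (p : nat) (delta : R) :=
  forall x y : 'M[C]_(N, p), hs (x *m adjm x) = 1 -> hs (y *m adjm y) = 1 ->
  hs y ^+ 2 <= p%:R ->
  \sum_j rd (cmx (a j) *m (y *m adjm y) *m adjm (cmx (a j))) (x *m adjm x)
    <= 1 - delta.

Lemma rd_sum m p (I : finType) (A : I -> 'M[C]_(m, p)) B :
  rd (\sum_i A i) B = \sum_i rd (A i) B.
Proof.
by rewrite /rd mulmx_suml [\tr _]raddf_sum raddf_sum.
Qed.

(** Cauchy-Schwarz, after [Y] and [X] are split as [y1 y2] and [x1 x2] : the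
    trace of [a Y b X^*] is the product of [x1^* a y1] and [y2 b x2^*]. *)
Lemma rd_mul_le N p n (a : 'I_n -> 'M[R]_N) (b : 'I_n -> 'M[C]_p) delta X Y :
  quantum_gap a p delta ->
  (forall P : 'M[C]_p, \sum_j hs (b j *m P) <= hs P) ->
  (forall P : 'M[C]_p, \sum_j hs (P *m b j) <= hs P) ->
  hs X = 1 -> hs Y = 1 ->
  rd (\sum_j cmx (a j) *m Y *m b j) X <= 1 - delta / 2.
Proof.
move=> ag bl br X1 Y1.
have [x1 [x2 [XE x11 x22 _]]] := balanced_factor X.
have [y1 [y2 [YE y11 y22 ys]]] := balanced_factor Y.
rewrite X1 in x11 x22; rewrite Y1 in y11 y22 ys; rewrite mulr1 in ys.
have h := ag x1 y1 x11 y11 ys.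
pose A j := adjm x1 *m cmx (a j) *m y1; pose B j := y2 *m b j *m adjm x2.
rewrite rd_sum.
have E1 j : rd (cmx (a j) *m Y *m b j) X = rd (A j) (adjm (B j)).
  rewrite /rd adjmK XE YE adjmM /A /B !mulmxA mxtrace_mulC.
  by rewrite !mulmxA.
have E2 j : hs (A j) =
    rd (cmx (a j) *m (y1 *m adjm y1) *m adjm (cmx (a j))) (x1 *m adjm x1).
  rewrite hs_rd /rd /A !adjmM !adjmK !mulmxA; congr complex.Re.
  by rewrite -!mulmxA mxtrace_mulC !mulmxA.
pose P := adjm x2 *m x2; pose Q := adjm y2 *m y2.
have E3 j : hs (B j) = rd (Q *m b j) (b j *m P).
  rewrite hs_rd /rd /B /P /Q !adjmM !adjmK !mulmxA; congr complex.Re.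
  by rewrite mxtrace_mulC !mulmxA.
have S1 : \sum_j hs (A j) <= 1 - delta by under eq_bigr do rewrite E2.
have S2 : \sum_j hs (B j) <= 1.
  have : \sum_j 2 * hs (B j) <= \sum_j (hs (Q *m b j) + hs (b j *m P)).
    by apply: ler_sum => j _; rewrite E3; exact: rd_le.
  rewrite -mulr_sumr big_split /=.
  have := bl P; have := br Q; rewrite x22 y22; lra.
have : \sum_j 2 * rd (cmx (a j) *m Y *m b j) X <= \sum_j (hs (A j) + hs (B j)).
  by apply: ler_sum => j _; rewrite E1 -(hs_adjm (B j)); exact: rd_le.
rewrite -mulr_sumr big_split /=; lra.
Qed.

Lemma hs_mul_le N p n (a : 'I_n -> 'M[R]_N) (b : 'I_n -> 'M[C]_p) delta Z :
  quantum_gap a p delta -> delta <= 2 ->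
  (forall P : 'M[C]_p, \sum_j hs (b j *m P) <= hs P) ->
  (forall P : 'M[C]_p, \sum_j hs (P *m b j) <= hs P) ->
  hs (\sum_j cmx (a j) *m Z *m b j) <= (1 - delta / 2) ^+ 2 * hs Z.
Proof.
move=> ag d2 bl br; set W := \sum_j _.
have [W0|Wn] := eqVneq (hs W) 0; first by rewrite W0 mulr_ge0 ?sqr_ge0 ?hs_ge0.
have Wp : 0 < hs W by rewrite lt0r Wn hs_ge0.
have [Z0|Zn] := eqVneq (hs Z) 0.
  suff W0 : W = 0.
    have := Wp; rewrite W0 (_ : hs _ = 0) ?ltxx//.
    by apply: big1 => i _; apply: big1 => j _; rewrite mxE nsq0.
  by rewrite /W (hs_eq0 Z0) big1// => j _; rewrite mulmx0 mul0mx.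
have Zp : 0 < hs Z by rewrite lt0r Zn hs_ge0.
pose w := Num.sqrt (hs W); pose z := Num.sqrt (hs Z).
have w0 : 0 < w by rewrite sqrtr_gt0.
have z0 : 0 < z by rewrite sqrtr_gt0.
have w2 : w ^+ 2 = hs W by rewrite sqr_sqrtr// ltW.
have z2 : z ^+ 2 = hs Z by rewrite sqr_sqrtr// ltW.
have X1 : hs (w^-1%:C%C *: W) = 1 by rewrite hsZ exprVn w2 mulVf.
have Y1 : hs (z^-1%:C%C *: Z) = 1 by rewrite hsZ exprVn z2 mulVf.
have := rd_mul_le ag bl br X1 Y1.
have -> : \sum_j cmx (a j) *m (z^-1%:C%C *: Z) *m b j = z^-1%:C%C *: W.
  rewrite /W scaler_sumr; apply: eq_bigr => j _.
  by rewrite -scalemxAr -scalemxAl.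
rewrite rdZl rdC rdZl -hs_rd -w2 -z2 => h.
have wz : w <= (1 - delta / 2) * z.
  rewrite -ler_pdivrMr//; apply: le_trans h.
  by rewrite expr2 mulKf ?gt_eqF// mulrC.
rewrite -exprMn ler_pXn2r ?nnegrE ?(ltW w0)//.
by rewrite mulr_ge0 ?(ltW z0)//; lra.
Qed.

End HilbertSchmidt.

(** * Four maps of the plane over the two-element field *)

Section Vectors.
Variable e : nat.
Local Notation d := e.+1.
Local Notation V := 'rV[bool]_d.
Implicit Types x y z : V.

(** A vector is seen as a polynomial over the field with two elements; this is
    its degree plus one, and zero for the zero vector. *)
Definition deg x : nat := \max_(i < d | x 0 i) i.+1.

(** Multiplication by the indeterminate, the top coefficient being dropped. *)
Definition tau x : V :=
  \row_(i < d) \sum_(j < d) ((i == j.+1 :> nat) && x 0 j).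

(** The reversal makes [tau] self-adjoint. *)
Definition bpair x y : bool := \sum_i x 0 i * y 0 (rev_ord i).

Lemma bool_addrr (b : bool) : b + b = 0. Proof. by case: b. Qed.

Lemma addrr2 x : x + x = 0.
Proof. by apply/matrixP => i j; rewrite !mxE bool_addrr. Qed.

Lemma bpairDl x y z : bpair (x + y) z = bpair x z + bpair y z.
Proof. by rewrite -big_split; apply: eq_bigr => i _; rewrite mxE mulrDl. Qed.

Lemma bpairC x y : bpair x y = bpair y x.
Proof.
rewrite /bpair (reindex_inj rev_ord_inj) /=; apply: eq_bigr => i _.
by rewrite rev_ordK mulrC.
Qed.

Lemma bpairDr x y z : bpair x (y + z) = bpair x y + bpair x z.
Proof. by rewrite bpairC bpairDl !(bpairC x). Qed.

Lemma bpair_delta i x : bpair (delta_mx 0 i) x = x 0 (rev_ord i).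
Proof.
rewrite /bpair (bigD1 i)//= big1 => [|j /negbTE ji]; last by rewrite mxE ji mul0r.
by rewrite mxE !eqxx mul1r addr0.
Qed.

Lemma nonzero_coef x : x != 0 -> exists i, x 0 i.
Proof.
move=> x0; apply/existsP; apply: contraNT x0 => /existsPn h.
by apply/eqP/matrixP => i j; rewrite ord1 mxE; apply/negbTE.
Qed.

Lemma bpair_nondeg x : x != 0 -> exists y, bpair y x.
Proof.
move=> /nonzero_coef [i xi].
by exists (delta_mx 0 (rev_ord i)); rewrite bpair_delta rev_ordK.
Qed.

Lemma tauD x y : tau (x + y) = tau x + tau y.
Proof.
apply/matrixP => k i; rewrite !mxE -big_split; apply: eq_bigr => j _ /=.
by rewrite !mxE; case: (_ == _).
Qed.

Lemma bpair_tau x y : bpair (tau x) y = bpair x (tau y).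
Proof.
have E (b : bool) (c : bool) : b && c = b * c by [].
rewrite /bpair; under eq_bigr do rewrite mxE mulr_suml.
under [RHS]eq_bigr do rewrite mxE mulr_sumr.
rewrite exchange_big; apply: eq_bigr => j _.
rewrite [RHS](reindex_inj rev_ord_inj); apply: eq_bigr => i _ /=.
have -> : (d - j.+1 == (d - i.+1).+1)%N = (i == j.+1 :> nat).
  by have := ltn_ord i; have := ltn_ord j; lia.
by rewrite !E mulrA [x 0 j * _]mulrC -!mulrA; congr (_ * _); rewrite mulrC.
Qed.

Lemma leq_deg x k : (deg x <= k)%N = [forall i : 'I_d, x 0 i ==> (i < k)%N].
Proof.
apply/bigmax_leqP/forallP => [h i|h i xi].
  by apply/implyP => xi; exact: h.
by have := h i; rewrite xi.
Qed.

Lemma deg_le x : (deg x <= d)%N.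
Proof. by rewrite leq_deg; apply/forallP => i; rewrite ltn_ord implybT. Qed.

Lemma deg_ge x i : x 0 i -> (i < deg x)%N.
Proof.
move=> xi; have := leqnn (deg x); rewrite leq_deg => /forallP /(_ i).
by rewrite xi.
Qed.

Lemma degD_le x y k : (deg x <= k)%N -> (deg y <= k)%N -> (deg (x + y) <= k)%N.
Proof.
rewrite !leq_deg => /forallP hx /forallP hy; apply/forallP => i; rewrite mxE.
by move: (hx i) (hy i); case: (x 0 i); case: (y 0 i) => //= ->.
Qed.

Lemma deg0 x : (deg x == 0)%N = (x == 0).
Proof.
rewrite -leqn0 leq_deg; apply/forallP/eqP => [h|-> i]; last by rewrite mxE.
apply/matrixP => i j; rewrite ord1 mxE; have := h j; rewrite ltn0.
by case: (x 0 j).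
Qed.

Lemma deg_attained x : (0 < deg x)%N -> exists2 i : 'I_d, x 0 i & deg x = i.+1.
Proof.
rewrite lt0n deg0 => /nonzero_coef [i0 xi0].
have c0 : (0 < #|[pred i : 'I_d | x ord0 i]|)%N by apply/card_gt0P; exists i0.
by have [i xi di] := eq_bigmax_cond (fun i : 'I_d => i.+1) c0; exists i.
Qed.

Lemma deg_top x : (deg x == d) = x 0 ord_max.
Proof.
apply/eqP/idP => [xd|xm]; last first.
  by apply/eqP; rewrite eqn_leq deg_le; exact: (deg_ge xm).
have [|i xi] := @deg_attained x; first by rewrite xd.
by rewrite xd => -[ei]; have -> : ord_max = i by apply: val_inj.
Qed.

Lemma deg_tau x : (0 < deg x < d)%N -> deg (tau x) = (deg x).+1.
Proof.
move=> /andP[x0 xd]; have [i xi dx] := deg_attained x0.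
apply/eqP; rewrite eqn_leq; apply/andP; split.
  rewrite leq_deg; apply/forallP => j; apply/implyP; rewrite mxE.
  have [/existsP [k /andP[/eqP jk xk]] _|nk] :=
      boolP [exists k : 'I_d, (j == k.+1 :> nat) && x 0 k].
    by rewrite jk ltnS; exact: deg_ge.
  rewrite big1 // => k _; apply/negbTE; apply: contra nk => h.
  by apply/existsP; exists k.
have i1 : (i.+1 < d)%N by rewrite -dx.
have := @deg_ge (tau x) (Ordinal i1).
rewrite dx; apply; rewrite mxE (bigD1 i)//= eqxx xi big1// => k ki.
apply/negbTE; rewrite negb_and eqSS; apply/orP; left.
by apply: contra ki => /eqP h; apply/eqP/val_inj.
Qed.

End Vectors.

Section Kernels.
Variables (R : realFieldType) (T : finType).
Implicit Types B C D : T -> T -> R.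

Definition sqsum B : R := \sum_s \sum_t B s t ^+ 2.
Definition kdist B C : R := sqsum (fun s t => B s t - C s t).

Lemma sqsum_ge0 B : 0 <= sqsum B.
Proof. by apply: sumr_ge0 => s _; apply: sumr_ge0 => t _; exact: sqr_ge0. Qed.

Lemma kdistC B C : kdist B C = kdist C B.
Proof.
by apply: eq_bigr => s _; apply: eq_bigr => t _; rewrite -opprB sqrrN.
Qed.

Lemma sqsum_le B C D : (forall s t, B s t = C s t + D s t) ->
  sqsum B <= 2 * sqsum C + 2 * sqsum D.
Proof.
move=> BE; rewrite !mulr_sumr -big_split; apply: ler_sum => s _ /=.
rewrite !mulr_sumr -big_split; apply: ler_sum => t _ /=.
have := sqr_ge0 (C s t - D s t); rewrite BE; nra.
Qed.

Lemma kdist_trans C B D : kdist B D <= 2 * kdist B C + 2 * kdist C D.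
Proof. by apply: sqsum_le => s t; rewrite addrA subrK. Qed.

Lemma sqsum_kdist B C : sqsum B <= 2 * kdist B C + 2 * sqsum C.
Proof. by apply: sqsum_le => s t; rewrite subrK. Qed.

Lemma kdist_reindex (f : T -> T) B C : injective f ->
  kdist (fun s t => B (f s) (f t)) (fun s t => C (f s) (f t)) = kdist B C.
Proof.
move=> fI; rewrite /kdist /sqsum [RHS](reindex_inj fI); apply: eq_bigr => s _.
by rewrite [RHS](reindex_inj fI).
Qed.

Lemma kdist_sign (b : T -> bool) B C :
  kdist (fun s t => (-1) ^+ b s * (-1) ^+ b t * B s t)
        (fun s t => (-1) ^+ b s * (-1) ^+ b t * C s t) = kdist B C.
Proof.
apply: eq_bigr => s _; apply: eq_bigr => t _.
by rewrite -mulrBr !exprMn !sqrr_sign !mul1r.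
Qed.

End Kernels.

Section Fourier.
Variables (R : realFieldType) (e : nat).
Local Notation V := 'rV[bool]_e.+1.
Local Notation W := (V * V)%type.
Implicit Types (s t h z : W).

(** The characters of the additive group. *)
Definition chi z s : R := (-1) ^+ (bpair z.1 s.1 + bpair z.2 s.2)%R.

Lemma signD (b c : bool) : (-1 : R) ^+ (b + c)%R = (-1) ^+ b * (-1) ^+ c.
Proof. exact: signr_addb. Qed.

Lemma chiC z s : chi z s = chi s z.
Proof. by rewrite /chi bpairC [bpair z.2 _]bpairC. Qed.

Lemma chiDr z s t : chi z (s + t) = chi z s * chi z t.
Proof. by rewrite /chi -signD !bpairDr addrACA. Qed.

Lemma chiDl z t s : chi (z + t) s = chi z s * chi t s.
Proof. by rewrite chiC chiDr !(chiC s). Qed.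

Lemma chi_sqr z s : chi z s * chi z s = 1.
Proof. by rewrite -expr2 sqrr_sign. Qed.

Lemma addWW s : s + s = 0.
Proof. by case: s => x y; congr pair; exact: addrr2. Qed.

Lemma sum_chi s : \sum_z chi z s = (s == 0)%:R * #|{: W}|%:R.
Proof.
have [->|sn] := eqVneq s 0.
  rewrite mul1r -sum1_card natr_sum; apply: eq_bigr => z _.
  by have := chi_sqr z 0; rewrite -chiDr addr0 => ->.
rewrite mul0r.
have [t tn] : exists t, chi t s = -1.
  have [s1|s1] := eqVneq s.1 0; last first.
    have [y ys] := bpair_nondeg s1; exists (y, 0).
    rewrite /chi /= ys (_ : bpair 0 _ = 0) ?addr0//.
    by rewrite /bpair big1// => i _; rewrite mxE mul0r.
  have s2 : s.2 != 0.
    by apply: contra sn => /eqP s2; move: s1 s2; case: (s) => /= x y -> ->.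
  have [y ys] := bpair_nondeg s2; exists (0, y).
  rewrite /chi /= ys (_ : bpair 0 _ = 0) ?add0r//.
  by rewrite /bpair big1// => i _; rewrite mxE mul0r.
have : \sum_z chi z s = - \sum_z chi z s.
  rewrite {1}(reindex_inj (addIr t)) -sumrN; apply: eq_bigr => z _ /=.
  by rewrite chiDl tn mulrN1.
by move=> h; lra.
Qed.

Lemma parseval (f : W -> R) :
  \sum_z (\sum_s f s * chi z s) ^+ 2 = #|{: W}|%:R * \sum_s f s ^+ 2.
Proof.
transitivity (\sum_z \sum_s \sum_t f s * f t * chi z (s + t)).
  apply: eq_bigr => z _; rewrite expr2 big_distrl; apply: eq_bigr => s _ /=.
  by rewrite big_distrr; apply: eq_bigr => t _ /=; rewrite chiDr mulrACA.
rewrite exchange_big mulr_sumr; apply: eq_bigr => s _ /=.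
rewrite exchange_big (bigD1 s)//= [X in _ + X]big1 => [|t ts].
  by rewrite -mulr_sumr sum_chi addWW eqxx mul1r addr0 mulrC expr2.
rewrite -mulr_sumr sum_chi (_ : s + t == 0 = false) ?mul0r ?mulr0//.
apply: contra_neqF ts => /eqP st.
by rewrite -[t]add0r -(addWW s) -addrA st addr0.
Qed.

(** The coefficients of the kernel [B] in the basis of the products of a
    translation by [h] and the multiplication by the character [z]. *)
Definition weyl (B : W -> W -> R) (p : W * W) : R :=
  \sum_s B s (s + p.1) * chi p.2 s.

Lemma weyl_parseval B : \sum_p weyl B p ^+ 2 = #|{: W}|%:R * sqsum B.
Proof.
rewrite -(pair_bigA _ (fun h z => weyl B (h, z) ^+ 2)) /=.
transitivity (\sum_h #|{: W}|%:R * \sum_s B s (s + h) ^+ 2).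
  by apply: eq_bigr => h _; exact: (parseval (fun s => B s (s + h))).
rewrite -mulr_sumr exchange_big; congr (_ * _); apply: eq_bigr => s _ /=.
by rewrite [RHS](reindex_inj (addrI s)).
Qed.

Lemma weylB B B' p : weyl (fun s t => B s t - B' s t) p = weyl B p - weyl B' p.
Proof. by rewrite /weyl -sumrB; apply: eq_bigr => s _; rewrite mulrBl. Qed.

Lemma weyl_lin B (L L' : W -> W) p : injective L -> {morph L : s t / s + t} ->
  (forall z s, chi (L' z) s = chi z (L s)) ->
  weyl (fun s t => B (L s) (L t)) (p.1, L' p.2) = weyl B (L p.1, p.2).
Proof.
move=> LI LD Lchi; rewrite [RHS](reindex_inj LI) /weyl; apply: eq_bigr => s _.
by rewrite /= LD Lchi.
Qed.

Lemma weyl_transl B c p :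
  weyl (fun s t => B (s + c) (t + c)) p = chi p.2 c * weyl B p.
Proof.
rewrite /weyl mulr_sumr (reindex_inj (addIr c)); apply: eq_bigr => s _ /=.
have E t : t + c + c = t by rewrite -addrA addWW addr0.
by rewrite -[s + c + p.1]addrAC !E chiDr; ring.
Qed.

Lemma weyl_sign B b p :
  weyl (fun s t => chi b s * chi b t * B s t) p = chi b p.1 * weyl B p.
Proof.
rewrite /weyl mulr_sumr; apply: eq_bigr => s _.
by rewrite chiDr [chi b s * (_ * _)]mulrA chi_sqr mul1r mulrA.
Qed.

Lemma weyl_0 B : weyl B 0 = \sum_s B s s.
Proof.
apply: eq_bigr => s _; rewrite addr0 /=.
by have := chi_sqr 0 s; rewrite -chiDl addr0 => ->; rewrite mulr1.
Qed.

End Fourier.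

Section PingPong.
Variables (R : realFieldType).

Lemma sqrD_le (a b : R) : a ^+ 2 <= 11 / 10 * b ^+ 2 + 11 * (b - a) ^+ 2.
Proof.
rewrite -subr_ge0 (_ : _ - _ = 10^-1 * (11 * b - 10 * a) ^+ 2); last by field.
by rewrite mulr_ge0 ?sqr_ge0// invr_ge0.
Qed.

Section Move.
Variables (T : finType) (G : T -> R) (f : T -> T) (A A' : pred T).
Hypothesis f_inj : injective f.

Lemma mass_move_le : (forall p, A p -> A' (f p)) ->
  \sum_(p | A p) G p ^+ 2 <= 11 / 10 * \sum_(p | A' p) G p ^+ 2 +
    11 * \sum_p (G (f p) - G p) ^+ 2.
Proof.
move=> AA'.
apply: (@le_trans _ _ (\sum_(p | A p) (11 / 10 * G (f p) ^+ 2 +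
    11 * (G (f p) - G p) ^+ 2))).
  by apply: ler_sum => p _; exact: sqrD_le.
rewrite big_split -!mulr_sumr /=; apply: lerD; rewrite ler_wpM2l ?divr_ge0//.
  rewrite [leRHS](reindex_inj f_inj) [leRHS](bigID A) /=.
  rewrite [X in _ <= X + _](eq_bigl A) => [|p]; last by apply: andb_idl; exact: AA'.
  by rewrite lerDl; apply: sumr_ge0 => p _; exact: sqr_ge0.
by rewrite [leRHS](bigID A) lerDl; apply: sumr_ge0 => p _; exact: sqr_ge0.
Qed.

Lemma mass_move_ge : (forall p, A (f p) -> A' p) ->
  \sum_(p | A p) G p ^+ 2 <= 11 / 10 * \sum_(p | A' p) G p ^+ 2 +
    11 * \sum_p (G (f p) - G p) ^+ 2.
Proof.
move=> AA'; rewrite (reindex_inj f_inj).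
apply: (@le_trans _ _ (\sum_(p | A (f p)) (11 / 10 * G p ^+ 2 +
    11 * (G (f p) - G p) ^+ 2))).
  apply: ler_sum => p _; apply: le_trans (sqrD_le _ (G p)) _.
  by rewrite -[G p - _]opprB sqrrN.
rewrite big_split -!mulr_sumr /=; apply: lerD; rewrite ler_wpM2l ?divr_ge0//.
  rewrite [leRHS](bigID (A \o f)) /=.
  rewrite [X in _ <= X + _](eq_bigl (A \o f)) => [|p]; last first.
    by apply: andb_idl; exact: AA'.
  by rewrite lerDl; apply: sumr_ge0 => p _; exact: sqr_ge0.
by rewrite [leRHS](bigID (A \o f)) lerDl; apply: sumr_ge0 => p _; exact: sqr_ge0.
Qed.

End Move.

Variable e : nat.
Local Notation d := e.+1.
Local Notation V := 'rV[bool]_d.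
Local Notation W := (V * V)%type.
Implicit Types (s t h z : W) (p : W * W).

Definition shear s : W := (s.1, s.2 + tau s.1).
Definition shearT z : W := (z.1 + tau z.2, z.2).
Definition twist s : W := (s.2, s.1 + s.2).
Definition twistT z : W := (z.2, z.1 + z.2).
Definition twistTi z : W := (z.1 + z.2, z.1).

Lemma addVK (x y : V) : x + y + y = x.
Proof. by rewrite -addrA addrr2 addr0. Qed.

Lemma shearK : involutive shear.
Proof. by case=> x y; rewrite /shear /= addVK. Qed.

Lemma shearTK : involutive shearT.
Proof. by case=> x y; rewrite /shearT /= addVK. Qed.

Lemma shearD : {morph shear : s t / s + t}.
Proof. by move=> [x y] [x' y']; rewrite /shear /= tauD addrACA. Qed.

Lemma twistD : {morph twist : s t / s + t}.
Proof. by move=> [x y] [x' y']; rewrite /twist /= addrACA. Qed.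

Lemma twist_inj : injective twist.
Proof. by move=> [x y] [x' y'] [-> /addIr ->]. Qed.

Lemma twistTiK : cancel twistTi twistT.
Proof. by case=> x y; rewrite /twistT /twistTi /= [x + y]addrC addVK. Qed.

Lemma chi_shear z s : chi R (shearT z) s = chi R z (shear s).
Proof.
by rewrite /chi /= bpairDl bpairDr bpair_tau -!addrA [_ (tau _) + _]addrC.
Qed.

Lemma chi_twist z s : chi R (twistT z) s = chi R z (twist s).
Proof.
rewrite /chi /= bpairDl bpairDr; congr ((-1) ^+ nat_of_bool _).
by rewrite addrCA.
Qed.

Definition degX p := maxn (deg p.1.1) (deg p.2.2).
Definition degY p := maxn (deg p.1.2) (deg p.2.1).
(** A label [p = (h, z)] of a Weyl coefficient is seen as the pair of [X = (h.1, z.2)] and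
    [Y = (h.2, z.1)]. Then [phiS] maps [(X, Y)] to [(X, Y + tau X)] and [phiQ] maps it
    to [(Y, X + Y)]. *)
Definition phiS p : W * W := (shear p.1, shearT p.2).
Definition phiQ p : W * W := (twist p.1, twistTi p.2).

Lemma phiS_inj : injective phiS.
Proof.
by apply: can_inj (_ : cancel phiS phiS) => -[h z]; rewrite /phiS /= shearK shearTK.
Qed.

Lemma phiQ_inj : injective phiQ.
Proof.
move=> [h z] [h' z'] E; have /twist_inj -> : twist h = twist h' := congr1 fst E.
by have /(can_inj twistTiK) -> : twistTi z = twistTi z' := congr1 snd E.
Qed.

Lemma degD_lt (x y : V) k : (deg x <= k < deg y)%N -> (k < deg (x + y))%N.
Proof.
move=> /andP[xk yk]; rewrite ltnNge; apply: contraTN yk => h; rewrite -leqNgt.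
by rewrite -[y](addVK _ x) [y + x]addrC; exact: degD_le.
Qed.

Lemma phiS_degX p : degX (phiS p) = degX p. Proof. by []. Qed.

Lemma phiS_degY p : (degY p <= degX p)%N -> (0 < degX p < d)%N ->
  (degX p < degY (phiS p))%N.
Proof.
rewrite /degY geq_max => /andP[y1 y2] xd; rewrite leq_max /=.
case: (leqP (deg p.2.2) (deg p.1.1)) => h.
  have E : degX p = deg p.1.1 by apply/maxn_idPl.
  apply/orP; left; apply: degD_lt; rewrite y1 /= deg_tau -E//.
have E : degX p = deg p.2.2 by apply/maxn_idPr/ltnW.
by apply/orP; right; apply: degD_lt; rewrite y2 /= deg_tau -E.
Qed.

Lemma phiQ_degX p : degX (phiQ p) = degY p. Proof. by []. Qed.

Lemma phiQ_degY_le p : (degX p <= degY p)%N -> (degY (phiQ p) <= degY p)%N.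
Proof.
rewrite /degX geq_max => /andP[x1 x2].
by rewrite {1}/degY geq_max /=; apply/andP; split; apply: degD_le => //;
  rewrite /degY leq_max leqnn ?orbT.
Qed.

Lemma phiQ_degY p : (degX p < degY p)%N -> degY (phiQ p) = degY p.
Proof.
move=> xy; apply/eqP; rewrite eqn_leq (phiQ_degY_le (ltnW xy)) /=.
case Ek : (degY p) xy => [//|k]; rewrite ltnS /degX geq_max => /andP[x1 x2].
rewrite leq_max /=.
case: (leqP (deg p.2.1) (deg p.1.2)) => h.
  have E : degY p = deg p.1.2 by apply/maxn_idPl.
  by apply/orP; left; apply: degD_lt; rewrite x1 /= -E Ek.
have E : degY p = deg p.2.1 by apply/maxn_idPr/ltnW.
by apply/orP; right; rewrite addrC; apply: degD_lt; rewrite x2 /= -E Ek.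
Qed.

Definition top_sign : W := (delta_mx 0 0, 0).
Definition top_transl : W := (0, delta_mx 0 0).

Lemma bpair0 (x : V) : bpair 0 x = 0.
Proof. by rewrite /bpair big1// => i _; rewrite mxE mul0r. Qed.

Lemma bpair_top (x : V) : bpair (delta_mx 0 0) x = (deg x == d).
Proof. by rewrite bpair_delta deg_top; congr (x _ _); apply: val_inj; rewrite /= subn1. Qed.

Lemma chi_top_sign s : chi R top_sign s = (-1) ^+ (deg s.1 == d).
Proof. by rewrite /chi /= bpair0 addr0 bpair_top. Qed.

Lemma chi_top_transl z : chi R z top_transl = (-1) ^+ (deg z.2 == d).
Proof. by rewrite chiC /chi /= bpair0 add0r bpair_top. Qed.

Lemma mass_sign (G : W * W -> R) (A : pred (W * W)) (sg : W * W -> R) :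
  (forall p, A p -> sg p = -1) ->
  4 * \sum_(p | A p) G p ^+ 2 <= \sum_p (sg p * G p - G p) ^+ 2.
Proof.
move=> As; rewrite mulr_sumr [leRHS](bigID A) /=.
rewrite [X in _ <= X + _](eq_bigr (fun p => 4 * G p ^+ 2)) => [|p Ap].
  by rewrite lerDl; apply: sumr_ge0 => p _; exact: sqr_ge0.
by rewrite As//; ring.
Qed.

(** Let [mu] be the mass of the Weyl coefficients of [B]. If [B] almost commutes
    with the translation and with the sign, then [mu] is small where one of the
    top degrees is reached; elsewhere [phiS] maps the set where
    [degY <= degX] into the set where [degX < degY], while [phiQ] maps the latter
    set, and the inverse of [phiQ] maps it as well, into two disjoint parts of the
    former. An almost invariant mass must then sit at the origin, where the
    coefficient is the trace of [B]. *)
Lemma four_generator_gap (B : W -> W -> R) (E : R) :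
  kdist (fun s t => B (shear s) (shear t)) B <= E ->
  kdist (fun s t => B (twist s) (twist t)) B <= E ->
  kdist (fun s t => B (s + top_transl) (t + top_transl)) B <= E ->
  kdist (fun s t => chi R top_sign s * chi R top_sign t * B s t) B <= E ->
  sqsum B <= 110 * E + (\sum_s B s s) ^+ 2 / #|{: W}|%:R.
Proof.
set w := #|{: W}|%:R => BS BQ Bc Bb; pose G := weyl B.
have w0 : 0 < w by rewrite ltr0n; apply/card_gt0P; exists 0.
have wE B' : kdist B' B <= E -> \sum_p (weyl B' p - G p) ^+ 2 <= w * E.
  move=> h; under eq_bigr do rewrite -weylB.
  by rewrite weyl_parseval ler_pM2l.
have GS : \sum_p (G (phiS p) - G p) ^+ 2 <= w * E.
  apply: le_trans (wE _ BS); apply: ler_sum => p _.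
  have := weyl_lin B (p.1, shearT p.2) (can_inj shearK) shearD chi_shear.
  by rewrite /= shearTK -surjective_pairing => ->.
have GQ : \sum_p (G (phiQ p) - G p) ^+ 2 <= w * E.
  apply: le_trans (wE _ BQ); apply: ler_sum => p _.
  have := weyl_lin B (p.1, twistTi p.2) twist_inj twistD chi_twist.
  by rewrite /= twistTiK -surjective_pairing => ->.
have Gc : 4 * \sum_(p | deg p.2.2 == d) G p ^+ 2 <= w * E.
  apply: le_trans (wE _ Bc); under [leRHS]eq_bigr do rewrite weyl_transl.
  by apply: mass_sign => p pd; rewrite chi_top_transl pd.
have Gb : 4 * \sum_(p | deg p.1.1 == d) G p ^+ 2 <= w * E.
  apply: le_trans (wE _ Bb); under [leRHS]eq_bigr do rewrite weyl_sign.
  by apply: mass_sign => p pd; rewrite chi_top_sign pd.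
pose mN := \sum_(p | (degX p < degY p)%N) G p ^+ 2.
pose mZ := \sum_(p | (degX p == degY p) && (0 < degX p)%N) G p ^+ 2.
pose mP := \sum_(p | (degY p < degX p)%N) G p ^+ 2.
have NZ : mN <= 11 / 10 * mZ + 11 * (w * E).
  apply: le_trans (mass_move_le (A' := fun p => (degX p == degY p) && (0 < degX p)%N)
    G phiQ_inj _) _ => [p xy|].
    by rewrite phiQ_degX (phiQ_degY xy) eqxx (leq_ltn_trans _ xy).
  by rewrite lerD2l ler_pM2l.
have NP : mN <= 11 / 10 * mP + 11 * (w * E).
  apply: le_trans (mass_move_ge (A' := fun p => (degY p < degX p)%N)
    G phiQ_inj _) _ => [p|].
    rewrite phiQ_degX !ltnNge; apply: contra => xy; exact: phiQ_degY_le.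
  by rewrite lerD2l ler_pM2l.
pose top p := (deg p.1.1 == d) || (deg p.2.2 == d).
have topE : \sum_(p | top p) G p ^+ 2 <= w * E / 2.
  apply: (@le_trans _ _ (\sum_(p | deg p.1.1 == d) G p ^+ 2 +
      \sum_(p | deg p.2.2 == d) G p ^+ 2)); last by lra.
  rewrite [leLHS]big_mkcond [X in _ <= X + _]big_mkcond.
  rewrite [X in _ <= _ + X]big_mkcond -big_split; apply: ler_sum => p _ /=.
  by rewrite /top; do 2 case: (_ == _) => /=; rewrite ?addr0 ?add0r ?lerDl ?sqr_ge0.
have SN : \sum_(p | [&& (degY p <= degX p)%N, (0 < degX p)%N & ~~ top p]) G p ^+ 2 <=
    11 / 10 * mN + 11 * (w * E).
  apply: le_trans (mass_move_le (A' := fun p => (degX p < degY p)%N)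
    G phiS_inj _) _ => [p /and3P[yx x0]|].
    rewrite negb_or => /andP[t1 t2]; rewrite phiS_degX phiS_degY// x0 /=.
    by rewrite /degX gtn_max !ltn_neqAle t1 t2 !deg_le.
  by rewrite lerD2l ler_pM2l.
have ZP : mZ + mP <= 11 / 10 * mN + 11 * (w * E) + w * E / 2.
  apply: le_trans (lerD SN topE).
  rewrite /mZ /mP [X in X + _ <= _]big_mkcond [X in _ + X <= _]big_mkcond.
  rewrite [X in _ <= X + _]big_mkcond [X in _ <= _ + X]big_mkcond -!big_split.
  apply: ler_sum => p _ /=; have g0 := sqr_ge0 (G p).
  case: (ltngtP (degX p) (degY p)) => [xy|yx|->] /=.
  - by case: (top p); rewrite /= ?addr0 ?add0r.
  - rewrite (leq_ltn_trans (leq0n _) yx) /=.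
    by case: (top p); rewrite /= ?addr0 ?add0r.
  - by case: (top p); case: (_ < _)%N => //=; rewrite ?addr0 ?add0r.
have tot : w * sqsum B = G 0 ^+ 2 + (mN + mZ + mP).
  rewrite -weyl_parseval (bigD1 (0 : W * W))//=; congr (_ + _).
  rewrite /mN /mZ /mP [X in X + _ + _]big_mkcond [X in _ + X + _]big_mkcond.
  rewrite [X in _ = _ + X]big_mkcond -!big_split big_mkcond.
  apply: eq_bigr => p _ /=.
  have p0 : (p == 0) = (degX p == 0)%N && (degY p == 0)%N.
    rewrite -!leqn0 !geq_max !leqn0 !deg0.
    case: p => [[x1 y1] [x2 y2]]; rewrite !xpair_eqE /=.
    by case: (x1 == 0); case: (y1 == 0); case: (x2 == 0); case: (y2 == 0).
  rewrite p0; case: (ltngtP (degX p) (degY p)) => h /=.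
  - by rewrite [degY p == 0]eqn0Ngt (leq_ltn_trans (leq0n _) h) andbF !addr0.
  - by rewrite [degX p == 0]eqn0Ngt (leq_ltn_trans (leq0n _) h) !add0r.
  - by rewrite h andbb lt0n; case: (_ == _); rewrite /= ?addr0 ?add0r.
have -> : (\sum_s B s s) = G 0 by rewrite /G weyl_0.
rewrite -(ler_pM2l w0) tot mulrDr [w * (_ / w)]mulrCA divff ?gt_eqF// mulr1.
have wE0 : 0 <= w * E.
  by apply: le_trans GS; apply: sumr_ge0 => p _; exact: sqr_ge0.
rewrite [w * (110 * E)]mulrCA; lra.
Qed.

End PingPong.

(** * From four generators to two *)

Section Slots.
Variables (R : realFieldType) (e : nat).
Local Notation d := e.+1.
Local Notation V := 'rV[bool]_d.
Local Notation W := (V * V)%type.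
Local Notation slots := ('I_9 * W)%type.

(** The unitary [u] acts as the identity in slot 0, as its opposite in the slots 1 to
    4, and as the four generators in the slots 5 to 8; the unitary [v] permutes
    the slots cyclically. *)
Definition slot_map (k : nat) : W -> W :=
  match k with
  | 5 => @shear e
  | 6 => @twist e
  | 7 => fun s => s + top_transl e
  | _ => id
  end.

Definition slot_perm (p : slots) : slots := (p.1, slot_map p.1 p.2).

Definition slot_sign (p : slots) : bool :=
  (0 < p.1 < 5)%N || (p.1 == 8 :> nat) && (deg p.2.1 == d).

Definition slot_shift (p : slots) : slots := (p.1 + 1, p.2).

Lemma slot_map_inj k : injective (slot_map k).
Proof.
case: k => [|[|[|[|[|[|[|[|k]]]]]]]] //=.
- exact: can_inj (@shearK e).
- exact: twist_inj.
- exact: addIr.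
Qed.

Lemma slot_perm_inj : injective slot_perm.
Proof.
move=> [i s] [j t] E; have ij : i = j := congr1 fst E.
have := congr1 snd E; rewrite /= -ij => /slot_map_inj ->.
by [].
Qed.

Lemma slot_shift_inj : injective slot_shift.
Proof.
move=> [i s] [j t] E; have /addIr -> : i + 1 = j + 1 := congr1 fst E.
by have /= -> := congr1 snd E.
Qed.

Definition kblk (A : slots -> slots -> R) (i j : 'I_9) (s t : W) : R :=
  A (i, s) (j, t).

Lemma sqsum_kblk (A : slots -> slots -> R) :
  sqsum A = \sum_i \sum_j sqsum (kblk A i j).
Proof.
transitivity (\sum_(p : slots) \sum_(q : slots) A (p.1, p.2) (q.1, q.2) ^+ 2).
  by apply: eq_bigr => -[i s] _; apply: eq_bigr => -[j t] _.
rewrite -(pair_bigA _ (fun i s => \sum_(q : slots) A (i, s) (q.1, q.2) ^+ 2)) /=.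
apply: eq_bigr => i _; rewrite [RHS]exchange_big; apply: eq_bigr => s _ /=.
by rewrite -(pair_bigA _ (fun j t => A (i, s) (j, t) ^+ 2)).
Qed.

Lemma kblk_le (A : slots -> slots -> R) i j : sqsum (kblk A i j) <= sqsum A.
Proof.
rewrite sqsum_kblk (bigD1 i)//= (bigD1 j)//= -addrA lerDl addr_ge0//.
  by apply: sumr_ge0 => k _; exact: sqsum_ge0.
by apply: sumr_ge0 => k _; apply: sumr_ge0 => l _; exact: sqsum_ge0.
Qed.

Section Gap.
Variables (A : slots -> slots -> R) (E : R).
Hypothesis Au : kdist (fun p q => (-1) ^+ slot_sign p * (-1) ^+ slot_sign q * A p q)
  (fun p q => A (slot_perm p) (slot_perm q)) <= E.
Hypothesis Av : kdist (fun p q => A (slot_shift p) (slot_shift q)) A <= E.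

Let E0 : 0 <= E.
Proof. exact: le_trans (sqsum_ge0 _) Av. Qed.

Lemma kblk_shift i j : kdist (kblk A (i + 1) (j + 1)) (kblk A i j) <= E.
Proof. by apply: le_trans Av; exact: (kblk_le (fun p q => _ - A p q)). Qed.

Lemma kblk_shiftn i j k :
  kdist (kblk A (i + k%:R) (j + k%:R)) (kblk A i j) <= (2 ^+ k.+1 - 2) * E.
Proof.
elim: k => [|k IH].
  rewrite !addr0 expr1 subrr mul0r /kdist /sqsum big1// => s _.
  by rewrite big1// => t _; rewrite subrr expr0n.
apply: le_trans (kdist_trans (kblk A (i + k%:R) (j + k%:R)) _ _) _.
have := kblk_shift (i + k%:R) (j + k%:R).
rewrite -[k.+1%:R]natr1 !addrA [2 ^+ k.+2]exprS; nra.
Qed.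

Lemma kblk_diag i j : kdist (kblk A i j) (kblk A 0 (j - i)) <= 512 * E.
Proof.
have := kblk_shiftn 0 (j - i) i; rewrite add0r natr_Zp subrK => /le_trans -> //.
rewrite ler_wpM2r// lerBlDr.
apply: (@le_trans _ _ (2 ^+ 9)); last by rewrite -natrX -natrD ler_nat.
by rewrite ler_weXn2l// ler1n.
Qed.

Lemma kblk_u i j : kdist
  (fun s t => (-1) ^+ slot_sign (i, s) * (-1) ^+ slot_sign (j, t) * kblk A i j s t)
  (fun s t => kblk A i j (slot_map i s) (slot_map j t)) <= E.
Proof. by apply: le_trans Au; exact: (kblk_le (fun p q => _ - A _ _)). Qed.

(** [u] has opposite signs on the two slots, so the block is almost its own
    opposite. *)
Lemma kblk_opp (i j : 'I_9) : (i == 0) && (0 < j < 5)%N || (j == 0) && (0 < i < 5)%N ->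
  4 * sqsum (kblk A i j) <= E.
Proof.
move=> ij; apply: le_trans (kblk_u i j).
rewrite mulr_sumr; apply: ler_sum => s _; rewrite mulr_sumr; apply: ler_sum => t _.
have id_map (k : 'I_9) x : (k < 5)%N -> slot_map k x = x.
  by case: k => -[|[|[|[|[|k]]]]].
have [si sj sg] : [/\ (i < 5)%N, (j < 5)%N &
    (-1) ^+ slot_sign (i, s) * (-1) ^+ slot_sign (j, t) = -1 :> R].
  rewrite /slot_sign /=; case/orP: ij => /andP[/eqP -> /andP[k0 k5]].
    by rewrite k0 k5 /= mul1r.
  by rewrite k0 k5 /= mulr1.
rewrite !id_map// sg mulN1r le_eqVlt; apply/orP; left; apply/eqP; ring.
Qed.

Lemma kblk_off (k : 'I_9) : k != 0 -> sqsum (kblk A 0 k) <= 1025 * E.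
Proof.
move=> kn; have k0 : (0 < k)%N by rewrite lt0n.
have [k5|k5] := ltnP k 5.
  by have := @kblk_opp 0 k; rewrite eqxx k0 k5 => /(_ isT); have := E0; lra.
have h : 4 * sqsum (kblk A (- k) 0) <= E.
  apply: kblk_opp; rewrite eqxx /= orbC.
  rewrite (_ : (0 < (- k : 'I_9) < 5)%N) ?orTb//.
  by case: k kn k0 k5 => -[|[|[|[|[|[|[|[|[|k]]]]]]]]].
have := sqsum_kdist (kblk A 0 k) (kblk A (- k) 0).
have := kblk_diag (- k) 0; rewrite sub0r opprK kdistC; have := E0; lra.
Qed.

(** The diagonal blocks are almost equal to each other, so each of them almost
    commutes with the generators carried by all the slots. *)
Lemma kblk_transfer (op : (W -> W -> R) -> W -> W -> R) i :
  (forall B C, kdist (op B) (op C) = kdist B C) ->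
  kdist (op (kblk A i i)) (kblk A i i) <= E ->
  kdist (op (kblk A 0 0)) (kblk A 0 0) <= 3076 * E.
Proof.
move=> opd opi; have := kblk_diag i i; rewrite subrr => di.
have h1 := kdist_trans (op (kblk A i i)) (op (kblk A 0 0)) (kblk A 0 0).
have h2 := kdist_trans (kblk A i i) (op (kblk A i i)) (kblk A 0 0).
have := opd (kblk A 0 0) (kblk A i i).
rewrite [kdist (kblk A 0 0) _]kdistC => h3; have := E0; lra.
Qed.

Lemma kblk_00 :
  sqsum (kblk A 0 0) <= 110 * (3076 * E) + (\sum_s A (0, s) (0, s)) ^+ 2 / #|{: W}|%:R.
Proof.
have gen (k : 'I_9) (f : W -> W) : slot_map k =1 f -> injective f ->
    (forall s, slot_sign (k, s) = false) ->
    kdist (fun s t => kblk A 0 0 (f s) (f t)) (kblk A 0 0) <= 3076 * E.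
  move=> kf fI ks.
  apply: (@kblk_transfer (fun B s t => B (f s) (f t)) k) => [B C|].
    exact: kdist_reindex.
  rewrite kdistC; apply: le_trans (kblk_u k k).
  rewrite le_eqVlt; apply/orP; left; apply/eqP.
  by apply: eq_bigr => s _; apply: eq_bigr => t _; rewrite !ks !kf expr0 !mul1r.
apply: four_generator_gap.
- by apply: (gen (inord 5)) => [s||s]; rewrite /slot_sign /= ?inordK//;
    exact: can_inj (@shearK e).
- by apply: (gen (inord 6)) => [s||s]; rewrite /slot_sign /= ?inordK//;
    exact: twist_inj.
- by apply: (gen (inord 7)) => [s||s]; rewrite /slot_sign /= ?inordK//;
    exact: addIr.
- pose b (s : W) := deg s.1 == d.
  have -> : kdist (fun s t => chi R (top_sign e) s * chi R (top_sign e) t *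
      kblk A 0 0 s t) (kblk A 0 0) =
      kdist (fun s t => (-1) ^+ b s * (-1) ^+ b t * kblk A 0 0 s t) (kblk A 0 0).
    by apply: eq_bigr => s _; apply: eq_bigr => t _; rewrite !chi_top_sign.
  apply: (@kblk_transfer (fun B s t => (-1) ^+ b s * (-1) ^+ b t * B s t) (inord 8)).
    by move=> B C; exact: kdist_sign.
  apply: le_trans (kblk_u (inord 8) (inord 8)).
  rewrite le_eqVlt; apply/orP; left; apply/eqP.
  apply: eq_bigr => s _; apply: eq_bigr => t _.
  by rewrite /slot_sign /= inordK.
Qed.

(** The blocks off the diagonal are small, by the sign rule; those on the diagonal
    are close to the first one, which is close to a scalar matrix. *)
Lemma slots_gap :
  sqsum A <= 1000 * (7000 * E) +
    18 * ((\sum_s A (0, s) (0, s)) ^+ 2 / #|{: W}|%:R).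
Proof.
have B00 := kblk_00; set B := sqsum (kblk A 0 0) in B00.
have h i j : sqsum (kblk A i j) <= 3074 * E + (i == j)%:R * (2 * B).
  have := sqsum_kdist (kblk A i j) (kblk A 0 (j - i)); have := kblk_diag i j.
  have [->|ij] := eqVneq i j; first by rewrite subrr mul1r -/B; have := E0; lra.
  have := @kblk_off (j - i); rewrite subr_eq0 eq_sym ij mul0r => /(_ isT); have := E0; lra.
have : sqsum A <= \sum_(i < 9) \sum_(j < 9) (3074 * E + (i == j)%:R * (2 * B)).
  by rewrite sqsum_kblk; apply: ler_sum => i _; apply: ler_sum => j _.
have -> : \sum_(i < 9) \sum_(j < 9) (3074 * E + (i == j)%:R * (2 * B)) =
    81 * (3074 * E) + 18 * B.
  have inner (i : 'I_9) : \sum_(j < 9) (3074 * E + (i == j)%:R * (2 * B)) =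
      9 * (3074 * E) + 2 * B.
    rewrite big_split /= sumr_const card_ord -(mulr_natl (3074 * E) 9) -mulr_suml.
    rewrite (bigD1 i)//= eqxx big1 ?addr0 ?mul1r// => j /negbTE.
    by rewrite eq_sym => ->.
  rewrite (eq_bigr _ (fun i _ => inner i)) sumr_const card_ord.
  rewrite -(mulr_natl (9 * (3074 * E) + 2 * B) 9).
  by ring.
have := E0; lra.
Qed.

End Gap.
End Slots.

(** * Tuples of expanding matrices *)

Section SignedPerm.
Variables (R : realType) (T : finType) (f : T -> T) (b : T -> bool).
Hypothesis f_inj : injective f.
Local Notation N := #|T|.

Definition signed_perm_mx : 'M[R]_N :=
  \matrix_(i, j) ((enum_val i == f (enum_val j))%:R * (-1) ^+ b (enum_val j)).

Lemma signed_perm_mxE (p : T) (k : 'I_N) :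
  signed_perm_mx (enum_rank (f p)) k = (k == enum_rank p)%:R * (-1) ^+ b p.
Proof.
rewrite mxE enum_rankK (inj_eq f_inj).
have [->|kp] := eqVneq k (enum_rank p); first by rewrite enum_rankK eqxx.
rewrite (_ : p == enum_val k = false) ?mul0r//.
by apply: contra_neqF kp => /eqP ->; rewrite enum_valK.
Qed.

Lemma signed_perm_mx_conj (A : 'M[R[i]]_N) (p q : T) :
  (cmx signed_perm_mx *m A *m adjm (cmx signed_perm_mx))
    (enum_rank (f p)) (enum_rank (f q)) =
  ((-1) ^+ b p * (-1) ^+ b q)%:C%C * A (enum_rank p) (enum_rank q).
Proof.
rewrite adjm_cmx mxE (bigD1 (enum_rank q))//= [X in _ + X]big1 => [|k kq].
  rewrite addr0 mxE (bigD1 (enum_rank p))//= [X in _ + X]big1 => [|k kp].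
    rewrite addr0 !mxE !enum_rankK !eqxx !mul1r rmorphM.
    by rewrite mulrAC.
  by rewrite mxE signed_perm_mxE (negbTE kp) !mul0r.
by rewrite [X in _ * X]mxE [X in _ * _ X]mxE signed_perm_mxE (negbTE kq) mul0r mulr0.
Qed.

Lemma signed_perm_mx_orth :
  signed_perm_mx^T *m signed_perm_mx = 1%:M /\
  signed_perm_mx *m signed_perm_mx^T = 1%:M.
Proof.
suff h : signed_perm_mx^T *m signed_perm_mx = 1%:M by split=> //; exact: mulmx1C.
apply/matrixP => i j; rewrite !mxE.
pose k0 := enum_rank (f (enum_val i)).
rewrite (bigD1 k0)//= big1 => [|k kk0].
  rewrite mxE !signed_perm_mxE enum_valK eqxx mul1r addr0 eq_sym.
  case: eqVneq => [->|_]; last by rewrite mul0r mulr0.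
  by rewrite mul1r -expr2 sqrr_sign.
rewrite !mxE (_ : enum_val k == _ = false) ?mul0r//.
by apply: contra_neqF kk0 => /eqP h; rewrite /k0 -h enum_valK.
Qed.

Lemma hs_enum (A : 'M[R[i]]_N) :
  hs A = \sum_p \sum_q nsq (A (enum_rank p) (enum_rank q)).
Proof.
rewrite /hs (reindex _ (onW_bij _ (@enum_rank_bij T))); apply: eq_bigr => p _.
by rewrite (reindex _ (onW_bij _ (@enum_rank_bij T))).
Qed.

Definition ReK (A : 'M[R[i]]_N) (p q : T) : R :=
  complex.Re (A (enum_rank p) (enum_rank q)).
Definition ImK (A : 'M[R[i]]_N) (p q : T) : R :=
  complex.Im (A (enum_rank p) (enum_rank q)).

Lemma hs_ReIm A : hs A = sqsum (ReK A) + sqsum (ImK A).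
Proof.
rewrite hs_enum -big_split; apply: eq_bigr => p _; rewrite -big_split.
by apply: eq_bigr => q _.
Qed.

Lemma hs_signed_perm A :
  hs (cmx signed_perm_mx *m A *m adjm (cmx signed_perm_mx) - A) =
  kdist (fun p q => (-1) ^+ b p * (-1) ^+ b q * ReK A p q)
        (fun p q => ReK A (f p) (f q)) +
  kdist (fun p q => (-1) ^+ b p * (-1) ^+ b q * ImK A p q)
        (fun p q => ImK A (f p) (f q)).
Proof.
rewrite hs_enum (reindex_inj f_inj) -big_split; apply: eq_bigr => p _ /=.
rewrite (reindex_inj f_inj) -big_split; apply: eq_bigr => q _ /=.
rewrite mxE signed_perm_mx_conj mxE /nsq /ReK /ImK !raddfD /= !raddfN /=.
case: (A (enum_rank p) (enum_rank q)) => x y /=.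
by rewrite !mul0r subr0 addr0.
Qed.

End SignedPerm.

Section ExpanderTuple.
Variables (R : realType) (n' e : nat).
Local Notation n := n'.+3.
Local Notation W := ('rV[bool]_e.+1 * 'rV[bool]_e.+1)%type.
Local Notation slots := ('I_9 * W)%type.

Definition umx : 'M[R]_#|{: slots}| :=
  signed_perm_mx R (@slot_perm e) (@slot_sign e).
Definition vmx : 'M[R]_#|{: slots}| :=
  signed_perm_mx R (@slot_shift e) (fun=> false).

(** As [u] and [v] are real, the real and the imaginary part of [A] are treated
    separately. The diagonal entries of [A] being nonnegative, their sum over a
    slot is at most the trace of [A]. *)
Lemma uv_gap p (y : 'M[R[i]]_(#|{: slots}|, p)) (A := y *m adjm y) E :
  hs (cmx umx *m A *m adjm (cmx umx) - A) <= E ->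
  hs (cmx vmx *m A *m adjm (cmx vmx) - A) <= E ->
  hs A <= 2 * (1000 * (7000 * E)) + 18 * (hs y ^+ 2 / #|{: W}|%:R).
Proof.
rewrite !hs_signed_perm; [|exact: slot_shift_inj|exact: slot_perm_inj].
set u1 := kdist _ _; set u2 := kdist _ _; set v1 := kdist _ _; set v2 := kdist _ _.
move=> uE vE.
have u10 : 0 <= u1 by exact: sqsum_ge0.
have u20 : 0 <= u2 by exact: sqsum_ge0.
have v10 : 0 <= v1 by exact: sqsum_ge0.
have v20 : 0 <= v2 by exact: sqsum_ge0.
have shift (B : slots -> slots -> R) : kdist (fun p q => (-1) ^+ (fun=> false) p *
    (-1) ^+ (fun=> false) q * B p q) (fun p q => B (slot_shift p) (slot_shift q)) =
    kdist (fun p q => B (slot_shift p) (slot_shift q)) B.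
  rewrite kdistC; apply: eq_bigr => p' _; apply: eq_bigr => q' _.
  by rewrite expr0 !mul1r.
have gR : sqsum (ReK A) <= 1000 * (7000 * E) +
    18 * ((\sum_s ReK A (0, s) (0, s)) ^+ 2 / #|{: W}|%:R).
  apply: slots_gap; first by apply: le_trans uE; rewrite lerDl.
  by rewrite -shift; apply: le_trans vE; rewrite lerDl.
have gI : sqsum (ImK A) <= 1000 * (7000 * E) +
    18 * ((\sum_s ImK A (0, s) (0, s)) ^+ 2 / #|{: W}|%:R).
  apply: slots_gap; first by apply: le_trans uE; rewrite lerDr.
  by rewrite -shift; apply: le_trans vE; rewrite lerDr.
have Aii k : A k k = (\sum_j nsq (y k j))%:C%C.
  rewrite mxE rmorph_sum; apply: eq_bigr => j _.
  by rewrite !mxE /= -sqr_normc normr_nsq.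
have I0 : \sum_s ImK A (0, s) (0, s) = 0.
  by apply: big1 => s _; rewrite /ImK Aii.
have R0 : 0 <= \sum_s ReK A (0, s) (0, s).
  apply: sumr_ge0 => s _; rewrite /ReK Aii /=.
  by apply: sumr_ge0 => j _; exact: nsq_ge0.
have R1 : \sum_s ReK A (0, s) (0, s) <= hs y.
  have -> : hs y = \sum_(k : slots) \sum_j nsq (y (enum_rank (k.1, k.2)) j).
    rewrite /hs (reindex _ (onW_bij _ (@enum_rank_bij slots))).
    by apply: eq_bigr => -[i s].
  rewrite -(pair_bigA _ (fun i s => \sum_j nsq (y (enum_rank (i, s)) j))) /=.
  rewrite [leRHS](bigD1 0)//= -[leLHS]addr0; apply: lerD.
    by apply: ler_sum => s _; rewrite /ReK Aii.
  apply: sumr_ge0 => i _; apply: sumr_ge0 => s _.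
  by apply: sumr_ge0 => j _; exact: nsq_ge0.
have RR : (\sum_s ReK A (0, s) (0, s)) ^+ 2 / #|{: W}|%:R <= hs y ^+ 2 / #|{: W}|%:R.
  by rewrite ler_wpM2r ?invr_ge0// ler_pXn2r ?nnegrE ?hs_ge0.
rewrite I0 expr0n mul0r mulr0 addr0 in gI.
rewrite hs_ReIm; move: gR gI RR; move: (sqsum _) (sqsum _) (_ / _) (_ / _).
by move=> r1 r2 r3 r4; lra.
Qed.

(** The scale for which three orthogonal matrices make a bistochastic tuple. *)
Definition expander_scale : R := Num.sqrt 3^-1.

Definition expander_tuple : mtuple R n :=
  @MTuple R n #|{: slots}| (fun j => expander_scale *:
    match val j with
    | 0 => 1%:M
    | 1 => umx
    | 2 => vmx
    | _ => 0
    end).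

Lemma expander_scale_sqr : expander_scale ^+ 2 = 3^-1.
Proof. by rewrite sqr_sqrtr// invr_ge0. Qed.

Lemma trmx_scale N p (c : R) (M : 'M[R]_(N, p)) : (c *: M)^T = c *: M^T.
Proof. by apply/matrixP => i j; rewrite !mxE. Qed.

Lemma sum_first3 (M : nmodType) (F : 'I_n -> M) (F' : nat -> M) :
  (forall j, F j = F' j) -> (forall k, F' k.+3 = 0) ->
  \sum_j F j = F' 0%N + F' 1%N + F' 2%N.
Proof.
move=> FE F0; under eq_bigr do rewrite FE.
by rewrite 3!big_ord_recl /= big1 ?addr0 ?addrA// => j _; exact: F0.
Qed.

Lemma expander_bistochastic : bistochastic expander_tuple.
Proof.
have [u1 u2] := signed_perm_mx_orth R (@slot_sign e) (@slot_perm_inj e).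
have [v1 v2] := signed_perm_mx_orth R (fun=> false) (@slot_shift_inj e).
have s3 (M : 'M[R]_#|{: slots}|) : M = 1%:M ->
    3^-1 *: 1%:M + 3^-1 *: M + 3^-1 *: M = 1%:M :> 'M[R]_#|{: slots}|.
  by move=> ->; rewrite -!scalerDl (_ : _ + _ + _ = 1) ?scale1r//; field.
split.
  rewrite (@sum_first3 _ _ (fun k => 3^-1 *: match k with
    | 0 => 1%:M | 1 => umx^T *m umx | 2 => vmx^T *m vmx | _ => 0 end)).
  - by rewrite [umx^T *m umx]u1 [vmx^T *m vmx]v1 s3.
  - move=> j /=; rewrite trmx_scale -scalemxAl -scalemxAr scalerA -expr2.
    rewrite expander_scale_sqr; congr (_ *: _).
    by case: (val j) => [|[|[|k]]]; rewrite ?trmx1 ?mul1mx ?mulmx0.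
  - by move=> k; rewrite scaler0.
rewrite (@sum_first3 _ _ (fun k => 3^-1 *: match k with
  | 0 => 1%:M | 1 => umx *m umx^T | 2 => vmx *m vmx^T | _ => 0 end)).
- by rewrite [umx *m umx^T]u2 [vmx *m vmx^T]v2 s3.
- move=> j /=; rewrite trmx_scale -scalemxAl -scalemxAr scalerA -expr2.
  rewrite expander_scale_sqr; congr (_ *: _).
  by case: (val j) => [|[|[|k]]]; rewrite ?trmx1 ?mul1mx ?mul0mx.
- by move=> k; rewrite scaler0.
Qed.

Lemma hs_conj_orth N (M : 'M[R]_N) (A : 'M[R[i]]_N) :
  M^T *m M = 1%:M -> hs (cmx M *m A *m adjm (cmx M)) = hs A.
Proof.
move=> M1; have cM : adjm (cmx M) *m cmx M = 1%:M.
  by rewrite adjm_cmx /cmx -map_mxM M1 map_mx1.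
apply: complexI; rewrite -!hs_tr !adjmM !adjmK !mulmxA.
rewrite -(mulmxA (cmx M *m A)) cM mulmx1 -!mulmxA mxtrace_mulC -!mulmxA cM.
by rewrite mulmx1.
Qed.

(** If the pairing were almost one, then [A], [u A u^*] and [v A v^*] would all be
    close to [B], hence [A] would almost commute with [u] and [v]. *)
Lemma expander_quantum_gap p (g : R) : (36 * p <= #|{: W}|)%N ->
  0 < g -> 1000 * (1000 * (1000 * g)) = 1 ->
  quantum_gap (tmx expander_tuple) p g.
Proof.
move=> pW g0 gE x y xx yy ys; set A := y *m adjm y in yy *; set B := x *m adjm x in xx *.
have [u1 _] := signed_perm_mx_orth R (@slot_sign e) (@slot_perm_inj e).
have [v1 _] := signed_perm_mx_orth R (fun=> false) (@slot_shift_inj e).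
pose uA := cmx umx *m A *m adjm (cmx umx).
pose vA := cmx vmx *m A *m adjm (cmx vmx).
have uA1 : hs uA = 1 by rewrite (@hs_conj_orth _ umx A u1).
have vA1 : hs vA = 1 by rewrite (@hs_conj_orth _ vmx A v1).
rewrite (@sum_first3 _ _ (fun k => 3^-1 * match k with
  | 0 => rd A B | 1 => rd uA B | 2 => rd vA B | _ => 0 end)); last first.
- by move=> k; rewrite mulr0.
- move=> j /=; rewrite /cmx map_mxZ /= -/(cmx _).
  have aZ (M : 'M[R[i]]_#|{: slots}|) :
      adjm (expander_scale%:C%C *: M) = expander_scale%:C%C *: adjm M.
    apply/matrixP => k l; rewrite !mxE rmorphM; congr (_ * _).
    exact: conjc_real.
  rewrite aZ -!scalemxAl -scalemxAr scalerA -rmorphM -expr2 rdZl.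
  rewrite expander_scale_sqr; congr (_ * _).
  case: (val j) => [|[|[|k]]] //.
    rewrite /cmx map_mx1 mul1mx (_ : adjm 1%:M = 1%:M) ?mulmx1//.
    by rewrite /adjm trmx1 map_mx1.
  by rewrite /cmx map_mx0 !mul0mx /rd mul0mx mxtrace0.
rewrite leNgt; apply/negP => h.
have [A1 [A2 A3]] : 1 - 3 * g <= rd A B /\ 1 - 3 * g <= rd uA B /\
    1 - 3 * g <= rd vA B.
  have := rd_le A B; have := rd_le uA B; have := rd_le vA B; move: h.
  rewrite uA1 vA1 xx yy; move: (rd A B) (rd uA B) (rd vA B) => r0 r1 r2.
  by clear -R; move=> *; split; [|split]; lra.
have near (Z : 'M[R[i]]_#|{: slots}|) : hs Z = 1 ->
    1 - 3 * g <= rd Z B -> hs (Z - A) <= 24 * g.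
  move=> Z1 ZB; have -> : Z - A = (Z - B) + (B - A) by rewrite addrA subrK.
  apply: le_trans (hsD_le _ _) _; rewrite !hsB Z1 xx yy [rd B A]rdC.
  by move: A1 ZB; move: (rd A B) (rd Z B) => r0 r1; clear -R; move=> *; lra.
have := @uv_gap p y (24 * g) (near _ uA1 A2) (near _ vA1 A3).
rewrite -/A yy.
have w0 : 0 < #|{: W}|%:R :> R by rewrite ltr0n; apply/card_gt0P; exists 0.
have : hs y ^+ 2 / #|{: W}|%:R <= 36^-1.
  rewrite ler_pdivrMr// mulrC ler_pdivlMr//; apply: le_trans (_ : p%:R * 36 <= _).
    by rewrite ler_wpM2r.
  by rewrite -natrM mulnC ler_nat.
by move: gE; move: (hs y ^+ 2 / _) => r; clear -R; move=> *; lra.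
Qed.

End ExpanderTuple.

(** * Pairings of the tuples, and the theorem *)

Section Tests.
Variables (R : realType) (n : nat).
Implicit Types t : mtuple R n.

(** [U] is also a contraction of column vectors. *)
Lemma contraction_tr (U : 'M[R[i]]_n) : contraction_mx U ->
  forall w : 'I_n -> R[i],
    \sum_i nsq (\sum_j U i j * w j) <= \sum_j nsq (w j).
Proof.
move=> cU w; pose z i := \sum_j U i j * w j.
pose v : 'rV[R[i]]_n := \row_i (z i)^*%C.
have vE : rv v = \sum_i nsq (z i) by apply: eq_bigr => i _; rewrite mxE nsqJ.
rewrite -vE.
(* |Uw|^2 = <(Uw)^* U, w>, and (Uw)^* U is not longer than Uw. *)
have E : (rv v)%:C%C = \sum_j (v *m U) 0 j * w j.
  under [RHS]eq_bigr do rewrite mxE mulr_suml.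
  rewrite exchange_big rmorph_sum; apply: eq_bigr => i _ /=.
  rewrite -normr_nsq sqr_normc mxE conjcK {2}/z mulr_sumr.
  by apply: eq_bigr => j _; rewrite mulrA.
have := nsq_sum_le (fun j => (v *m U) 0 j) w.
rewrite -E nsq_real -/(rv (v *m U)) => h.
have := le_trans h (ler_wpM2r (sumr_ge0 _ (fun j _ => nsq_ge0 (w j))) (cU v)).
have [->|vn] := eqVneq (rv v) 0; first by move=> _; apply: sumr_ge0 => j _; exact: nsq_ge0.
by rewrite expr2 ler_pM2l// lt0r vn rv_ge0.
Qed.

Lemma contraction_trmx (U : 'M[R[i]]_n) : contraction_mx U -> contraction_mx U^T.
Proof.
move=> cU v; have := contraction_tr cU (fun j => v 0 j).
apply: le_trans; apply: ler_sum => i _; rewrite mxE le_eqVlt; apply/orP; left.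
by apply/eqP; congr nsq; apply: eq_bigr => j _; rewrite mxE mulrC.
Qed.

(** The transposes of the matrices of [t], rotated by [U]. *)
Definition rot_tr t (U : 'M[R[i]]_n) (i : 'I_n) : 'M[R[i]]_t :=
  \sum_j U i j *: cmx (tmx t j)^T.

Lemma hs_tr_mx p q (A : 'M[R[i]]_(p, q)) : hs A^T = hs A.
Proof.
by rewrite hs_cols; apply: eq_bigr => i _; apply: eq_bigr => j _; rewrite mxE.
Qed.

Lemma tr_cmx p q (M : 'M[R]_(p, q)) : (cmx M)^T = cmx M^T.
Proof. by rewrite /cmx map_trmx. Qed.

Lemma hs_sum_cmx p q (a : 'I_n -> 'M[R]_p) (A : 'M[R[i]]_(p, q)) :
  \sum_j (a j)^T *m a j = 1%:M -> \sum_j hs (cmx (a j) *m A) = hs A.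
Proof.
move=> a1; have E (B : 'M[R[i]]_(p, q)) : hs B = \sum_k vn (col k B).
  by rewrite hs_cols; apply: eq_bigr => k _; apply: eq_bigr => i _; rewrite mxE.
rewrite E; under eq_bigr do rewrite E.
rewrite exchange_big; apply: eq_bigr => k _.
by under eq_bigr do rewrite colE -mulmxA -colE; exact: vn_sum_cmx.
Qed.

Lemma hs_contraction_le p q (U : 'M[R[i]]_n) (A : 'I_n -> 'M[R[i]]_(p, q)) :
  contraction_mx U -> \sum_i hs (\sum_j U i j *: A j) <= \sum_j hs (A j).
Proof.
move=> cU; rewrite exchange_big [leRHS]exchange_big; apply: ler_sum => k _ /=.
rewrite exchange_big [leRHS]exchange_big; apply: ler_sum => l _ /=.
have := contraction_tr cU (fun j => A j k l).
apply: le_trans; rewrite le_eqVlt; apply/orP; left; apply/eqP.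
apply: eq_bigr => i _; congr nsq; rewrite summxE; apply: eq_bigr => j _.
by rewrite mxE.
Qed.

Lemma rot_tr_l t (U : 'M[R[i]]_n) q (P : 'M[R[i]]_(t, q)) : bistochastic t ->
  contraction_mx U -> \sum_i hs (rot_tr t U i *m P) <= hs P.
Proof.
move=> [_ t2] cU; have t2' : \sum_j ((tmx t j)^T)^T *m (tmx t j)^T = 1%:M.
  by under eq_bigr do rewrite trmxK.
rewrite -(hs_sum_cmx P t2').
apply: le_trans (hs_contraction_le (fun j => cmx (tmx t j)^T *m P) cU).
rewrite le_eqVlt; apply/orP; left; apply/eqP; apply: eq_bigr => i _; congr hs.
by rewrite mulmx_suml; apply: eq_bigr => j _; rewrite -scalemxAl.
Qed.

Lemma rot_tr_r t (U : 'M[R[i]]_n) q (P : 'M[R[i]]_(q, t)) : bistochastic t ->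
  contraction_mx U -> \sum_i hs (P *m rot_tr t U i) <= hs P.
Proof.
move=> [t1 _] cU; rewrite -(hs_tr_mx P) -(hs_sum_cmx P^T t1).
apply: le_trans (hs_contraction_le (fun j => cmx (tmx t j) *m P^T) cU).
rewrite le_eqVlt; apply/orP; left; apply/eqP; apply: eq_bigr => i _.
rewrite -hs_tr_mx; congr hs; rewrite /rot_tr mulmx_sumr raddf_sum.
apply: eq_bigr => j _; rewrite -scalemxAr /= linearZ /= trmx_mul.
by rewrite tr_cmx trmxK.
Qed.

(** The matrix of coefficients [X = t] itself: paired with [t] it is the matrix of
    [sum_j a_j (x) a_j], which maps the normalized identity to itself. *)
Definition test_mx t (i j : 'I_t) : 'rV[R[i]]_n :=
  \row_l (tmx t l i j)%:C%C.

Lemma test_mx_ge t (s : R) : bistochastic t -> (0 < t)%N -> 0 <= s ->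
  tnorm_le t (test_mx (t := t)) s -> 1 <= s.
Proof.
move=> [_ t2] t0 s0 /(_ (fun j => delta_mx j 0)).
have E i : \sum_j amat t (test_mx i j) *m delta_mx j 0 = delta_mx i 0 :> 'cV_t.
  apply/matrixP => r k; rewrite summxE !mxE ord1 eqxx andbT.
  transitivity (\sum_l \sum_j (tmx t l i j * tmx t l r j)%:C%C : R[i]).
    rewrite exchange_big; apply: eq_bigr => j _.
    rewrite -colE mxE /amat summxE; apply: eq_bigr => l _.
    by rewrite !mxE rmorphM.
  have /matrixP /(_ i r) := t2; rewrite summxE !mxE => h.
  rewrite eq_sym -[RHS](rmorph_nat (real_complex R)) -h rmorph_sum.
  apply: eq_bigr => l _; rewrite mxE rmorph_sum; apply: eq_bigr => j _.
  by rewrite mxE.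
have v1 (i : 'I_t) : vn (delta_mx i 0 : 'cV[R[i]]_t) = 1.
  rewrite /vn (bigD1 i)//= big1 => [|j /negbTE ji].
    by rewrite mxE !eqxx addr0 (nsq_real 1) expr1n.
  by rewrite mxE ji nsq0.
under eq_bigr do rewrite E v1.
under [X in _ * X]eq_bigr do rewrite v1.
rewrite sumr_const card_ord => h.
have tp : 0 < t%:R :> R by rewrite ltr0n.
have : 1 <= s ^+ 2 by rewrite -(ler_pM2r tp) mul1r.
by rewrite -{1}(expr1n R 2) ler_pXn2r ?nnegrE.
Qed.

(** The pairing is the map [Z |-> sum_l a_l Z b_l], where the rows of [Z] are the
    components of [xi]. *)
Lemma test_mx_pairing t t' (U : 'M[R[i]]_n) (xi : 'I_t -> 'cV[R[i]]_t') :
  \sum_i vn (\sum_j amat t' (test_mx i j *m U) *m xi j) =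
  hs (\sum_l cmx (tmx t l) *m (\matrix_(j, r) xi j r 0) *m rot_tr t' U l).
Proof.
apply: eq_bigr => i _; apply: eq_bigr => r _; congr nsq.
rewrite !summxE.
transitivity (\sum_j \sum_l \sum_k \sum_q
   (tmx t l i j)%:C%C * U l k * ((tmx t' k r q)%:C%C * xi j q 0)).
  apply: eq_bigr => j _; rewrite /amat mulmx_suml summxE exchange_big.
  apply: eq_bigr => k _; rewrite -scalemxAl !mxE mulr_suml; apply: eq_bigr => l _.
  rewrite !mxE mulr_sumr; apply: eq_bigr => q _; by rewrite !mxE.
rewrite exchange_big; apply: eq_bigr => l _ /=.
rewrite -mulmxA mxE; apply: eq_bigr => j _.
rewrite mxE [in RHS]mxE mulr_sumr exchange_big; apply: eq_bigr => q _ /=.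
rewrite mxE /rot_tr summxE !mulr_sumr; apply: eq_bigr => k _.
by rewrite !mxE; ring.
Qed.

Lemma hs_xi p q (xi : 'I_p -> 'cV[R[i]]_q) :
  hs (\matrix_(j, r) xi j r 0) = \sum_j vn (xi j).
Proof. by apply: eq_bigr => j _; apply: eq_bigr => r _; rewrite mxE. Qed.

Section Pairing.
Variables (delta : R) (d2 : delta <= 2).

(** Whichever of [t] and [t'] has the larger dimension provides the gap. *)
Lemma test_mx_le_big t t' (U : 'M[R[i]]_n) : bistochastic t' ->
  quantum_gap (tmx t) t' delta -> contraction_mx U ->
  tnorm_le t' (fun i j => test_mx (t := t) i j *m U) (1 - delta / 2).
Proof.
move=> b' tg cU xi; rewrite test_mx_pairing -hs_xi.
apply: (hs_mul_le _ tg d2) => P; first exact: rot_tr_l.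
exact: rot_tr_r.
Qed.

Lemma test_mx_le_small t t' (U : 'M[R[i]]_n) : bistochastic t ->
  quantum_gap (tmx t') t delta -> contraction_mx U ->
  tnorm_le t' (fun i j => test_mx (t := t) i j *m U) (1 - delta / 2).
Proof.
move=> b tg cU xi; rewrite test_mx_pairing -hs_xi -hs_tr_mx -(hs_tr_mx (\matrix_(j, r) _)).
set Z := \matrix_(j, r) _.
rewrite (_ : (\sum_l _)^T = \sum_l cmx (tmx t' l) *m Z^T *m rot_tr t U^T l).
  apply: (hs_mul_le _ tg d2) => P; first exact: rot_tr_l _ (contraction_trmx cU).
  exact: rot_tr_r _ (contraction_trmx cU).
transitivity (\sum_l \sum_k U l k *: (cmx (tmx t' k) *m Z^T *m cmx (tmx t l)^T)).
  rewrite raddf_sum; apply: eq_bigr => l _ /=; rewrite /rot_tr mulmx_sumr raddf_sum.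
  apply: eq_bigr => k _ /=; rewrite -scalemxAr linearZ /= !trmx_mul mulmxA.
  by rewrite !tr_cmx trmxK.
rewrite exchange_big; apply: eq_bigr => k _ /=.
rewrite /rot_tr mulmx_sumr; apply: eq_bigr => l _.
by rewrite -scalemxAr mxE.
Qed.

End Pairing.
End Tests.

Lemma card_vector_pairs e :
  #|{: 'rV[bool]_e.+1 * 'rV[bool]_e.+1}| = (4 ^ e.+1)%N.
Proof. by rewrite card_prod !card_mx card_bool !mul1n -expnMn. Qed.

Theorem mainTheorem7 (R : realType) (n : nat) (hn : (2 < n)%N) :
  ~ separable_subset (@delta_cb R n) (@HH R n).
Proof.
case: n hn => [//|[//|[//|n]]] _.
pose e m := (5 * m + 5)%N.
pose a m : mtuple R n.+3 := expander_tuple R n (e m).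
have a_bi m : bistochastic (a m) by exact: expander_bistochastic.
have [g [g0 gE]] : exists g : R, 0 < g /\ 1000 * (1000 * (1000 * g)) = 1.
  have K (x : R) : 0 < x -> exists g : R, 0 < g /\ x * (x * (x * g)) = 1.
    move=> x0; exists (x^-1 * (x^-1 * x^-1)); split; last first.
      by field; rewrite gt_eqF.
    by rewrite !mulr_gt0// invr_gt0.
  by apply: K; rewrite ltr0n.
have g1 : g < 1 by lra.
have dimE m : (a m : nat) = (9 * 4 ^ (e m).+1)%N.
  by rewrite /a /= card_prod card_ord card_vector_pairs.
have gap m m' : (m' < m.+1)%N ->
    quantum_gap (tmx (a m)) (tup a m') (g).
  move=> mm'; apply: expander_quantum_gap => //; rewrite card_vector_pairs.
  case: m' mm' => [_|m' mm'].
    rewrite [tup a 0]/(scalar_tuple R n.+2) /=.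
    by rewrite muln1; apply: (@leq_trans (4 ^ 3)) => //; rewrite leq_exp2l// /e; lia.
  rewrite [tup a m'.+1]/(a m') dimE.
  apply: (@leq_trans (4 ^ 5 * 4 ^ (e m').+1)); first by rewrite mulnA leq_mul2r orbT.
  by rewrite -expnD leq_exp2l// /e; lia.
have r01 : 0 < 1 - g / 2 < 1 by apply/andP; split; lra.
apply: (nonseparable_of_family a_bi r01) => m.
exists (a m : nat), (test_mx (t := a m)); split=> [s s0|m' U mm' cU].
  by apply: (test_mx_ge (a_bi m)) => //; rewrite dimE muln_gt0 expn_gt0.
have gs2 : g <= 2 by lra.
have [lt|gt|eq] := ltngtP m' m.+1; last by rewrite eq eqxx in mm'.
  by apply: test_mx_le_big => //; [exact: tup_bi|exact: gap].
case: m' mm' gt => [//|m'] _ gt.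
by apply: test_mx_le_small => //; exact: (gap m' m.+1).
Qed.
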